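(* Let $\mathcal P=\{\mathbb P_X\mathbb P_{Y\mid X}:\mathbb P_X\in\mathcal P_X,\ \mathbb P_{Y\mid X}\in\mathcal P_{Y\mid X}\}$, $\mathbb P^*=\mathbb P_X^*\mathbb P_{Y\mid X}^*\in\mathcal P$, and let $\theta:\mathcal P\to\Theta\subseteq\mathbb R^p$ have efficient influence function $\varphi^*_{\eta^*}(z)$ at $\mathbb P^*$ relative to $\mathcal P$, where $\eta:\mathcal P\to\Omega$ is a functional into a metric space $(\Omega,\rho)$ and $\eta^*=\eta(\mathbb P^* )$. If $\theta(\cdot)$ is well-specified at $\mathbb P^*_{Y\mid X}$ relative to $\mathcal P_X$, then $$\phi^*_{\eta^*}(X):=\mathbb E[\varphi^*_{\eta^*}(Z)\mid X]=0\qquad\mathbb P_X^*\text{-almost surely}.$$ Moreover, if in addition the tangent space at $\mathbb P_X^*$ relative to $\mathcal P_X$ is $\mathcal T_{\mathcal P_X}(\mathbb P_X^* )=\mathcal L^2_{1,0}(\mathbb P_X^* )$, then any influence function $\varphi_{\eta^*}$ of a regular (relative to $\mathcal P$) and asymptotically linear estimator of $\theta^*=\theta(\mathbb P^* )$ satisfies $$\mathbb E[\varphi_{\eta^*}(Z)\mid X]=0\qquad\mathbb P_X^*\text{-almost surely}.$$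
   Context: $Z=(X,Y)\in\mathcal Z=\mathcal X\times\mathcal Y$, $Z\sim\mathbb P^*=\mathbb P^*_X\mathbb P^*_{Y\mid X}$. All models are dominated by a common measure; $\mathbb P^*_X\in\mathcal P_X$, $\mathbb P^*_{Y\mid X}\in\mathcal P_{Y\mid X}$. $\mathcal L^2_{p,0}(\mathbb P)$: square-integrable mean-zero $\mathbb R^p$-valued functions under $\mathbb P$. Well-specification: $\theta(\cdot)$ is well-specified at $\mathbb P_{Y\mid X}^*$ relative to $\mathcal P_X$ if $\theta(\mathbb P_X^*\mathbb P^*_{Y\mid X})=\theta(\mathbb P_X\mathbb P^*_{Y\mid X})$ for every $\mathbb P_X\in\mathcal P_X$. For a model $\mathcal M$ containing a distribution $\mathbb P^*$: a one-dimensional regular parametric sub-model is a family $\{\mathbb P_t:t\in T\subset\mathbb R\}\subset\mathcal M$ with $\mathbb P_{t^*}=\mathbb P^*$, differentiable in quadratic mean at $t^*$, with score $s_{t^*}\in\mathcal L^2_{1,0}(\mathbb P^* )$; the tangent space $\mathcal T_{\mathcal M}(\mathbb P^* )$ is the closed linear span of all such scores (likewise $\mathcal T_{\mathcal P_X}(\mathbb P_X^* )$ for the marginal model). $D\in\mathcal L^2_{p,0}(\mathbb P^* )$ is a gradient of $\theta$ at $\mathbb P^*$ relative to $\mathcal M$ if $\frac{d}{dt}\theta(\mathbb P_t)|_{t=t^*}=\mathbb E[D(Z)s_{t^*}(Z)]$ for every such sub-model; it is the efficient influence function if moreover $a^\top D\in\mathcal T_{\mathcal M}(\mathbb P^* )$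 for all $a\in\mathbb R^p$. An estimator $\hat\theta_n$ based on $Z_1,\dots,Z_n$ i.i.d. $\mathbb P^*$ is asymptotically linear with influence function $\varphi\in\mathcal L^2_{p,0}(\mathbb P^* )$ if $\sqrt n(\hat\theta_n-\theta^* )=n^{-1/2}\sum_{i=1}^n\varphi(Z_i)+o_p(1)$; it is regular relative to $\mathcal M$ if for every such sub-model and every $h\in\mathbb R$, $\sqrt n[\hat\theta_n-\theta(\mathbb P_{t^*+h/\sqrt n})]$ converges in distribution under $\mathbb P_{t^*+h/\sqrt n}$ to a law not depending on $h$. *)

(* Defs.v *)
From HB Require Import structures.
From mathcomp Require Import all_boot all_order all_algebra.
From mathcomp Require Import all_classical all_reals all_analysis measurable_realfun.

Set Implicit Arguments.
Unset Strict Implicit.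
Unset Printing Implicit Defensive.

Import Order.TTheory GRing.Theory Num.Theory.
Import numFieldNormedType.Exports.

Local Open Scope classical_set_scope.
Local Open Scope charge_scope.
Local Open Scope ring_scope.

(* A term of type [probability T R] also assigns values to non-measurable sets;
   these are meaningless, so distributions are compared on measurable sets. *)
Definition same_law d (T : measurableType d) (R : realType)
    (P Q : probability T R) : Prop :=
  forall A, measurable A -> P A = Q A.

Section joint_law.
Context d d' (X : measurableType d) (Y : measurableType d') (R : realType).
Variables (PX : probability X R) (k : R.-pker X ~> Y).
Local Open Scope ereal_scope.

Definition joint (A : set (X * Y)) : \bar R := \int[PX]_x k x (xsection A x).

Let joint0 : joint set0 = 0.
Proof. by apply: integral0_eq => x _; rewrite xsection0 measure0. Qed.

Let joint_ge0 A : 0 <= joint A.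
Proof. exact: integral_ge0. Qed.

Let joint_sigma_additive : semi_sigma_additive joint.
Proof.
move=> F mF tF mUF.
have -> : joint (\bigcup_n F n) = \sum_(n <oo) joint (F n).
  rewrite /joint -integral_nneseries//; last first.
    by move=> n; apply: measurable_fun_xsection_finite_kernel; rewrite inE.
  apply: eq_integral => x _; rewrite xsection_bigcup measure_bigcup//.
  - by apply: eq_eseriesl => n; rewrite in_setT.
  - by move=> n _; exact: measurable_xsection.
  - exact: trivIset_xsection.
by apply: is_cvg_nneseries => n _ _; exact: joint_ge0.
Qed.

HB.instance Definition _ := isMeasure.Build _ _ _ joint
  joint0 joint_ge0 joint_sigma_additive.

Let joint_setT : joint setT = 1.
Proof.
rewrite /joint (eq_integral (cst 1)).
  by rewrite integral_cst// mul1e; exact: probability_setT.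
move=> x _; rewrite (_ : xsection _ _ = setT) ?prob_kernel//.
by apply/seteqP; split => // y _; rewrite /xsection /= in_setT.
Qed.

HB.instance Definition _ := Measure_isProbability.Build _ _ _ joint joint_setT.

(* P_X P_{Y|X}: the law of (X, Y) when X ~ PX and Y | X = x ~ k x. *)
Definition joint_law : probability (X * Y)%type R := joint.

End joint_law.

Definition joint_model d d' (X : measurableType d) (Y : measurableType d')
    (R : realType) (MX : set (probability X R)) (MK : set (R.-pker X ~> Y)) :
    set (probability (X * Y)%type R) :=
  [set P | exists PX k, [/\ MX PX, MK k & same_law P (joint_law PX k)]].

Definition well_specified d d' (X : measurableType d) (Y : measurableType d')
    (R : realType) (V : Type) (theta : probability (X * Y)%type R -> V)
    (k : R.-pker X ~> Y) (MX : set (probability X R)) (PXstar : probability X R)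
    : Prop :=
  forall PX, MX PX -> theta (joint_law PXstar k) = theta (joint_law PX k).

Section scores.
Context d (T : measurableType d) (R : realType).
Implicit Types (P : probability T R) (s : T -> R) (M : set (probability T R)).

Definition L20 P : set (T -> R) := [set s | s \in Lfun P 2%:E /\ ('E_P[s] = 0)%E].

Definition L20_vec p P (D : T -> 'rV[R]_p) : Prop :=
  forall j, L20 P (fun z => D z ord0 j).

Variable mu : {sigma_finite_measure set T -> \bar R}.

Definition density P (z : T) : R :=
  fine (('d (charge_of_finite_measure P) '/d mu) z).

Definition dqm (P_ : R -> probability T R) (tstar : R) s : Prop :=
  (((t - tstar) ^- 2)%:E *
   \int[mu]_z ((Num.sqrt (density (P_ t) z) - Num.sqrt (density (P_ tstar) z)
                - (t - tstar) / 2 * s z * Num.sqrt (density (P_ tstar) z)) ^+ 2)%:E)%E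
    @[t --> tstar^'] --> 0%E.

(* Values of P_ outside the parameter set D are irrelevant.  Since D is a
   neighbourhood of tstar, two-sided derivatives at tstar make sense and
   tstar + h / sqrt n eventually belongs to D, for every h. *)
Definition regular_submodel M P (D : set R) (tstar : R)
    (P_ : R -> probability T R) s : Prop :=
  [/\ nbhs tstar D, forall t, D t -> M (P_ t), same_law (P_ tstar) P,
      dqm P_ tstar s & L20 P s].

Definition is_score M P s : Prop :=
  exists (D : set R) (tstar : R) (P_ : R -> probability T R),
    regular_submodel M P D tstar P_ s.

(* The closed linear span of the scores in L^2(P); it is saturated under
   P-a.e. equality, elements of L^2 being represented by functions. *)
Definition tangent_space M P : set (T -> R) :=
  [set g | g \in Lfun P 2%:E /\
    forall e : R, 0 < e -> exists n (c : 'I_n -> R) (s : 'I_n -> T -> R),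
      (forall i, is_score M P (s i)) /\
      ('N[P]_2%:E[EFin \o (fun z => g z - \sum_(i < n) c i * s i z)%R] < e%:E)%E].

Section influence.
Context (p : nat).
Implicit Types (theta : probability T R -> 'rV[R]_p) (D : T -> 'rV[R]_p).

Definition is_gradient M P theta D : Prop :=
  L20_vec P D /\
  forall (E : set R) (tstar : R) (P_ : R -> probability T R) s,
    regular_submodel M P E tstar P_ s ->
    is_derive tstar (1 : R) (fun t => theta (P_ t))
      (\row_j fine ('E_P[(fun z => D z ord0 j * s z)%R])%E).

Definition is_eif M P theta D : Prop :=
  is_gradient M P theta D /\
  forall a : 'rV[R]_p,
    tangent_space M P (fun z => \sum_j a ord0 j * D z ord0 j).

End influence.

End scores.

Section iid_sample.
Context d (T : measurableType d) (R : realType).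

Definition tuple_cons n (x : T * n.-tuple T) : n.+1.-tuple T :=
  [tuple of x.1 :: x.2].

Let measurable_tuple_cons n : measurable_fun setT (@tuple_cons n).
Proof. exact: measurable_cons. Qed.

HB.instance Definition _ n :=
  isMeasurableFun.Build _ _ _ _ (@tuple_cons n) (@measurable_tuple_cons n).

(* The n-fold product of P, i.e. the law of an i.i.d. sample of size n. *)
Fixpoint iid_law (P : probability T R) n : probability (n.-tuple T) R :=
  match n with
  | 0 => \d_([tuple] : 0.-tuple T)
  | m.+1 => distribution (P \x iid_law P m)%E (@tuple_cons m)
  end.

Lemma iid_lawE (P : probability T R) n (A : 'I_n -> set T) :
  (forall i, measurable (A i)) ->
  iid_law P n [set t | forall i, A i (tnth t i)] = (\prod_(i < n) P (A i))%E.
Proof.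
elim: n A => [|n IH] A mA /=.
  rewrite big_ord0 diracE mem_set//= => -[]//.
rewrite /distribution /pushforward big_ord_recl.
rewrite -IH; last by move=> i; exact: mA.
rewrite -product_measure1E//.
  congr ((P \x iid_law P n)%E _); apply/seteqP; split => -[x t] /=.
    move=> h; split; first by have := h ord0; rewrite tnth0.
    by move=> i; have := h (lift ord0 i); rewrite tnthS.
  by move=> [hx ht] i; case: (unliftP ord0 i) => [j ->|->]; rewrite ?tnthS ?tnth0.
rewrite (_ : [set t | _] =
    \bigcap_(i in setT) ((@tnth n T ^~ i) @^-1` A (lift ord0 i))).
  apply: fin_bigcap_measurable => // i _.
  by rewrite -[X in measurable X]setTI; exact: measurable_tnth.
by apply/seteqP; split => t /= h i; [move=> _|]; exact: h.
Qed.

End iid_sample.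

Section estimators.
Context d (T : measurableType d) (R : realType) (p : nat).
Implicit Types (That : forall n, n.-tuple T -> 'rV[R]_p).

Definition is_estimator That : Prop :=
  forall n j, measurable_fun setT (fun t : n.-tuple T => That n t ord0 j).

Definition borel_rV := g_sigma_algebraType (@open 'rV[R]_p).

Definition cvg_in_law (Q : forall n, probability (n.-tuple T) R)
    (W : forall n, n.-tuple T -> 'rV[R]_p) (L : probability borel_rV R) : Prop :=
  forall f : 'rV[R]_p -> R, continuous f -> (exists B, forall x, `|f x| <= B) ->
    (\int[Q n]_t (f (W n t))%:E)%E @[n --> \oo] --> (\int[L]_x (f x)%:E)%E.

Definition is_asymp_linear (P : probability T R) (theta0 : 'rV[R]_p) That
    (phi : T -> 'rV[R]_p) : Prop :=
  L20_vec P phi /\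
  forall e : R, 0 < e ->
    iid_law P n [set t | e < `| Num.sqrt n%:R *: (That n t - theta0)
      - (Num.sqrt n%:R)^-1 *: \sum_(i < n) phi (tnth t i) | ]
    @[n --> \oo] --> 0%E.

Definition is_regular (mu : {sigma_finite_measure set T -> \bar R})
    (M : set (probability T R)) (P : probability T R)
    (theta : probability T R -> 'rV[R]_p) That : Prop :=
  forall D tstar P_ s, regular_submodel mu M P D tstar P_ s ->
  exists L : probability borel_rV R, forall h : R,
    let Pn n := P_ (tstar + h / Num.sqrt n%:R) in
    cvg_in_law (fun n => iid_law (Pn n) n)
      (fun n t => Num.sqrt n%:R *: (That n t - theta (Pn n))) L.

End estimators.

Section conditional_expectation.
Context d d' (X : measurableType d) (Y : measurableType d') (R : realType).
Variable P : probability (X * Y)%type R.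
Local Open Scope ereal_scope.

(* g(X) is a version of E[f(X, Y) | X] under P. *)
Definition is_cond_exp (f : X * Y -> R) (g : X -> R) : Prop :=
  [/\ measurable_fun setT g,
      P.-integrable setT (fun z => (g z.1)%:E) &
      forall A, measurable A ->
        \int[P]_(z in fst @^-1` A) (g z.1)%:E = \int[P]_(z in fst @^-1` A) (f z)%:E].

Lemma is_cond_exp_exists (f : X * Y -> R) :
  P.-integrable setT (EFin \o f) -> exists g, is_cond_exp f g.
Proof.
move=> intf.
have mfst : measurable_fun setT (@fst X Y) by exact: measurable_fst.
pose fstm : {mfun (X * Y)%type >-> X} := mfun_Sub (mem_set mfst).
pose PX : probability X R := distribution P fstm.
have mfstm : measurable_fun setT fstm by [].
pose nu0 : {charge set X -> \bar R} :=
  pushforward (induced_charge intf) fstm.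
pose nu := nu0 mfstm.
have nuPX : nu `<< PX.
  apply/null_content_dominatesP => A mA PA.
  rewrite /nu /= /pushforward /induced_charge.
  apply: null_set_integral => //.
    by rewrite -[Z in measurable Z]setTI; exact: (mfst measurableT A mA).
  by apply: (measurable_funS _ _ (measurable_int P intf)).
pose g x := fine ('d nu '/d PX x).
have gE x : (g x)%:E = ('d nu '/d PX x).
  by rewrite fineK//; exact: Radon_Nikodym_fin_num.
have intg : PX.-integrable setT (EFin \o g).
  apply: (eq_integrable _ _ _ _ (Radon_Nikodym_integrable nuPX)) => // x _.
  by rewrite /= gE.
have mg : measurable_fun setT g.
  by apply/measurable_EFinP; exact: (measurable_int PX intg).
have intg1 : P.-integrable setT (fun z => (g z.1)%:E).
  apply/integrableP; split.
    by apply/measurable_EFinP; exact: (measurableT_comp mg mfst).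
  have /integrableP[_] := intg; apply: le_lt_trans.
  by rewrite ge0_integral_pushforward//; apply: measurableT_comp => //;
    apply/measurable_EFinP.
exists g; split => //.
move=> A mA.
have -> : \int[P]_(z in fst @^-1` A) (f z)%:E = nu A by [].
rewrite (Radon_Nikodym_integral nuPX mA).
under [RHS]eq_integral do rewrite -gE.
rewrite integral_pushforward//; first exact/measurable_EFinP.
apply: (integrableS measurableT _ _ intg1) => //.
by rewrite -[Z in measurable Z]setTI; exact: (mfst measurableT A mA).
Qed.

Definition is_cond_exp_vec p (f : X * Y -> 'rV[R]_p) (g : X -> 'rV[R]_p) : Prop :=
  forall j, is_cond_exp (fun z => f z ord0 j) (fun x => g x ord0 j).

End conditional_expectation.

(* Main.v *)
Require Import Defs.
From HB Require Import structures.
From mathcomp Require Import all_boot all_order all_algebra.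
From mathcomp Require Import all_classical all_reals all_analysis measurable_realfun.
From mathcomp Require Import ring lra.

Set Implicit Arguments.
Unset Strict Implicit.
Unset Printing Implicit Defensive.

Import Order.TTheory GRing.Theory Num.Theory.
Import numFieldNormedType.Exports.

Local Open Scope classical_set_scope.
Local Open Scope ring_scope.

(** Write [g x] for the conditional mean [E[psi(Z) | X = x]], computed with the
    fixed kernel.  If [s] is the score of a marginal submodel [PX_t], then
    [(x, y) |-> s x] is the score of [PX_t kstar], a path in the joint model
    along which [theta] is constant by well-specification.

    If [psi] is a gradient, differentiating along this path gives [E[psi s] = 0].
    Conversely a score of the joint model projects to a score of the marginal
    model, because marginalisation contracts the Hellinger distance; so the
    components of [g] are orthogonal to every joint score.  The efficient
    influence function lies in their closed span, hence [E[g ^ 2] = 0].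

    For a regular asymptotically linear estimator, put
    [W_n = sqrt n (That_n - theta0)].  As [theta] is constant along the path,
    regularity makes [lim E sin(W_n)] under [PX_(t0 + h / sqrt n) kstar]
    independent of [h].  A Hellinger bound shows that this limit is
    [exp(- E[psi ^ 2] / 2) sin(h E[psi s]) + O(h ^ 2)], so [E[psi s] = 0]; no
    contiguity or limit theorem is needed.  When the marginal scores
    span [L20], this gives [g = 0]. *)

(** No relation between [mu] and [nu] is assumed. In particular [mu] need not be a product, so the
    density of a joint law does not factor through that of its marginal. Lifting and projecting
    submodels therefore rest on identities between integrals of functions of [x], from which ratios
    of densities are recovered.

    For the estimator the obstacle is that the remainder of the linear expansion is small under the
    fixed law only, whereas regularity speaks of laws at distance of order [1 / sqrt n]. An event
    [A] satisfies [Q^n(A) <= 2 n H + 2 P^n(A)] as soon as [H <= 2] bounds the squared Hellinger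
    distance of [P] and [Q], and along the path [n H] is [O(h ^ 2)]. The error of this transfer does
    not vanish with [n], but it is of second order in [h], while the sine to be detected is of first
    order. Comparing [h] with [- h] removes the unknown limit. The sine is a good test function
    because it is bounded, Lipschitz and odd, and because the addition formulas reduce its
    expectation over an i.i.d. sum to the expectations of sine and cosine of one term. *)

Section joint_law_integral.
Context d d' (X : measurableType d) (Y : measurableType d') (R : realType).
Variables (PX : probability X R) (k : R.-pker X ~> Y).
Local Open Scope ereal_scope.
Import HBNNSimple.

Lemma measurable_kernel_integral (f : X * Y -> \bar R) :
  (forall z, 0 <= f z) -> measurable_fun setT f ->
  measurable_fun setT (fun x => \int[k x]_y f (x, y)).
Proof. by move=> f0 mf; exact: (@measurable_kfcomp _ _ _ _ _ k f). Qed.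

(** Tonelli's theorem for a kernel. For indicators it is the definition of [joint]; linearity gives
    simple functions, and monotone convergence along [nnsfun_approx] the rest. *)
Lemma ge0_integral_joint_law (f : X * Y -> \bar R) :
  (forall z, 0 <= f z) -> measurable_fun setT f ->
  \int[joint_law PX k]_z f z = \int[PX]_x \int[k x]_y f (x, y).
Proof.
move=> f0 mf.
have msec (g : X * Y -> \bar R) x : measurable_fun setT g ->
    measurable_fun setT (fun y => g (x, y)).
  by move=> mg; exact: measurableT_comp.
have indicE A : measurable A ->
    \int[joint_law PX k]_z (\1_A z)%:E = \int[PX]_x \int[k x]_y (\1_A (x, y))%:E.
  move=> mA; rewrite integral_indic// setIT; apply: eq_integral => x _.
  by have := congr1 (@^~ x) (kfcompkindic k mA); rewrite /kfcomp.
have nnsfunE (h : {nnsfun (X * Y)%type >-> R}) :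
    \int[joint_law PX k]_z (h z)%:E = \int[PX]_x \int[k x]_y (h (x, y))%:E.
  have m1 r : measurable_fun setT (fun z => (r * \1_(h @^-1` [set r]) z)%:E).
    by apply/measurable_EFinP; apply: measurable_funM.
  have pos1 r z : 0 <= (r * \1_(h @^-1` [set r]) z)%:E.
    by rewrite EFinM; exact: nnfun_muleindic_ge0.
  under eq_integral do rewrite fimfunE -fsumEFin//.
  rewrite ge0_integral_fsum//.
  transitivity (\int[PX]_x \sum_(r \in range h)
      \int[k x]_y (r * \1_(h @^-1` [set r]) (x, y))%:E); last first.
    apply: eq_integral => x _.
    rewrite -ge0_integral_fsum//; last by move=> r; exact: msec (m1 r).
    by apply: eq_integral => y _; rewrite fimfunE -fsumEFin.
  rewrite ge0_integral_fsum//; last 2 first.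
  - by move=> r; exact: (measurable_kernel_integral (pos1 r) (m1 r)).
  - by move=> r x _; exact: integral_ge0.
  apply: eq_fsbigr => r /[!inE] -[z _ hr].
  have r0 : (0 <= r)%R by rewrite -hr.
  have mi : measurable_fun setT (fun z => (\1_(h @^-1` [set r]) z)%:E : \bar R).
    exact/measurable_EFinP.
  under eq_integral do rewrite EFinM.
  rewrite ge0_integralZl//.
  rewrite indicE// -ge0_integralZl//; last 2 first.
  - apply: (@measurable_kernel_integral (fun z => (\1_(h @^-1` [set r]) z)%:E)) => //.
  - by move=> x _; apply: integral_ge0 => ? _; rewrite lee_fin.
  apply: eq_integral => x _; rewrite -ge0_integralZl//; exact: msec mi.
pose f_ := nnsfun_approx measurableT mf.
have mf_ n : measurable_fun setT (EFin \o f_ n) by exact/measurable_EFinP.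
have f_0 n z : 0 <= (f_ n z)%:E by rewrite lee_fin.
have f_nd z a b : (a <= b)%N -> (f_ a z)%:E <= (f_ b z)%:E.
  by move=> ab; rewrite lee_fin; exact/lefP/nd_nnsfun_approx.
have f_f z : (f_ n z)%:E @[n --> \oo] --> f z by exact: cvg_nnsfun_approx.
transitivity (limn (fun n => \int[joint_law PX k]_z (f_ n z)%:E)).
  rewrite -monotone_convergence//; last by move=> z _ a b; exact: f_nd.
  by apply: eq_integral => z _; apply/esym/cvg_lim => //; exact: f_f.
under eq_fun do rewrite nnsfunE.
rewrite -monotone_convergence//; last 3 first.
- by move=> n; exact: (measurable_kernel_integral (f_0 n) (mf_ n)).
- by move=> n x _; exact: integral_ge0.
- move=> x _ a b ab; apply: ge0_le_integral => //.
  + exact: msec (mf_ a).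
  + exact: msec (mf_ b).
  + by move=> y _; exact: f_nd.
apply: eq_integral => x _; rewrite -monotone_convergence//; last 2 first.
- by move=> n; exact: msec (mf_ n).
- by move=> y _ a b; exact: f_nd.
by apply: eq_integral => y _; apply/cvg_lim => //; exact: f_f.
Qed.

Lemma ge0_integral_joint_law_fst (h : X -> \bar R) :
  (forall x, 0 <= h x) -> measurable_fun setT h ->
  \int[joint_law PX k]_z h z.1 = \int[PX]_x h x.
Proof.
move=> h0 mh; rewrite ge0_integral_joint_law//; last first.
  exact: measurableT_comp mh measurable_fst.
by apply: eq_integral => x _; rewrite /= integral_cst// prob_kernel mule1.
Qed.

Lemma ge0_integral_joint_law_mul (h : X -> \bar R) (f : X * Y -> \bar R) :
  (forall x, 0 <= h x) -> measurable_fun setT h ->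
  (forall z, 0 <= f z) -> measurable_fun setT f ->
  \int[joint_law PX k]_z (h z.1 * f z) = \int[PX]_x (h x * \int[k x]_y f (x, y)).
Proof.
move=> h0 mh f0 mf; rewrite ge0_integral_joint_law//; last 2 first.
- by move=> z; exact: mule_ge0.
- by apply: emeasurable_funM => //; exact: measurableT_comp mh measurable_fst.
apply: eq_integral => x _ /=; rewrite ge0_integralZl//.
exact: measurableT_comp.
Qed.

End joint_law_integral.

(** Inversion is discontinuous at 0, but on nonnegative reals it is the power with exponent -1, the
    values at 0 included. *)
Lemma measurable_fun_inv d (T : measurableType d) (R : realType) (f : T -> R) :
  (forall x, 0 <= f x) -> measurable_fun setT f ->
  measurable_fun setT (fun x => (f x)^-1).
Proof.
move=> f0 mf; under eq_fun do rewrite -powR_inv1//.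
exact: (measurableT_comp (measurable_powR _) mf).
Qed.

(** * Densities, square integrability and conditional means *)

Section density.
Context d (T : measurableType d) (R : realType).
Variables (mu : {sigma_finite_measure set T -> \bar R}) (P : probability T R).
Hypothesis Pmu : P `<< mu.

Lemma measurable_density : measurable_fun setT (density mu P).
Proof.
apply: measurableT_comp => //; exact: measurable_int (Radon_Nikodym_integrable _ _).
Qed.

Definition sqrt_density (z : T) : R := Num.sqrt (density mu P z).

Lemma measurable_sqrt_density : measurable_fun setT sqrt_density.
Proof.
apply: measurableT_comp measurable_density.
exact: continuous_measurable_fun (@sqrt_continuous R).
Qed.

(** The change of variables is stated for the derivative of a measure, while [density] is that of a
    charge. The two agree almost everywhere, and only there is [density] known to be nonnegative,
    hence equal to the square of [sqrt_density]. *)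
Lemma ge0_integral_density (f : T -> \bar R) :
  (forall z, 0 <= f z)%E -> measurable_fun setT f ->
  (\int[P]_z f z = \int[mu]_z (f z * (sqrt_density z ^+ 2)%:E))%E.
Proof.
move=> f0 mf; rewrite -(Radon_Nikodym_SigmaFinite.change_of_variables Pmu)//.
have ae := ae_eq_Radon_Nikodym_SigmaFinite Pmu measurableT.
apply: ge0_ae_eq_integral => //.
- apply: emeasurable_funM => //.
  exact: measurable_int (Radon_Nikodym_SigmaFinite.f_integrable Pmu).
- apply: emeasurable_funM => //; apply/measurable_EFinP; apply: measurable_funX.
  exact: measurable_sqrt_density.
- by move=> z _; rewrite mule_ge0// Radon_Nikodym_SigmaFinite.f_ge0.
- by move=> z _; rewrite mule_ge0// lee_fin sqr_ge0.
apply: filterS ae => z /(_ I) fE _; congr (_ * _)%E.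
have fz0 := Radon_Nikodym_SigmaFinite.f_ge0 Pmu z.
have ffin := Radon_Nikodym_SigmaFinite.f_fin_num Pmu z.
rewrite /sqrt_density /density sqr_sqrtr -fE ?fine_ge0// fineK//.
Qed.

Lemma ge0_integral_sqrt_density (f : T -> R) :
  (forall z, 0 <= f z) -> measurable_fun setT f ->
  (\int[P]_z (f z)%:E = \int[mu]_z (f z * sqrt_density z ^+ 2)%:E)%E.
Proof.
move=> f0 mf; rewrite ge0_integral_density//.
exact/measurable_EFinP.
Qed.

End density.

Section Lfun2.
Context d (T : measurableType d) (R : realType) (P : probability T R).

Lemma Lfun2P (f : T -> R) : f \in Lfun P 2%:E <->
  measurable_fun setT f /\ (\int[P]_z (f z ^+ 2)%:E < +oo)%E.
Proof.
split.
  move=> L; split; first by move: L; rewrite inE => /andP[/[!inE]].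
  have /integrableP[_] := Lfun2_integrable_sqr L.
  apply: le_lt_trans; rewrite le_eqVlt; apply/orP; left; apply/eqP.
  by apply: eq_integral => z _ /=; rewrite ger0_norm ?sqr_ge0.
move=> [mf fi]; rewrite inE; apply/andP; split; rewrite inE//=.
rewrite /finite_norm unlock poweR_lty//.
rewrite (le_lt_trans _ fi)// le_eqVlt; apply/orP; left; apply/eqP.
apply: eq_integral => z _ /=; rewrite powR_mulrn ?normr_ge0//.
by rewrite -normrX ger0_norm ?sqr_ge0.
Qed.

End Lfun2.

Lemma integral_sqrD_le d (T : measurableType d) (R : realType)
    (m : {measure set T -> \bar R}) (f g : T -> R) :
  measurable_fun setT f -> measurable_fun setT g ->
  (\int[m]_z ((f z + g z) ^+ 2)%:E <=
   2%:E * \int[m]_z (f z ^+ 2)%:E + 2%:E * \int[m]_z (g z ^+ 2)%:E)%E.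
Proof.
move=> mf mg.
have msq (h : T -> R) : measurable_fun setT h ->
    measurable_fun setT (fun z => (h z ^+ 2)%:E).
  by move=> mh; apply/measurable_EFinP; exact: measurable_funX.
have sq0 (h : T -> R) z : (0 <= (h z ^+ 2)%:E)%E by rewrite lee_fin sqr_ge0.
have mf2 := msq _ mf; have mg2 := msq _ mg.
rewrite -!ge0_integralZl//.
rewrite -ge0_integralD//; last 4 first.
- by move=> z _; rewrite -EFinM lee_fin mulr_ge0 ?sqr_ge0.
- exact: measurable_funeM.
- by move=> z _; rewrite -EFinM lee_fin mulr_ge0 ?sqr_ge0.
- exact: measurable_funeM.
apply: ge0_le_integral => //.
- by move=> z _; rewrite lee_fin sqr_ge0.
- exact: (msq _ (measurable_funD mf mg)).
- by apply: emeasurable_funD; exact: measurable_funeM.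
- move=> z _; rewrite -!EFinM -EFinD lee_fin.
  by have := sqr_ge0 (f z - g z); nra.
Qed.

Section conditional_mean.
Context d d' (X : measurableType d) (Y : measurableType d') (R : realType).
Variables (PX : probability X R) (k : R.-pker X ~> Y).
Implicit Types f : X * Y -> R.

(** The real-valued integral makes this a number at every [x], with junk value 0 where the fibre
    integral is infinite; for an integrable [f] such points form a null set. *)
Definition cmean f (x : X) : R := (\int[k x]_y f (x, y))%R.

Let msec f x : measurable_fun setT f -> measurable_fun setT (fun y => f (x, y)).
Proof. by move=> mf; exact: measurableT_comp. Qed.

Let mkint (F : X * Y -> \bar R) : (forall z, 0 <= F z)%E ->
  measurable_fun setT F -> measurable_fun setT (fun x => \int[k x]_y F (x, y))%E.
Proof. exact: measurable_kernel_integral. Qed.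

Let section_integralE f x : (\int[k x]_y (f (x, y))%:E =
  \int[k x]_y (EFin \o f)^\+ (x, y) - \int[k x]_y (EFin \o f)^\- (x, y))%E.
Proof.
rewrite integralE; congr (_ - _)%E; apply: eq_integral => y _.
- by rewrite !funeposE.
- by rewrite !funenegE.
Qed.

Lemma measurable_cmean f : measurable_fun setT f -> measurable_fun setT (cmean f).
Proof.
move=> mf; apply: measurableT_comp => //.
have mF : measurable_fun setT (EFin \o f) by exact/measurable_EFinP.
have mp := mkint
  (fun z => funepos_ge0 (EFin \o f) z) (measurable_funepos mF).
have mn := mkint
  (fun z => funeneg_ge0 (EFin \o f) z) (measurable_funeneg mF).
have := emeasurable_funB mp mn; apply: eq_measurable_fun => x _.
exact: esym (section_integralE _ _).
Qed.

Lemma ae_kernel_integrable f : (joint_law PX k).-integrable setT (EFin \o f) ->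
  {ae PX, forall x, (k x).-integrable setT (fun y => (f (x, y))%:E)}.
Proof.
move=> /integrableP[mF fi]; have mf : measurable_fun setT f by exact/measurable_EFinP.
have mA : measurable_fun setT (abse \o (EFin \o f)) by exact: measurableT_comp.
have A0 z : (0 <= (abse \o (EFin \o f)) z)%E by exact: abse_ge0.
rewrite (ge0_integral_joint_law PX k A0 mA) in fi.
have mK := mkint A0 mA.
have : PX.-integrable setT (fun x => \int[k x]_y (abse \o (EFin \o f)) (x, y))%E.
  by apply/integrableP; split => //; under eq_integral do rewrite gee0_abs ?integral_ge0//.
move=> /(integrable_ae measurableT); apply: filterS => x /(_ I) fx.
apply/integrableP; split; first exact/measurable_EFinP/msec.
by rewrite -ge0_fin_numE// integral_ge0.
Qed.

(** Tonelli applies to the positive and the negative part separately. The difference of the two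
    fibre integrals is [cmean] almost everywhere, namely on the integrable fibres. *)
Lemma integral_cmean f : (joint_law PX k).-integrable setT (EFin \o f) ->
  PX.-integrable setT (EFin \o cmean f) /\
  (\int[joint_law PX k]_z (f z)%:E = \int[PX]_x (cmean f x)%:E)%E.
Proof.
move=> fi; have mF := measurable_int _ fi.
have mf : measurable_fun setT f by exact/measurable_EFinP.
pose Fp := (EFin \o f)^\+%E; pose Fn := (EFin \o f)^\-%E.
have mFp : measurable_fun setT Fp by exact: measurable_funepos.
have mFn : measurable_fun setT Fn by exact: measurable_funeneg.
have Fp0 z : (0 <= Fp z)%E by exact: funepos_ge0.
have Fn0 z : (0 <= Fn z)%E by exact: funeneg_ge0.
have mKp := mkint Fp0 mFp.
have mKn := mkint Fn0 mFn.
have ip : PX.-integrable setT (fun x => \int[k x]_y Fp (x, y))%E.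
  apply/integrableP; split => //; under eq_integral do rewrite gee0_abs ?integral_ge0//.
  rewrite -ge0_integral_joint_law//; exact: integral_funepos_lt_pinfty.
have iN : PX.-integrable setT (fun x => \int[k x]_y Fn (x, y))%E.
  apply/integrableP; split => //; under eq_integral do rewrite gee0_abs ?integral_ge0//.
  rewrite -ge0_integral_joint_law//; exact: integral_funeneg_lt_pinfty.
have cE : ae_eq PX setT (EFin \o cmean f)
    (fun x => \int[k x]_y Fp (x, y) - \int[k x]_y Fn (x, y))%E.
  apply: filterS (ae_kernel_integrable fi) => x ix _.
  rewrite /= /cmean /Rintegral fineK; last exact: integrable_fin_num.
  exact: section_integralE.
have mc : measurable_fun setT (EFin \o cmean f).
  exact/measurable_EFinP/measurable_cmean.
have mB : measurable_fun setT
    (fun x => \int[k x]_y Fp (x, y) - \int[k x]_y Fn (x, y))%E.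
  exact: emeasurable_funB.
have iB := integrableB measurableT ip iN.
have E : (\int[joint_law PX k]_z (f z)%:E = \int[PX]_x (cmean f x)%:E)%E.
  transitivity (\int[PX]_x (\int[k x]_y Fp (x, y) - \int[k x]_y Fn (x, y)))%E.
    by rewrite integralB// [LHS]integralE -!ge0_integral_joint_law.
  by apply: ae_eq_integral => //; apply: filterS cE => x /[apply].
split => //; apply/integrableP; split => //.
have /integrableP[_] := iB; apply: le_lt_trans.
rewrite le_eqVlt; apply/orP; left; apply/eqP; apply: ge0_ae_eq_integral => //.
- exact: measurableT_comp.
- exact: measurableT_comp.
by apply: filterS cE => x /[apply] ->.
Qed.

Lemma integral_cmean_mul (h : X -> R) f :
  (joint_law PX k).-integrable setT (EFin \o f) ->
  measurable_fun setT h ->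
  (joint_law PX k).-integrable setT (fun z => (h z.1 * f z)%:E) ->
  (\int[joint_law PX k]_z (h z.1 * f z)%:E = \int[PX]_x (h x * cmean f x)%:E)%E.
Proof.
move=> fi mh hfi; have mf : measurable_fun setT f.
  by apply/measurable_EFinP; exact: measurable_int fi.
have [_ ->] := integral_cmean hfi.
apply: ae_eq_integral => //.
- apply/measurable_EFinP/measurable_cmean; apply: measurable_funM => //.
  exact: measurableT_comp mh measurable_fst.
- by apply/measurable_EFinP/measurable_funM => //; exact: measurable_cmean.
apply: filterS (ae_kernel_integrable fi) => x ix _; congr EFin.
by rewrite /cmean -RintegralZl.
Qed.

End conditional_mean.

Section unit_mass.
Context d (T : measurableType d) (R : realType).
Variables (m : {measure set T -> \bar R}).
Hypothesis m1 : m setT = 1%E.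

(** Total mass 1 is a hypothesis rather than part of the type of [m], so that these facts cover the
    fibre measures [k x] as well as probabilities. *)
Lemma unit_mass_integrable_cst (c : R) : m.-integrable setT (EFin \o cst c).
Proof.
apply/integrableP; split => /=; first exact: (measurable_cst c%:E).
by rewrite integral_cst// m1 mule1 ltry.
Qed.

Lemma sqr_integrable_integrable (f : T -> R) : measurable_fun setT f ->
  m.-integrable setT (fun z => (f z ^+ 2)%:E) -> m.-integrable setT (EFin \o f).
Proof.
move=> mf f2; apply: (le_integrable measurableT _ _
    (integrableD measurableT (unit_mass_integrable_cst 1) f2)).
- exact/measurable_EFinP.
- move=> z _ /=; rewrite lee_fin [leRHS]ger0_norm ?addr_ge0 ?sqr_ge0//.
  by rewrite -[f z ^+ 2]real_normK ?num_real//; have := normr_ge0 (f z); nra.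
Qed.

Lemma integral_sqr_affine (f : T -> R) (a b : R) : measurable_fun setT f ->
  m.-integrable setT (fun z => (f z ^+ 2)%:E) ->
  (\int[m]_z ((a + b * f z) ^+ 2)%:E =
  (a ^+ 2 + 2 * a * b * \int[m]_z f z + b ^+ 2 * \int[m]_z (f z ^+ 2))%:E)%E.
Proof.
move=> mf f2; have fi := sqr_integrable_integrable mf f2.
have i1 := integrableZl measurableT (2 * a * b) fi.
have i2 := integrableZl measurableT (b ^+ 2) f2.
have i0 := unit_mass_integrable_cst (a ^+ 2).
have i12 := integrableD measurableT i1 i2.
transitivity (\int[m]_z ((a ^+ 2)%:E + ((2 * a * b)%:E * (f z)%:E +
    (b ^+ 2)%:E * (f z ^+ 2)%:E)))%E.
  by apply: eq_integral => z _; rewrite -!EFinM -!EFinD; congr EFin; ring.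
rewrite integralD//= integralD//= !integralZl//.
rewrite integral_cst// m1 mule1 /Rintegral.
by rewrite !EFinD !EFinM !fineK ?addeA//; exact: integrable_fin_num.
Qed.

Lemma sqr_Rintegral_le (f : T -> R) : measurable_fun setT f ->
  m.-integrable setT (fun z => (f z ^+ 2)%:E) ->
  (\int[m]_z f z) ^+ 2 <= \int[m]_z (f z ^+ 2).
Proof.
move=> mf f2; set e := \int[m]_z f z.
(* The variance of [f] is nonnegative, and [integral_sqr_affine] expands it. *)
have : 0 <= \int[m]_z ((- e + 1 * f z) ^+ 2).
  by apply: Rintegral_ge0 => z _; exact: sqr_ge0.
by rewrite [leRHS]/Rintegral integral_sqr_affine//= -/e; nra.
Qed.

End unit_mass.

(** * Hellinger distances of laws sharing a kernel *)

Section joint_law_hellinger.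
Context d d' (X : measurableType d) (Y : measurableType d') (R : realType).
Variables (mu : {sigma_finite_measure set (X * Y)%type -> \bar R})
  (nu : {sigma_finite_measure set X -> \bar R}).
Variables (PX QX : probability X R) (k : R.-pker X ~> Y).
Hypothesis PXnu : PX `<< nu.
Hypothesis QXnu : QX `<< nu.
Hypothesis Pmu : joint_law PX k `<< mu.
Hypothesis Qmu : joint_law QX k `<< mu.

Let v := sqrt_density nu PX.
Let u := sqrt_density nu QX.
Let V := sqrt_density mu (joint_law PX k).
Let U := sqrt_density mu (joint_law QX k).
Let w x := u x / v x.
Let b x : R := (v x != 0)%:R.
Let b' x : R := (v x == 0)%:R.

Let mv : measurable_fun setT v. Proof. exact: measurable_sqrt_density. Qed.
Let mu_ : measurable_fun setT u. Proof. exact: measurable_sqrt_density. Qed.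
Let mV : measurable_fun setT V. Proof. exact: measurable_sqrt_density. Qed.
Let mU : measurable_fun setT U. Proof. exact: measurable_sqrt_density. Qed.

Let mb' : measurable_fun setT b'.
Proof.
have -> : b' = \1_(v @^-1` [set 0]).
  apply/funext => x; rewrite indicE /b'; congr (nat_of_bool _)%:R.
  by apply/idP/idP => [/eqP ?|]; [rewrite inE|rewrite inE => /= ->].
by apply: measurable_indic; rewrite -[X in measurable X]setTI; exact: mv.
Qed.

Let mb : measurable_fun setT b.
Proof.
have -> : b = (fun x => 1 - b' x).
  by apply/funext => x; rewrite /b /b'; case: eqP => _; rewrite ?subr0 ?subrr.
exact: measurable_funB.
Qed.

Let mw : measurable_fun setT w.
Proof.
by apply: measurable_funM => //; apply: measurable_fun_inv => // x; exact: sqrtr_ge0.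
Qed.

Let mfst (h : X -> R) : measurable_fun setT h ->
  measurable_fun setT (fun z : X * Y => h z.1).
Proof. by move=> mh; exact: measurableT_comp mh measurable_fst. Qed.

(** Both sides have the same integral over every measurable [E]: disintegration turns the integrals
    into [nu]-integrals of [b u ^ 2] and [w ^ 2 v ^ 2], which are equal pointwise, weighted by the
    kernel mass of the sections of [E]. *)
Let density_ratio : {ae mu, forall z, b z.1 * U z ^+ 2 = w z.1 ^+ 2 * V z ^+ 2}.
Proof.
pose f z := (b z.1 * U z ^+ 2)%:E; pose g z := (w z.1 ^+ 2 * V z ^+ 2)%:E.
have f0 z : (0 <= f z)%E by rewrite lee_fin mulr_ge0 ?sqr_ge0.
have mf : measurable_fun setT f.
  apply/measurable_EFinP; apply: measurable_funM; first exact: mfst.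
  exact: measurable_funX.
have mg : measurable_fun setT g.
  apply/measurable_EFinP; apply: measurable_funM.
    by apply: measurable_funX; exact: mfst.
  exact: measurable_funX.
suff : ae_eq mu setT f g by apply: filterS => z /(_ I) [].
apply: integral_ae_eq => //.
  apply/integrableP; split => //; under eq_integral do rewrite gee0_abs//.
  rewrite -ge0_integral_sqrt_density//; last exact: mfst.
  apply: (@le_lt_trans _ _ (\int[joint_law QX k]_z 1)%E).
    apply: ge0_le_integral => //.
    - by move=> z _; rewrite lee_fin.
    - by apply/measurable_EFinP; exact: mfst.
    - by move=> z _; rewrite lee_fin /b; case: eqP.
  by rewrite integral_cst// mul1e -ge0_fin_numE// fin_num_measure.
move=> E _ mE.
have mE1 : measurable_fun setT (\1_E : X * Y -> R) by exact: measurable_indic.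
have mKE := @measurable_kernel_integral _ _ _ _ _ k (fun z => (\1_E z)%:E).
have {}mKE := mKE (fun z => ltac:(by rewrite lee_fin)) ltac:(exact/measurable_EFinP).
have patchE (h : X -> R) (W : X * Y -> R) :
    (\int[mu]_(z in E) (h z.1 * W z)%:E =
     \int[mu]_z ((h z.1 * \1_E z) * W z)%:E)%E.
  rewrite integral_mkcond; apply: eq_integral => z _.
  rewrite patchE indicE; case: ifP => _; rewrite ?mulr1 ?mulr0 ?mul0r//.
rewrite /f /g (patchE b) (patchE (fun x => w x ^+ 2)).
have jointE (S : probability X R) (h : X -> R) :
    S `<< nu -> joint_law S k `<< mu ->
    (forall x, 0 <= h x) -> measurable_fun setT h ->
    (\int[mu]_z ((h z.1 * \1_E z) * sqrt_density mu (joint_law S k) z ^+ 2)%:E =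
     \int[nu]_x ((h x)%:E * \int[k x]_y (\1_E (x, y))%:E *
                  (sqrt_density nu S x ^+ 2)%:E))%E.
  move=> Snu Smu h0 mh; rewrite -ge0_integral_sqrt_density//; last 2 first.
  - by move=> z; rewrite mulr_ge0.
  - by apply: measurable_funM => //; exact: mfst.
  under eq_integral do rewrite EFinM.
  have := @ge0_integral_joint_law_mul _ _ _ _ _ S k (EFin \o h) (EFin \o \1_E).
  move=> -> //=; last 2 first.
  - exact/measurable_EFinP.
  - exact/measurable_EFinP.
  rewrite (ge0_integral_density Snu)//.
  - by move=> x; rewrite mule_ge0 ?lee_fin ?integral_ge0.
  - by apply: emeasurable_funM => //; exact/measurable_EFinP.
rewrite (jointE QX b)// (jointE PX (fun x => w x ^+ 2))//; last 2 first.
- by move=> x; rewrite sqr_ge0.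
- exact: measurable_funX.
apply: eq_integral => x _; rewrite !(muleC _ (\int[k x]_y _)%E) -!muleA.
congr (_ * _)%E; rewrite -!EFinM; congr EFin; rewrite -/u -/v /w /b.
by case: eqP => /= [->|/eqP v0]; rewrite ?invr0 ?mulr0 ?expr0n ?mul0r// mul1r; field.
Qed.

(** [PX] gives no mass to [v = 0], so its lift gives none to the cylinder above it. *)
Let density_null : {ae mu, forall z, b' z.1 * V z ^+ 2 = 0}.
Proof.
pose f z := (b' z.1 * V z ^+ 2)%:E.
have f0 z : (0 <= f z)%E by rewrite lee_fin mulr_ge0 ?sqr_ge0.
have mf : measurable_fun setT f.
  apply/measurable_EFinP; apply: measurable_funM; first exact: mfst.
  exact: measurable_funX.
suff : ae_eq mu setT f (cst 0) by apply: filterS => z /(_ I) [].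
apply/(ae_eq_integral_abs mu measurableT mf).
under eq_integral do rewrite gee0_abs//.
rewrite -ge0_integral_sqrt_density//; last exact: mfst.
rewrite (@ge0_integral_joint_law_fst _ _ _ _ _ PX k (EFin \o b')); last 2 first.
- by move=> x; rewrite lee_fin.
- exact/measurable_EFinP.
rewrite (ge0_integral_sqrt_density PXnu)//.
rewrite integral0_eq// => x _; rewrite -/v /b'; case: eqP => [->|_].
  by rewrite expr0n mulr0.
by rewrite mul0r.
Qed.

(* With [w = u / v], the lifted density is [w ^ 2 V ^ 2] over [v <> 0], while
   over [v = 0] only the mass of [QX] is left; both pieces depend on [x] alone. *)
Lemma hellinger_lift (s : X -> R) (c : R) : measurable_fun setT s ->
  (\int[mu]_z ((U z - V z - c * s z.1 * V z) ^+ 2)%:E =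
   \int[nu]_x ((u x - v x - c * s x * v x) ^+ 2)%:E)%E.
Proof.
move=> ms; pose a x := (w x - 1 - c * s x) ^+ 2.
have a0 x : 0 <= a x by exact: sqr_ge0.
have b'0 x : 0 <= b' x by rewrite ler0n.
have ma : measurable_fun setT a.
  apply: measurable_funX; apply: measurable_funB; first exact: measurable_funB.
  exact: measurable_funM.
transitivity (\int[mu]_z ((a z.1 * V z ^+ 2)%:E + (b' z.1 * U z ^+ 2)%:E))%E.
  apply: ge0_ae_eq_integral => //.
  - apply/measurable_EFinP; apply: measurable_funX; apply: measurable_funB.
      exact: measurable_funB.
    by apply: measurable_funM => //; apply: measurable_funM => //; exact: mfst.
  - apply: emeasurable_funD; apply/measurable_EFinP; apply: measurable_funM;
      by [exact: mfst | exact: measurable_funX].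
  - by move=> z _; rewrite lee_fin sqr_ge0.
  - by move=> z _; apply: adde_ge0; rewrite lee_fin mulr_ge0 ?sqr_ge0.
  apply: filterS2 density_ratio density_null => z; rewrite /b /b' => e1 e2 _.
  rewrite -EFinD; congr EFin; move: e1 e2; rewrite /a.
  case: eqP => v0 /=.
    rewrite !mul0r !mul1r => _ /eqP; rewrite sqrf_eq0 => /eqP ->.
    by rewrite expr0n !mulr0 add0r !subr0.
  rewrite !mul0r !mul1r addr0 -exprMn => e1 _.
  have UE : U z = w z.1 * V z.
    apply/eqP; rewrite -(@eqrXn2 _ 2)// ?sqrtr_ge0//; first by rewrite e1.
    by rewrite mulr_ge0 ?sqrtr_ge0// divr_ge0 ?sqrtr_ge0.
  by rewrite UE; ring.
rewrite ge0_integralD//; last 4 first.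
- by move=> z _; rewrite lee_fin mulr_ge0 ?sqr_ge0.
- apply/measurable_EFinP; apply: measurable_funM; first exact: mfst.
  exact: measurable_funX.
- by move=> z _; rewrite lee_fin mulr_ge0 ?sqr_ge0.
- apply/measurable_EFinP; apply: measurable_funM; first exact: mfst.
  exact: measurable_funX.
rewrite -!ge0_integral_sqrt_density//; try exact: mfst.
rewrite (@ge0_integral_joint_law_fst _ _ _ _ _ PX k (EFin \o a)); last 2 first.
- by move=> x; rewrite lee_fin.
- exact/measurable_EFinP.
rewrite (@ge0_integral_joint_law_fst _ _ _ _ _ QX k (EFin \o b')); last 2 first.
- by move=> x; rewrite lee_fin.
- exact/measurable_EFinP.
rewrite (ge0_integral_sqrt_density PXnu)// (ge0_integral_sqrt_density QXnu)// -ge0_integralD//; last 4 first.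
- by move=> z _; rewrite lee_fin mulr_ge0 ?sqr_ge0.
- by apply/measurable_EFinP; apply: measurable_funM => //; exact: measurable_funX.
- by move=> z _; rewrite lee_fin mulr_ge0 ?sqr_ge0.
- by apply/measurable_EFinP; apply: measurable_funM => //; exact: measurable_funX.
apply: eq_integral => x _; rewrite -EFinD; congr EFin; rewrite -/u -/v /a /b' /w.
case: eqP => [->|/eqP v0].
  by rewrite expr0n !mulr0 mul1r add0r !subr0.
by rewrite mul0r addr0; field.
Qed.

End joint_law_hellinger.

(** * Scores of the marginal model *)

Section sqrt_remainder.
Variable R : realType.

(** First-order Taylor remainder in [c]. With [p = E[s | x]] and [q = E[s ^ 2 | x]] the radicand is
    [E[(1 + c s) ^ 2 | x]], so this measures how far the root of the marginalised density is from
    [1 + c p]. *)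
Definition sqrt_rem (p q c : R) : R :=
  Num.sqrt (1 + 2 * c * p + c ^+ 2 * q) - 1 - c * p.

Lemma sqrt_rem_ge0 (p q c : R) : p ^+ 2 <= q -> 0 <= sqrt_rem p q c.
Proof.
move=> pq; rewrite /sqrt_rem -addrA -opprD subr_ge0.
apply: le_trans (ler_norm _) _.
rewrite -sqrtr_sqr ler_wsqrtr//.
have : c ^+ 2 * p ^+ 2 <= c ^+ 2 * q by rewrite ler_wpM2l ?sqr_ge0.
by nra.
Qed.

(** The radicand is at most [(1 + |c| sqrt q) ^ 2]. Valid for every [c], this provides the
    dominating function [4 q] of [(sqrt_rem / c) ^ 2]. *)
Lemma sqrt_rem_le (p q c : R) : p ^+ 2 <= q ->
  sqrt_rem p q c ^+ 2 <= 4 * c ^+ 2 * q.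
Proof.
move=> pq; have q0 : 0 <= q by rewrite (le_trans _ pq) ?sqr_ge0.
have D0 := sqrt_rem_ge0 c pq.
have sq := sqr_sqrtr q0; have sq0 := sqrtr_ge0 q.
have ps : `|p| <= Num.sqrt q by rewrite -sqrtr_sqr ler_wsqrtr.
have cp : `|c * p| <= `|c| * Num.sqrt q by rewrite normrM ler_wpM2l.
have /andP[cp1 cp2] : - (`|c| * Num.sqrt q) <= c * p <= `|c| * Num.sqrt q.
  by rewrite -ler_norml.
have c2 : `|c| ^+ 2 = c ^+ 2 by rewrite real_normK ?num_real.
have D1 : sqrt_rem p q c <= 2 * (`|c| * Num.sqrt q).
  rewrite /sqrt_rem.
  suff : Num.sqrt (1 + 2 * c * p + c ^+ 2 * q) <= 1 + `|c| * Num.sqrt q by lra.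
  have pos : 0 <= 1 + `|c| * Num.sqrt q by rewrite addr_ge0// mulr_ge0.
  rewrite -[leRHS]ger0_norm// -sqrtr_sqr ler_wsqrtr//.
  have -> : (1 + `|c| * Num.sqrt q) ^+ 2 = 1 + 2 * (`|c| * Num.sqrt q) + c ^+ 2 * q.
    rewrite sqrrD exprMn sq c2; ring.
  by lra.
have -> : 4 * c ^+ 2 * q = (2 * (`|c| * Num.sqrt q)) ^+ 2.
  by rewrite !exprMn sq c2; ring.
by rewrite ler_sqr ?nnegrE// (le_trans D0).
Qed.

(** Since [1 + c p >= 1 / 2], squaring [1 + c p + 2 c ^ 2 q] already yields the radicand. This gives
    the pointwise convergence of [sqrt_rem / c] to 0. *)
Lemma sqrt_rem_le_quadratic (p q c : R) : p ^+ 2 <= q -> `|c * p| <= 1 / 2 ->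
  sqrt_rem p q c <= 2 * c ^+ 2 * q.
Proof.
move=> pq; have q0 : 0 <= q by rewrite (le_trans _ pq) ?sqr_ge0.
rewrite ler_norml => /andP[cp1 cp2]; rewrite /sqrt_rem.
have cq : 0 <= c ^+ 2 * q by rewrite mulr_ge0 ?sqr_ge0.
suff : Num.sqrt (1 + 2 * c * p + c ^+ 2 * q) <= 1 + c * p + 2 * (c ^+ 2 * q) by lra.
rewrite -[leRHS]ger0_norm; last by lra.
rewrite -sqrtr_sqr ler_wsqrtr//.
have : 0 <= (c * p) ^+ 2 by exact: sqr_ge0.
by nra.
Qed.

End sqrt_remainder.

(** Dominated convergence concerns sequences, so the proof is by contradiction: if [e] fails for
    every radius, the radii [1 / (n + 1)] produce [c_ n] tending to 0 along which the quotient by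
    [c ^ 2] stays above [e]. *)
Lemma integral_sqrt_rem_littleo d (T : measurableType d) (R : realType)
    (P : probability T R) (p q : T -> R) :
  measurable_fun setT p -> P.-integrable setT (EFin \o q) ->
  {ae P, forall x, p x ^+ 2 <= q x} ->
  forall e : R, 0 < e -> exists2 r, 0 < r & forall c, `|c| < r ->
    (\int[P]_x (sqrt_rem (p x) (q x) c ^+ 2)%:E <= (e * c ^+ 2)%:E)%E.
Proof.
move=> mp qi pq e e0; apply: contrapT => /forall2NP H.
have /choice[c_ Hc] (n : nat) : exists c : R, `|c| < n.+1%:R^-1 /\
    ((e * c ^+ 2)%:E < \int[P]_x (sqrt_rem (p x) (q x) c ^+ 2)%:E)%E.
  have [/negP//|/existsNP[c /not_implyP[cr /negP]]] := H n.+1%:R^-1.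
  by rewrite -ltNge => cH; exists c.
move=> {H}.
have c0 n : c_ n != 0.
  apply/eqP => cn; have [_] := Hc n; rewrite cn expr0n mulr0.
  rewrite integral0_eq ?ltxx// => x _.
  by rewrite /sqrt_rem !(mulr0, mul0r, expr0n, addr0, subr0) sqrtr1 subrr expr0n.
have mq : measurable_fun setT q by apply/measurable_EFinP; exact: measurable_int qi.
pose f n x := ((sqrt_rem (p x) (q x) (c_ n) / c_ n) ^+ 2)%:E.
have mD c : measurable_fun setT (fun x => sqrt_rem (p x) (q x) c).
  apply: measurable_funB; last exact: measurable_funM.
  apply: measurable_funB => //; apply: measurableT_comp.
    exact: continuous_measurable_fun (@sqrt_continuous R).
  apply: measurable_funD; last exact: measurable_funM.
  by apply: measurable_funD => //; exact: measurable_funM.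
have mf n : measurable_fun setT (f n).
  by apply/measurable_EFinP/measurable_funX/measurable_funM.
have c_0 : c_ n @[n --> \oo] --> 0.
  apply/cvgrPdist_lt => eps eps0.
  apply: filterS (near_infty_natSinv_lt (PosNum eps0)) => n /= neps.
  by rewrite sub0r normrN; have [cn _] := Hc n; exact: lt_trans cn neps.
have f_0 : {ae P, forall x, setT x -> f ^~ x @ \oo --> 0%E}.
  apply: filterS pq => x pqx _.
  have q0 : 0 <= q x by rewrite (le_trans _ pqx) ?sqr_ge0.
  suff H1 : (sqrt_rem (p x) (q x) (c_ n) / c_ n) ^+ 2 @[n --> \oo] --> 0.
    by apply: cvg_comp H1 _; exact: cvg_id.
  have cp0 : `|c_ n * p x| @[n --> \oo] --> 0.
    by rewrite -[X in _ --> X](normr0 R) -[X in `|X|](mul0r (p x)); apply: cvg_norm; apply: cvgMl.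
  have cp1 : \forall n \near \oo, `|c_ n * p x| <= 1 / 2.
    have /cvgrPdist_le/(_ (1 / 2) ltac:(lra)) := cp0.
    by apply: filterS => n; rewrite sub0r normrN normr_id.
  (* The majorant is the square of the quadratic bound, divided by [c_ n ^ 2]. *)
  have ch : (4 * c_ n ^+ 2 * q x ^+ 2) @[n --> \oo] --> (0 : R).
    have -> : 0 = 4 * 0 ^+ 2 * q x ^+ 2 :> R by rewrite expr0n mulr0 mul0r.
    by apply: cvgMl; apply: cvgMr; under eq_fun do rewrite expr2; rewrite expr2; exact: cvgM.
  apply: (squeeze_cvgr _ (cvg_cst 0) ch).
  near=> n; apply/andP; split; first exact: sqr_ge0.
    have cn : `|c_ n * p x| <= 1 / 2 by near: n.
    have D0 := sqrt_rem_ge0 (c_ n) pqx.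
    have D1 := sqrt_rem_le_quadratic pqx cn.
    have D2 : sqrt_rem (p x) (q x) (c_ n) ^+ 2 <= (2 * c_ n ^+ 2 * q x) ^+ 2.
      by rewrite ler_sqr ?nnegrE// (le_trans D0).
    have cn2 : 0 < c_ n ^+ 2 by rewrite exprn_even_gt0// c0.
    rewrite expr_div_n ler_pdivrMr// (le_trans D2)// le_eqVlt; apply/orP; left.
    by apply/eqP; ring.
have f_q : {ae P, forall x n, setT x -> (`|f n x| <= 4%:E * (q x)%:E)%E}.
  apply: filterS pq => x pqx n _.
  have cn2 : 0 < c_ n ^+ 2 by rewrite exprn_even_gt0// c0.
  rewrite /f -EFinM lee_fin ger0_norm ?sqr_ge0// expr_div_n ler_pdivrMr//.
  by rewrite (le_trans (sqrt_rem_le _ pqx))// le_eqVlt; apply/orP; left; apply/eqP; ring.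
have [_ _ cvf] := dominated_convergence measurableT mf (measurable_cst 0%E)
  f_0 (integrableZl measurableT 4 qi) f_q.
have : (e%:E <= 0 :> \bar R)%E.
  rewrite integral0 in cvf; apply: (cvge_ge _ cvf).
  near=> n; have [_ /ltW] := Hc n; rewrite EFinM.
  have cn2 : 0 < c_ n ^+ 2 by rewrite exprn_even_gt0// c0.
  have -> : (\int[P]_x (sqrt_rem (p x) (q x) (c_ n) ^+ 2)%:E =
      (c_ n ^+ 2)%:E * \int[P]_x f n x)%E.
    rewrite -ge0_integralZl//; last 2 first.
    - by move=> x _; rewrite lee_fin sqr_ge0.
    - by rewrite lee_fin ltW.
    by apply: eq_integral => x _; rewrite -EFinM expr_div_n mulrC divfK ?gt_eqF.
  by rewrite muleC lee_pmul2l// lte_fin.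
by rewrite lee_fin leNgt e0.
Unshelve. all: by end_near. Qed.

(** Convergence of an extended-real quotient hides two facts, eventual finiteness and smallness. The
    form without quotient expresses both in one inequality, which is easy to transport and to
    restrict to a sequence. *)
Lemma dqmP d (T : measurableType d) (R : realType)
    (mu : {sigma_finite_measure set T -> \bar R}) (P_ : R -> probability T R)
    (tstar : R) (s : T -> R) :
  dqm mu P_ tstar s <-> forall e : R, 0 < e -> \forall t \near tstar^',
    (\int[mu]_z ((sqrt_density mu (P_ t) z - sqrt_density mu (P_ tstar) z
      - (t - tstar) / 2 * s z * sqrt_density mu (P_ tstar) z) ^+ 2)%:E
     <= (e * (t - tstar) ^+ 2)%:E)%E.
Proof.
pose I t := (\int[mu]_z ((sqrt_density mu (P_ t) z - sqrt_density mu (P_ tstar) z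
      - (t - tstar) / 2 * s z * sqrt_density mu (P_ tstar) z) ^+ 2)%:E)%E.
have I0 t : (0 <= I t)%E by apply: integral_ge0 => z _; rewrite lee_fin sqr_ge0.
pose g t := (((t - tstar) ^- 2)%:E * I t)%E.
have g0 t : (0 <= g t)%E by rewrite mule_ge0// lee_fin invr_ge0 sqr_ge0.
have d0 t : t != tstar -> 0 < (t - tstar) ^+ 2.
  by move=> tt; rewrite exprn_even_gt0// subr_eq0 tt.
have near_neq : \forall t \near tstar^', t != tstar by exact: nbhs_dnbhs_neq.
have gI t (e : R) : t != tstar ->
    (g t <= e%:E)%E = (I t <= (e * (t - tstar) ^+ 2)%:E)%E.
  move=> tt; rewrite /g muleC EFinM.
  by rewrite -[in LHS]lee_pdivlMr ?invr_gt0 ?d0// invrK.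
suff : g t @[t --> tstar^'] --> 0%E <->
    forall e, 0 < e -> \forall t \near tstar^', (g t <= e%:E)%E.
  move=> [H1 H2]; split => H.
    by move=> e /(H1 H); apply: filterS2 near_neq => t /gI ->.
  by apply: H2 => e /H; apply: filterS2 near_neq => t /gI ->.
split => [/fine_cvgP[gfin /cvgrPdist_le H] e /H|H].
  apply: filterS2 gfin => t gt; rewrite sub0r normrN.
  by move=> /(le_trans (ler_norm _)); rewrite -lee_fin fineK.
apply/fine_cvgP; split.
  apply: filterS (H 1 ltr01) => t gt.
  by rewrite ge0_fin_numE// (le_lt_trans gt)// ltry.
apply/cvgrPdist_le => e /H; apply: filterS => t gt.
rewrite sub0r normrN ger0_norm ?fine_ge0// -lee_fin fineK//.
by rewrite ge0_fin_numE// (le_lt_trans gt)// ltry.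
Qed.

Section hellinger_contraction.
Context d d' (X : measurableType d) (Z : measurableType d') (R : realType).
Variables (mu : {measure set Z -> \bar R}) (nu : {measure set X -> \bar R}).
Variable pi : Z -> X.
Hypothesis mpi : measurable_fun setT pi.
Variables (u v : Z -> R) (a b : X -> R).
Hypotheses (mu_ : measurable_fun setT u) (mv : measurable_fun setT v).
Hypotheses (ma : measurable_fun setT a) (mb : measurable_fun setT b).
Hypotheses (a0 : forall x, 0 <= a x) (b0 : forall x, 0 <= b x).
Hypothesis ua : forall h : X -> R, (forall x, 0 <= h x) -> measurable_fun setT h ->
  (\int[mu]_z (h (pi z) * u z ^+ 2)%:E = \int[nu]_x (h x * a x ^+ 2)%:E)%E.
Hypothesis vb : forall h : X -> R, (forall x, 0 <= h x) -> measurable_fun setT h ->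
  (\int[mu]_z (h (pi z) * v z ^+ 2)%:E = \int[nu]_x (h x * b x ^+ 2)%:E)%E.
Hypothesis a_fin : (\int[nu]_x (a x ^+ 2)%:E < +oo)%E.
Hypothesis b_fin : (\int[nu]_x (b x ^+ 2)%:E < +oo)%E.

(** The hypothesis on [w] and [c] says that [w ^ 2] has image density [c ^ 2] under [pi]. Testing it
    with the indicator of [c = 0] shows that no mass lies above that set. *)
Let null (w : Z -> R) (c : X -> R) : measurable_fun setT w -> measurable_fun setT c ->
  (forall h : X -> R, (forall x, 0 <= h x) -> measurable_fun setT h ->
  (\int[mu]_z (h (pi z) * w z ^+ 2)%:E = \int[nu]_x (h x * c x ^+ 2)%:E)%E) ->
  {ae mu, forall z, c (pi z) = 0 -> w z = 0}.
Proof.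
move=> mw mc wc; pose h x : R := (c x == 0)%:R.
have mh : measurable_fun setT h.
  have -> : h = \1_(c @^-1` [set 0]).
    apply/funext => x; rewrite indicE /h; congr (nat_of_bool _)%:R.
    by apply/idP/idP => [/eqP ?|]; [rewrite inE|rewrite inE => /= ->].
  by apply: measurable_indic; rewrite -[X in measurable X]setTI; exact: mc.
have mf : measurable_fun setT (fun z => (h (pi z) * w z ^+ 2)%:E).
  apply/measurable_EFinP; apply: measurable_funM; last exact: measurable_funX.
  exact: measurableT_comp mh mpi.
suff : ae_eq mu setT (fun z => (h (pi z) * w z ^+ 2)%:E) (cst 0%E).
  apply: filterS => z /(_ I) [] + cz0; rewrite /h cz0 eqxx mul1r => /eqP.
  by rewrite sqrf_eq0 => /eqP.
apply/(ae_eq_integral_abs mu measurableT mf).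
have f0 z : (0 <= (h (pi z) * w z ^+ 2)%:E)%E.
  by rewrite lee_fin mulr_ge0 ?sqr_ge0// ler0n.
under eq_integral do rewrite gee0_abs//.
rewrite wc//.
rewrite integral0_eq// => x _; rewrite /h; case: eqP => [->|_].
  by rewrite expr0n mulr0.
by rewrite mul0r.
Qed.

(* Young's inequality [2 u v <= al u ^ 2 + be v ^ 2] with the fibrewise constant
   weights [al = b / a] and [be = a / b] turns the affinity of [u] and [v] into
   that of [a] and [b]. *)
Lemma hellinger_contraction :
  (\int[nu]_x ((a x - b x) ^+ 2)%:E <= \int[mu]_z ((u z - v z) ^+ 2)%:E)%E.
Proof.
pose al x := b x / a x; pose be x := a x / b x.
have mal : measurable_fun setT al.
  by apply: measurable_funM => //; exact: measurable_fun_inv.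
have mbe : measurable_fun setT be.
  by apply: measurable_funM => //; exact: measurable_fun_inv.
have al0 x : 0 <= al x by rewrite divr_ge0.
have be0 x : 0 <= be x by rewrite divr_ge0.
have ala x : al x * a x ^+ 2 = a x * b x.
  rewrite /al; have [->|a_neq0] := eqVneq (a x) 0.
    by rewrite expr0n mulr0 mul0r.
  by field.
have beb x : be x * b x ^+ 2 = a x * b x.
  rewrite /be; have [->|b_neq0] := eqVneq (b x) 0.
    by rewrite expr0n !mulr0.
  by field.
have ab_fin : (\int[nu]_x (a x * b x)%:E < +oo)%E.
  apply: (@le_lt_trans _ _ (\int[nu]_x ((a x ^+ 2)%:E + (b x ^+ 2)%:E))%E).
    apply: ge0_le_integral => //.
    - by move=> x _; rewrite lee_fin mulr_ge0.
    - by apply/measurable_EFinP; exact: measurable_funM.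
    - by apply: emeasurable_funD; apply/measurable_EFinP; exact: measurable_funX.
    - by move=> x _; rewrite -EFinD lee_fin; have := sqr_ge0 (a x - b x);
        have := mulr_ge0 (a0 x) (b0 x); nra.
  rewrite ge0_integralD//; first exact: lte_add_pinfty.
  - by move=> x _; rewrite lee_fin sqr_ge0.
  - by apply/measurable_EFinP; exact: measurable_funX.
  - by move=> x _; rewrite lee_fin sqr_ge0.
  - by apply/measurable_EFinP; exact: measurable_funX.
set I := (\int[nu]_x (a x * b x)%:E)%E in ab_fin.
have I0 : (0 <= I)%E by apply: integral_ge0 => x _; rewrite lee_fin mulr_ge0.
have Ifin : (I + I)%E \is a fin_num by rewrite fin_numD ge0_fin_numE// ab_fin.
(* Adding twice the finite affinity avoids subtracting integrals: on the left the cross term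
   disappears, and on the right it is absorbed as the integral of [al u ^ 2 + be v ^ 2]. *)
rewrite -(@leeD2rE _ (I + I)%E)//.
have -> : (\int[nu]_x ((a x - b x) ^+ 2)%:E + (I + I) =
    \int[mu]_z (u z ^+ 2 + v z ^+ 2)%:E)%E.
  have one0 : forall x : X, 0 <= (1 : R) by [].
  have := ua one0 (measurable_cst _); have := vb one0 (measurable_cst _).
  under eq_integral do rewrite mul1r; under [in RHS]eq_integral do rewrite mul1r.
  move=> e1.
  under eq_integral do rewrite mul1r; under [in RHS]eq_integral do rewrite mul1r.
  move=> e2.
  under [in RHS]eq_integral do rewrite EFinD.
  rewrite [in RHS]ge0_integralD//; last 4 first.
  - by move=> x _; rewrite lee_fin sqr_ge0.
  - by apply/measurable_EFinP; exact: measurable_funX.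
  - by move=> x _; rewrite lee_fin sqr_ge0.
  - by apply/measurable_EFinP; exact: measurable_funX.
  rewrite e1 e2 /I -!ge0_integralD//.
  all: try by move=> x _; rewrite ?adde_ge0 ?lee_fin ?sqr_ge0 ?mulr_ge0.
  all: try by apply/measurable_EFinP; exact: measurable_funX.
  all: try by apply/measurable_EFinP; exact: measurable_funM.
  - by apply: eq_integral => x _; rewrite -!EFinD; congr EFin; ring.
  - by apply/measurable_EFinP; apply: measurable_funX; exact: measurable_funB.
  - by apply: emeasurable_funD; apply/measurable_EFinP; exact: measurable_funM.
have -> : (\int[mu]_z ((u z - v z) ^+ 2)%:E + (I + I) =
    \int[mu]_z ((u z - v z) ^+ 2 + (al (pi z) * u z ^+ 2 + be (pi z) * v z ^+ 2))%:E)%E.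
  have := ua al0 mal; have := vb be0 mbe.
  have mal_u : measurable_fun setT (fun z => al (pi z) * u z ^+ 2).
    by apply: measurable_funM; [exact: measurableT_comp mal mpi|exact: measurable_funX].
  have mbe_v : measurable_fun setT (fun z => be (pi z) * v z ^+ 2).
    by apply: measurable_funM; [exact: measurableT_comp mbe mpi|exact: measurable_funX].
  have mu_v : measurable_fun setT (fun z => (u z - v z) ^+ 2).
    by apply: measurable_funX; exact: measurable_funB.
  have al_u z : 0 <= al (pi z) * u z ^+ 2 by rewrite mulr_ge0 ?sqr_ge0.
  have be_v z : 0 <= be (pi z) * v z ^+ 2 by rewrite mulr_ge0 ?sqr_ge0.
  under [in RHS]eq_integral do rewrite beb; move=> e1.
  under [in RHS]eq_integral do rewrite ala; move=> e2.
  rewrite {1}/I -{1}e2 /I -{1}e1 -!ge0_integralD//.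
  all: try by move=> z _; rewrite ?adde_ge0 ?lee_fin ?sqr_ge0 ?mulr_ge0 ?sqr_ge0.
  all: try by move=> z _; rewrite -EFinD lee_fin addr_ge0.
  all: try by apply: emeasurable_funD; apply/measurable_EFinP.
  all: try by apply/measurable_EFinP.
  1-2: by move=> z _; rewrite lee_fin.
apply: ae_ge0_le_integral => //.
- by move=> z _; rewrite lee_fin addr_ge0 ?sqr_ge0.
- by apply/measurable_EFinP; apply: measurable_funD; exact: measurable_funX.
- move=> z _; rewrite lee_fin; apply: addr_ge0; first exact: sqr_ge0.
  by apply: addr_ge0; rewrite mulr_ge0 ?sqr_ge0.
- apply/measurable_EFinP; apply: measurable_funD.
    by apply: measurable_funX; exact: measurable_funB.
  apply: measurable_funD; (apply: measurable_funM; last exact: measurable_funX).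
    exact: measurableT_comp mal mpi.
  exact: measurableT_comp mbe mpi.
apply: filterS2 (null mu_ ma ua) (null mv mb vb) => z uz vz _; rewrite lee_fin.
(* If [a] or [b] vanishes, the weights are not inverse to each other, but then [u] or [v] vanishes
   as well and the inequality is immediate. *)
have [a0z|an0] := eqVneq (a (pi z)) 0.
  by rewrite (uz a0z) /be a0z mul0r; nra.
have [b0z|bn0] := eqVneq (b (pi z)) 0.
  by rewrite (vz b0z) /al b0z mul0r; nra.
have -> : be (pi z) = (al (pi z))^-1 by rewrite /be /al invf_div.
have alz : 0 < al (pi z) by rewrite lt_neqAle eq_sym al0 mulf_neq0 ?invr_eq0.
rewrite -subr_ge0.
have -> : (u z - v z) ^+ 2 + (al (pi z) * u z ^+ 2 + (al (pi z))^-1 * v z ^+ 2)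
   - (u z ^+ 2 + v z ^+ 2) = (al (pi z))^-1 * (al (pi z) * u z - v z) ^+ 2.
  by field; rewrite gt_eqF.
by rewrite mulr_ge0 ?sqr_ge0// invr_ge0.
Qed.

End hellinger_contraction.

Lemma same_law_integral d (T : measurableType d) (R : realType)
    (P Q : probability T R) (f : T -> \bar R) :
  same_law P Q -> (\int[P]_z f z = \int[Q]_z f z)%E.
Proof. by move=> PQ; apply: eq_measure_integral => A mA _; exact: PQ. Qed.

Lemma same_law_integrable d (T : measurableType d) (R : realType)
    (P Q : probability T R) (f : T -> \bar R) :
  same_law P Q -> P.-integrable setT f -> Q.-integrable setT f.
Proof.
move=> PQ /integrableP[mf fi]; apply/integrableP; split => //.
by rewrite -(same_law_integral _ PQ).
Qed.

Section dqm_marginal.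
Context d d' (X : measurableType d) (Y : measurableType d') (R : realType).
Variables (mu : {sigma_finite_measure set (X * Y)%type -> \bar R})
  (nu : {sigma_finite_measure set X -> \bar R}).
Variables (PX_ : R -> probability X R) (k_ : R -> R.-pker X ~> Y)
  (P_ : R -> probability (X * Y)%type R) (tstar : R) (s : X * Y -> R).
Hypothesis P_E : \forall t \near tstar,
  [/\ P_ t `<< mu, PX_ t `<< nu & same_law (P_ t) (joint_law (PX_ t) (k_ t))].
Hypothesis s2 : s \in Lfun (P_ tstar) 2%:E.

Let P0mu : P_ tstar `<< mu. Proof. by have [] := nbhs_singleton P_E. Qed.
Let PX0nu : PX_ tstar `<< nu. Proof. by have [] := nbhs_singleton P_E. Qed.
Let P0E : same_law (P_ tstar) (joint_law (PX_ tstar) (k_ tstar)).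
Proof. by have [] := nbhs_singleton P_E. Qed.

Let ms : measurable_fun setT s. Proof. by have /Lfun2P[] := s2. Qed.

Let s2i : (joint_law (PX_ tstar) (k_ tstar)).-integrable setT
  (EFin \o (fun z => s z ^+ 2)).
Proof. exact: same_law_integrable P0E (Lfun2_integrable_sqr s2). Qed.

Let p := cmean (k_ tstar) s.
Let q := cmean (k_ tstar) (fun z => s z ^+ 2).

Let mp : measurable_fun setT p. Proof. exact: measurable_cmean. Qed.
Let mq : measurable_fun setT q.
Proof. by apply: measurable_cmean; exact: measurable_funX. Qed.

Let msec x : measurable_fun setT (fun y => s (x, y)).
Proof. exact: measurableT_comp. Qed.

Let k1 x : k_ tstar x setT = 1%E. Proof. exact: prob_kernel. Qed.

Let qi : (PX_ tstar).-integrable setT (EFin \o q).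
Proof. by have [] := integral_cmean s2i. Qed.

Let pq : {ae PX_ tstar, forall x, p x ^+ 2 <= q x}.
Proof.
apply: filterS (ae_kernel_integrable s2i) => x six.
exact: (sqr_Rintegral_le (k1 x) (msec x) six).
Qed.

Let kap c x := 1 + 2 * c * p x + c ^+ 2 * q x.

Let kapE c : {ae PX_ tstar, forall x,
  (\int[k_ tstar x]_y ((1 + c * s (x, y)) ^+ 2)%:E = (kap c x)%:E)%E}.
Proof.
apply: filterS (ae_kernel_integrable s2i) => x six.
rewrite (integral_sqr_affine (k1 x) _ _ (msec x) six).
by rewrite expr1n mulr1.
Qed.

Let mkap c : measurable_fun setT (kap c).
Proof.
apply: measurable_funD; last exact: measurable_funM.
by apply: measurable_funD => //; exact: measurable_funM.
Qed.

Let V := sqrt_density mu (P_ tstar).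
Let b0 := sqrt_density nu (PX_ tstar).
(** [v c] is the nonnegative root of the joint density tilted by [(1 + c s) ^ 2], and [b c] is the
    root of its marginal density, as [vb] shows. They are intermediate between the submodel and its
    linear approximation. *)
Let v c z := `|1 + c * s z| * V z.
Let b c x := Num.sqrt (kap c x) * b0 x.

Let mV : measurable_fun setT V. Proof. exact: measurable_sqrt_density. Qed.
Let mb0 : measurable_fun setT b0. Proof. exact: measurable_sqrt_density. Qed.

Let m1cs c : measurable_fun setT (fun z => 1 + c * s z).
Proof. by apply: measurable_funD => //; exact: measurable_funM. Qed.

Let mv c : measurable_fun setT (v c).
Proof. by apply: measurable_funM => //; exact: measurableT_comp. Qed.

Let msq c : measurable_fun setT (fun x => Num.sqrt (kap c x)).
Proof.
exact: (measurableT_comp (continuous_measurable_fun (@sqrt_continuous R)) (mkap c)).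
Qed.

Let mb c : measurable_fun setT (b c). Proof. exact: measurable_funM. Qed.

Let vb c (h : X -> R) : (forall x, 0 <= h x) -> measurable_fun setT h ->
  (\int[mu]_z (h z.1 * v c z ^+ 2)%:E = \int[nu]_x (h x * b c x ^+ 2)%:E)%E.
Proof.
move=> h0 mh.
have mh1 : measurable_fun setT (fun z : X * Y => h z.1).
  exact: measurableT_comp mh measurable_fst.
transitivity (\int[mu]_z ((h z.1 * (1 + c * s z) ^+ 2) * V z ^+ 2)%:E)%E.
  apply: eq_integral => z _; congr EFin.
  by rewrite /v exprMn real_normK ?num_real// mulrA.
rewrite -ge0_integral_sqrt_density//; last 2 first.
- by move=> z; rewrite mulr_ge0 ?sqr_ge0.
- by apply: measurable_funM => //; exact: measurable_funX.
rewrite (same_law_integral _ P0E).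
under eq_integral do rewrite EFinM.
pose F z := ((1 + c * s z) ^+ 2)%:E.
have mF : measurable_fun setT F.
  by apply/measurable_EFinP; exact: measurable_funX.
have F0 z : (0 <= F z)%E by rewrite lee_fin sqr_ge0.
rewrite (@ge0_integral_joint_law_mul _ _ _ _ _ (PX_ tstar) (k_ tstar)
  (EFin \o h) F)//=; last exact/measurable_EFinP.
transitivity (\int[nu]_x ((h x * Num.sqrt (kap c x) ^+ 2) * b0 x ^+ 2)%:E)%E; last first.
  by apply: eq_integral => x _; congr EFin; rewrite /b; ring.
have mhk : measurable_fun setT (fun x => h x * Num.sqrt (kap c x) ^+ 2).
  by apply: measurable_funM => //; exact: measurable_funX.
rewrite -(ge0_integral_sqrt_density PX0nu)//; last first.
  by move=> x; rewrite mulr_ge0 ?sqr_ge0.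
apply: ge0_ae_eq_integral => //.
- apply: emeasurable_funM; first exact/measurable_EFinP.
  exact: measurable_kernel_integral F0 mF.
- exact/measurable_EFinP.
- by move=> x _; rewrite mule_ge0 ?lee_fin// integral_ge0.
- by move=> x _; rewrite lee_fin mulr_ge0 ?sqr_ge0.
apply: filterS (kapE c) => x kx _; rewrite kx EFinM sqr_sqrtr//.
by rewrite -lee_fin -kx integral_ge0// => y _; rewrite lee_fin sqr_ge0.
Qed.

Let b_fin c : (\int[nu]_x (b c x ^+ 2)%:E < +oo)%E.
Proof.
have := vb c (fun=> ler01) (measurable_cst _).
under eq_integral do rewrite mul1r.
under [in RHS]eq_integral do rewrite mul1r.
move=> <-.
rewrite (eq_integral (fun z => ((1 + c * s z) ^+ 2 * V z ^+ 2)%:E)); last first.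
  by move=> z _; rewrite /v exprMn real_normK ?num_real.
rewrite -ge0_integral_sqrt_density//; last 2 first.
- by move=> z; rewrite sqr_ge0.
- exact: measurable_funX.
by rewrite (integral_sqr_affine (probability_setT _))// ?ltry//;
  exact: Lfun2_integrable_sqr.
Qed.

Let a_fin t : PX_ t `<< nu -> (\int[nu]_x (sqrt_density nu (PX_ t) x ^+ 2)%:E < +oo)%E.
Proof.
move=> tnu; rewrite (eq_integral (fun x => (1 * sqrt_density nu (PX_ t) x ^+ 2)%:E)); last first.
  by move=> x _; rewrite mul1r.
rewrite -ge0_integral_sqrt_density//.
by rewrite integral_cst// mul1e -ge0_fin_numE// fin_num_measure.
Qed.

Let ua t (h : X -> R) : P_ t `<< mu -> PX_ t `<< nu ->
  same_law (P_ t) (joint_law (PX_ t) (k_ t)) ->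
  (forall x, 0 <= h x) -> measurable_fun setT h ->
  (\int[mu]_z (h z.1 * sqrt_density mu (P_ t) z ^+ 2)%:E =
   \int[nu]_x (h x * sqrt_density nu (PX_ t) x ^+ 2)%:E)%E.
Proof.
move=> tmu tnu tE h0 mh; rewrite -!ge0_integral_sqrt_density//; last first.
  exact: measurableT_comp mh measurable_fst.
rewrite (same_law_integral _ tE).
rewrite (@ge0_integral_joint_law_fst _ _ _ _ _ (PX_ t) (k_ t) (EFin \o h))//.
exact/measurable_EFinP.
Qed.

(** With [c = (t - tstar) / 2], the marginal remainder splits at [b c]. The distance from the root
    density of [PX_ t] to [b c] is controlled by contraction and the joint quadratic-mean bound;
    what is left is [sqrt_rem] times the root density at [tstar]. *)
Lemma dqm_marginal : dqm mu P_ tstar s -> dqm nu PX_ tstar p.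
Proof.
move=> /dqmP sdqm; apply/dqmP => e e0.
have [r r0 rP] := integral_sqrt_rem_littleo mp qi pq e0.
(* Each of the two pieces is doubled by [integral_sqrD_le]: [2 (e / 4)] for the first and, since
   [c ^ 2] is a quarter of [(t - tstar) ^ 2], [2 e / 4] for the second. *)
have e4 : 0 < e / 4 by rewrite divr_gt0.
have close : \forall t \near tstar^', `|(t - tstar) / 2| < r.
  apply: nbhs_dnbhs; near=> t; rewrite normrM (@ger0_norm _ 2^-1) ?invr_ge0//.
  rewrite ltr_pdivrMr// distrC; near: t.
  by apply: cvgr_dist_lt; rewrite ?mulr_gt0//; exact: cvg_id.
near=> t.
have [tmu tnu tE] : [/\ P_ t `<< mu, PX_ t `<< nu &
    same_law (P_ t) (joint_law (PX_ t) (k_ t))].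
  by near: t; apply: nbhs_dnbhs; exact: P_E.
have cr : `|(t - tstar) / 2| < r by near: t; exact: close.
have dqm_t : (\int[mu]_z ((sqrt_density mu (P_ t) z - V z
    - (t - tstar) / 2 * s z * V z) ^+ 2)%:E <= (e / 4 * (t - tstar) ^+ 2)%:E)%E.
  by near: t; exact: sdqm.
set c := (t - tstar) / 2 in cr dqm_t *.
have ma : measurable_fun setT (sqrt_density nu (PX_ t)).
  exact: measurable_sqrt_density.
have mU : measurable_fun setT (sqrt_density mu (P_ t)).
  exact: measurable_sqrt_density.
have mD : measurable_fun setT (fun x => sqrt_rem (p x) (q x) c).
  apply: measurable_funB; last exact: measurable_funM.
  by apply: measurable_funB => //; exact: msq.
rewrite (eq_integral (fun x => (((sqrt_density nu (PX_ t) x - b c x) +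
    sqrt_rem (p x) (q x) c * b0 x) ^+ 2)%:E)); last first.
  by move=> x _; congr EFin; rewrite /b /b0 /sqrt_rem /kap; ring.
apply: le_trans (integral_sqrD_le _ _ _) _.
- exact: measurable_funB.
- exact: measurable_funM.
have -> : e * (t - tstar) ^+ 2 = 2 * (e / 4 * (t - tstar) ^+ 2) + 2 * (e * c ^+ 2).
  by rewrite /c; field.
have mUv : measurable_fun setT (fun z => sqrt_density mu (P_ t) z - v c z).
  exact: measurable_funB.
have -> : (2 * (e / 4 * (t - tstar) ^+ 2) + 2 * (e * c ^+ 2))%:E =
    (2%:E * (e / 4 * (t - tstar) ^+ 2)%:E + 2%:E * (e * c ^+ 2)%:E)%E by [].
apply: leeD; apply: lee_wpmul2l => //; last first.
  rewrite (eq_integral (fun x => (sqrt_rem (p x) (q x) c ^+ 2 * b0 x ^+ 2)%:E)); last first.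
    by move=> x _; rewrite exprMn.
  rewrite -ge0_integral_sqrt_density//; last 2 first.
  - by move=> x; exact: sqr_ge0.
  - exact: measurable_funX.
  exact: rP.
apply: (@le_trans _ _ (\int[mu]_z ((sqrt_density mu (P_ t) z - v c z) ^+ 2)%:E)%E).
  apply: (@hellinger_contraction _ _ _ _ _ mu nu fst) => //.
  - by move=> x; exact: sqrtr_ge0.
  - by move=> x; rewrite mulr_ge0 ?sqrtr_ge0.
  - by move=> h h0 mh; exact: ua.
  - by move=> h h0 mh; exact: vb.
  - exact: a_fin.
apply: (@le_trans _ _ (\int[mu]_z ((sqrt_density mu (P_ t) z - V z
    - c * s z * V z) ^+ 2)%:E)%E); last exact: dqm_t.
apply: ge0_le_integral => //.
- by move=> z _; rewrite lee_fin sqr_ge0.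
- by apply/measurable_EFinP; exact: measurable_funX.
- apply/measurable_EFinP; apply: measurable_funX; apply: measurable_funB.
    exact: measurable_funB.
  by apply: measurable_funM => //; exact: measurable_funM.
(* As the root density at [t] is nonnegative, replacing [1 + c s] by its absolute value can only
   bring the two closer. *)
move=> z _; rewrite lee_fin /v.
have U0 : 0 <= sqrt_density mu (P_ t) z by exact: sqrtr_ge0.
have V0 : 0 <= V z by exact: sqrtr_ge0.
have UV := mulr_ge0 U0 V0.
have w1 := ler_norm (1 + c * s z).
have w2 : `|1 + c * s z| ^+ 2 = (1 + c * s z) ^+ 2 by rewrite real_normK ?num_real.
have := ler_wpM2r UV w1.
by rewrite sqrrB exprMn w2; nra.
Unshelve. all: by end_near. Qed.

End dqm_marginal.

(** * Orthogonality to the tangent space *)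

Section L2_products.
Context d (T : measurableType d) (R : realType) (P : probability T R).

Lemma Lfun2_integrable_mul (f g : T -> R) :
  f \in Lfun P 2%:E -> g \in Lfun P 2%:E ->
  P.-integrable setT (fun z => (f z * g z)%:E).
Proof. by move=> f2 g2; have /Lfun1_integrable := Lfun2_mul_Lfun1 f2 g2. Qed.

Lemma Lfun2_integrable (f : T -> R) : f \in Lfun P 2%:E ->
  P.-integrable setT (EFin \o f).
Proof.
move=> f2; have /Lfun2P[mf _] := f2.
by apply: sqr_integrable_integrable => //;
  [exact: probability_setT|exact: Lfun2_integrable_sqr].
Qed.

Lemma integral_sqr_eq0 (f : T -> R) : measurable_fun setT f ->
  (\int[P]_z (f z * f z)%:E = 0)%E -> {ae P, forall z, f z = 0}.
Proof.
move=> mf f0; have mff : measurable_fun setT (fun z => (f z * f z)%:E).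
  by apply/measurable_EFinP; exact: measurable_funM.
have : ae_eq P setT (fun z => (f z * f z)%:E) (cst 0%E).
  apply/(ae_eq_integral_abs P measurableT mff); rewrite -[RHS]f0.
  by apply: eq_integral => z _; rewrite gee0_abs// lee_fin -expr2 sqr_ge0.
by apply: filterS => z /(_ I) [] /eqP; rewrite mulf_eq0 orbb => /eqP.
Qed.

End L2_products.

Lemma tangent_space_orthogonal d (T : measurableType d) (R : realType)
    (mu : {sigma_finite_measure set T -> \bar R}) (M : set (probability T R))
    (P : probability T R) (u g : T -> R) :
  u \in Lfun P 2%:E -> tangent_space mu M P g ->
  (forall s, is_score mu M P s -> \int[P]_z (u z * s z)%:E = 0)%E ->
  (\int[P]_z (u z * g z)%:E = 0)%E.
Proof.
move=> u2 [g2 gs] us; have [mu_ _] := (Lfun2P _ _).1 u2.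
have [mg _] := (Lfun2P _ _).1 g2.
have N0 := @Lnorm_ge0 _ _ _ P 2%:E (EFin \o u).
have Nfin : 'N[P]_2%:E[EFin \o u]%E \is a fin_num.
  rewrite ge0_fin_numE//.
  by move: u2; rewrite inE => /andP[_]; rewrite inE.
set N := fine 'N[P]_2%:E[EFin \o u]%E.
have NR0 : 0 <= N by rewrite fine_ge0.
apply/eqP; rewrite -abse_eq0 eq_le abse_ge0 andbT.
apply/lee_addgt0Pr => e e0; rewrite add0e.
(* The tolerance is adapted to the Cauchy-Schwarz bound by [N] times the error; adding 1 avoids
   dividing by zero when [u] vanishes almost everywhere. *)
have [n [c [s [ss gse]]]] := gs (e / (N + 1)) ltac:(by rewrite divr_gt0// ltr_wpDl).
have s2 i : s i \in Lfun P 2%:E by have [? [? [? [? ? ? ? []]]]] := ss i.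
have ms i : measurable_fun setT (s i) by have /Lfun2P[] := s2 i.
pose w z := g z - \sum_(i < n) c i * s i z.
have mw : measurable_fun setT w.
  apply: measurable_funB => //; apply: measurable_sum => i.
  exact: measurable_funM.
have -> : (\int[P]_z (u z * g z)%:E = \int[P]_z (u z * w z)%:E)%E.
  have iug := Lfun2_integrable_mul u2 g2.
  have ius i := integrableZl measurableT (c i) (Lfun2_integrable_mul u2 (s2 i)).
  transitivity (\int[P]_z ((u z * g z)%:E -
      \sum_(i < n) ((c i)%:E * (u z * s i z)%:E)))%E; last first.
    apply: eq_integral => z _; under eq_bigr do rewrite -EFinM.
    rewrite sumEFin -EFinB; congr EFin; rewrite /w mulrBr mulr_sumr.
    by congr (_ - _); apply: eq_bigr => i _; rewrite mulrCA.
  rewrite integralB//; last exact: integrable_sum.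
  rewrite integral_sum// big1 ?sube0// => i _.
  by rewrite integralZl ?us ?mule0//; exact: Lfun2_integrable_mul.
apply: (@le_trans _ _ ('N[P]_1[EFin \o (u \* w)%R])%E).
  rewrite Lnorm1; apply: le_abse_integral => //.
  by apply/measurable_EFinP; exact: measurable_funM.
apply: (le_trans (@hoelder _ _ _ P u w 2 2 mu_ mw _ _ _)) => //.
  by rewrite [RHS]splitr !div1r.
rewrite -(fineK Nfin) -/N.
apply: (@le_trans _ _ (N%:E * (e / (N + 1))%:E)%E).
  by apply: lee_wpmul2l; [rewrite lee_fin|exact: ltW].
rewrite -EFinM lee_fin mulrCA ger_pMr// ler_pdivrMr ?ltr_wpDl// mul1r.
by rewrite lerDl.
Qed.

Section conditional_mean_L2.
Context d d' (X : measurableType d) (Y : measurableType d') (R : realType).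
Variables (PX : probability X R) (k : R.-pker X ~> Y).
Local Notation J := (joint_law PX k).

Let k1 x : k x setT = 1%E. Proof. exact: prob_kernel. Qed.

Lemma cmean_Lfun2 (f : X * Y -> R) :
  f \in Lfun J 2%:E -> cmean k f \in Lfun PX 2%:E.
Proof.
move=> f2; have /Lfun2P[mf _] := f2; have f2i := Lfun2_integrable_sqr f2.
have [qi _] := integral_cmean f2i.
have mq : measurable_fun setT (cmean k (fun z => f z ^+ 2)).
  by apply: measurable_cmean; exact: measurable_funX.
have mp : measurable_fun setT (cmean k f) by exact: measurable_cmean.
apply/Lfun2P; split => //; have /integrableP[_] := qi.
apply: le_lt_trans; apply: ae_ge0_le_integral => //.
- by move=> x _; rewrite lee_fin sqr_ge0.
- by apply/measurable_EFinP; exact: measurable_funX.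
- by apply/measurable_EFinP; exact: measurableT_comp.
apply: filterS (ae_kernel_integrable f2i) => x fx _.
rewrite /= lee_fin (le_trans _ (ler_norm _))//.
apply: (sqr_Rintegral_le (k1 x)) fx; exact: measurableT_comp.
Qed.

Lemma integral_joint_law_fst (h : X -> R) : PX.-integrable setT (EFin \o h) ->
  J.-integrable setT (fun z => (h z.1)%:E) /\
  (\int[J]_z (h z.1)%:E = \int[PX]_x (h x)%:E)%E.
Proof.
move=> /[dup] hi /integrableP[mh hfin].
have mh' : measurable_fun setT h by exact/measurable_EFinP.
have mh1 : measurable_fun setT (fun z : X * Y => h z.1).
  exact: measurableT_comp mh' measurable_fst.
have hJ : J.-integrable setT (fun z => (h z.1)%:E).
  apply/integrableP; split; first exact/measurable_EFinP.
  rewrite (@ge0_integral_joint_law_fst _ _ _ _ _ PX k (abse \o (EFin \o h)))//.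
  - by move=> x; exact: abse_ge0.
  - exact: measurableT_comp.
split=> //; have [_ ->] := integral_cmean hJ.
apply: eq_integral => x _; congr EFin.
by rewrite /cmean /= (@Rintegral_cst _ _ _ (k x) setT measurableT (h x)) k1 mulr1.
Qed.

Lemma Lfun2_fst (h : X -> R) : h \in Lfun PX 2%:E ->
  (fun z => h z.1) \in Lfun J 2%:E.
Proof.
move=> /Lfun2P[mh h2]; apply/Lfun2P; split.
  exact: measurableT_comp mh measurable_fst.
rewrite (@ge0_integral_joint_law_fst _ _ _ _ _ PX k (EFin \o (fun x => h x ^+ 2)))//.
- by move=> x; rewrite lee_fin sqr_ge0.
- by apply/measurable_EFinP; exact: measurable_funX.
Qed.

Lemma integral_fst_mul (h : X -> R) (f : X * Y -> R) :
  h \in Lfun PX 2%:E -> f \in Lfun J 2%:E ->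
  (\int[J]_z (h z.1 * f z)%:E = \int[PX]_x (h x * cmean k f x)%:E)%E.
Proof.
move=> h2 f2; have /Lfun2P[mh _] := h2.
apply: integral_cmean_mul => //; first exact: Lfun2_integrable.
exact: Lfun2_integrable_mul (Lfun2_fst h2) f2.
Qed.

(** Uniqueness of conditional expectations: [g] and [cmean k f] have equal integrals over every
    measurable set of [X]. It reduces claims about an arbitrary version to the kernel mean. *)
Lemma cond_exp_eq0 (f : X * Y -> R) (g : X -> R) :
  J.-integrable setT (EFin \o f) -> {ae PX, forall x, cmean k f x = 0} ->
  is_cond_exp J f g -> {ae PX, forall x, g x = 0}.
Proof.
move=> fi f0 [mg gi gA].
have giX : PX.-integrable setT (EFin \o g).
  have /integrableP[_ gfin] := gi; apply/integrableP; split.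
    exact/measurable_EFinP.
  rewrite -(@ge0_integral_joint_law_fst _ _ _ _ _ PX k (abse \o (EFin \o g)))//.
  - by move=> x; exact: abse_ge0.
  - by apply: measurableT_comp => //; exact/measurable_EFinP.
suff : ae_eq PX setT (EFin \o g) (cst 0%E).
  by apply: filterS => x /(_ I) [].
apply: integral_ae_eq => // A _ mA.
have mA1 : measurable (fst @^-1` A : set (X * Y)).
  by rewrite -[Z in measurable Z]setTI; exact: measurable_fst.
have mI : measurable_fun setT (\1_A : X -> R) by exact: measurable_indic.
rewrite integral0.
have intA (F : X * Y -> R) : measurable_fun setT F ->
  (\int[J]_(z in fst @^-1` A) (F z)%:E = \int[J]_z (\1_A z.1 * F z)%:E)%E.
  move=> mF; rewrite integral_mkcond; apply: eq_integral => z _.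
  rewrite patchE indicE -[z \in _ @^-1` _]/(z.1 \in A).
  by case: ifP => _; rewrite ?mul1r ?mul0r.
have bndA (F : X * Y -> R) : J.-integrable setT (EFin \o F) ->
    J.-integrable setT (fun z => (\1_A z.1 * F z)%:E).
  move=> Fi; have mF : measurable_fun setT F.
    by apply/measurable_EFinP; exact: measurable_int Fi.
  apply: (le_integrable measurableT _ _ Fi).
    apply/measurable_EFinP/measurable_funM => //.
    exact: measurableT_comp mI measurable_fst.
  move=> z _; rewrite lee_fin normrM ler_piMl// indicE.
  by case: (_ \in _); rewrite ?normr1 ?normr0.
have mf : measurable_fun setT f by apply/measurable_EFinP; exact: measurable_int fi.
have giA : PX.-integrable setT (fun x => (\1_A x * g x)%:E).
  apply: (le_integrable measurableT _ _ giX).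
    by apply/measurable_EFinP/measurable_funM.
  move=> z _; rewrite lee_fin normrM ler_piMl// indicE.
  by case: (_ \in _); rewrite ?normr1 ?normr0.
transitivity (\int[PX]_x (\1_A x * g x)%:E)%E.
  rewrite integral_mkcond; apply: eq_integral => x _.
  by rewrite patchE indicE; case: ifP => _; rewrite ?mul1r ?mul0r.
have [_ <-] := integral_joint_law_fst giA.
have mg1 : measurable_fun setT (fun z : X * Y => g z.1).
  exact: measurableT_comp mg measurable_fst.
rewrite -(intA (fun z => g z.1))// gA// intA//.
rewrite (integral_cmean_mul fi mI (bndA _ fi)).
rewrite -[RHS](integral0 PX setT); apply: ae_eq_integral => //.
  by apply/measurable_EFinP/measurable_funM => //; exact: measurable_cmean.
by apply: filterS f0 => x -> _; rewrite mulr0.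
Qed.

Lemma same_law_joint_law (QX : probability X R) :
  same_law PX QX -> same_law J (joint_law QX k).
Proof. by move=> PQ A mA; exact: same_law_integral. Qed.

End conditional_mean_L2.

(** * Submodels of the product model and the efficient influence function *)

Section product_model.
Context (R : realType) d d' (X : measurableType d) (Y : measurableType d').
Variables (mu : {sigma_finite_measure set (X * Y)%type -> \bar R})
  (nu : {sigma_finite_measure set X -> \bar R}).
Variables (MX : set (probability X R)) (MK : set (R.-pker X ~> Y)).
Variables (PXstar : probability X R) (kstar : R.-pker X ~> Y).
Let M := joint_model MX MK.
Let Pstar := joint_law PXstar kstar.
Hypothesis Mmu : forall P, M P -> P `<< mu.
Hypothesis MXnu : forall PX, MX PX -> PX `<< nu.
Hypothesis MXstar : MX PXstar.
Hypothesis MKstar : MK kstar.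

Let joint_model_joint_law PX k : MX PX -> MK k -> M (joint_law PX k).
Proof. by move=> PXM kM; exists PX, k. Qed.

(** Since [hellinger_lift] is an equality of integrals, the quadratic-mean bound is carried over
    unchanged. *)
Lemma regular_submodel_joint_law (D : set R) (tstar : R)
    (PX_ : R -> probability X R) (s : X -> R) :
  regular_submodel nu MX PXstar D tstar PX_ s ->
  regular_submodel mu M Pstar D tstar (fun t => joint_law (PX_ t) kstar)
    (fun z => s z.1).
Proof.
move=> [Dt DM PXE sdqm [s2 s0]]; have /Lfun2P[ms _] := s2; split=> //.
- by move=> t /DM PXt; exact: joint_model_joint_law.
- exact: same_law_joint_law.
- have Mt t : D t -> joint_law (PX_ t) kstar `<< mu.
    by move=> /DM PXt; apply/Mmu/joint_model_joint_law.
  have Dtstar := nbhs_singleton Dt.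
  apply/dqmP => e e0; move/dqmP : sdqm => /(_ e e0).
  apply: filterS2 (nbhs_dnbhs Dt) => t tD.
  by rewrite (hellinger_lift (MXnu (DM _ Dtstar)) (MXnu (DM _ tD)) (Mt _ Dtstar) (Mt _ tD)).
- split; first exact: Lfun2_fst.
  move: s0; rewrite !unlock => s0.
  by have [_ ->] := integral_joint_law_fst kstar (Lfun2_integrable s2).
Qed.

Lemma regular_submodel_marginal (D : set R) (tstar : R)
    (P_ : R -> probability (X * Y)%type R) (s : X * Y -> R) :
  regular_submodel mu M Pstar D tstar P_ s -> exists PX_,
  regular_submodel nu MX PXstar D tstar PX_ (cmean kstar s).
Proof.
move=> [Dt DM PE sdqm [s2 s0]].
(* The model only asserts that factors exist for each [t] in [D]. At [tstar] the pair is prescribed,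
   because a law does not determine its kernel everywhere and the score must be averaged with
   [kstar]; off [D] any pair will do. *)
have /choice[pk_ pkP] (t : R) : exists pk : probability X R * (R.-pker X ~> Y),
    (t = tstar -> pk = (PXstar, kstar)) /\
    (D t -> MX pk.1 /\ same_law (P_ t) (joint_law pk.1 pk.2)).
  have [->|tt] := eqVneq t tstar; first by exists (PXstar, kstar).
  have [/DM [PX [k [PXM kM tE]]]|nDt] := pselect (D t).
    by exists (PX, k); split => // /eqP; rewrite (negbTE tt).
  by exists (PXstar, kstar).
have pkstar : pk_ tstar = (PXstar, kstar) by exact: (pkP tstar).1.
exists (fun t => (pk_ t).1); split => //.
- by move=> t /(pkP t).2 [].
- by rewrite pkstar.
- have := @dqm_marginal _ _ _ _ _ mu nu (fun t => (pk_ t).1) (fun t => (pk_ t).2)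
    P_ tstar s.
  rewrite pkstar; apply=> //.
    apply: filterS Dt => t tD; have [PXt tE] := (pkP t).2 tD.
    by split => //; [exact/Mmu/DM|exact: MXnu].
  have /Lfun2P[ms sfin] := s2.
  by apply/Lfun2P; split => //; rewrite (same_law_integral _ PE).
- split; first exact: cmean_Lfun2.
  move: s0; rewrite !unlock => <-.
  by have [_ <-] := integral_cmean (Lfun2_integrable s2).
Qed.

Lemma cmean_eif_eq0 p (theta : probability (X * Y)%type R -> 'rV[R]_p)
    (phi : X * Y -> 'rV[R]_p) (j : 'I_p) :
  is_eif mu M Pstar theta phi -> well_specified theta kstar MX PXstar ->
  {ae PXstar, forall x, cmean kstar (fun z => phi z ord0 j) x = 0}.
Proof.
move=> [[phiL grad] phiT] ws; pose f z := phi z ord0 j.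
have f2 : f \in Lfun Pstar 2%:E by have [] := phiL j.
have score0 s : is_score mu M Pstar s ->
    (\int[PXstar]_x (cmean kstar s x * cmean kstar f x)%:E = 0)%E.
  (* The path is projected to the marginal model and lifted back with the kernel frozen at [kstar].
     Along the new path [theta] is constant, so the derivative given by the gradient is 0. *)
  move=> [D [tstar [P_ /regular_submodel_marginal[PX_ sub]]]].
  have [Dt DM _ _ [Ks2 _]] := sub.
  have der := grad _ _ _ _ (regular_submodel_joint_law sub).
  have cst_der : is_derive tstar (1 : R) (fun t => theta (joint_law (PX_ t) kstar))
      (0 : 'rV[R]_p).
    have cst_der := is_derive_cst (theta Pstar) tstar (1 : R).
    apply: near_eq_is_derive cst_der.
    by apply: filterS Dt => t /DM PXt; exact: ws.
  have /rowP/(_ j) := etrans (esym (@derive_val _ _ _ _ _ _ _ der))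
    (@derive_val _ _ _ _ _ _ _ cst_der).
  rewrite !mxE unlock => fine0.
  rewrite -(integral_fst_mul Ks2 f2).
  have fi := Lfun2_integrable_mul f2 (Lfun2_fst kstar Ks2).
  under eq_integral do rewrite mulrC.
  by rewrite -[LHS]fineK ?fine0//; exact: integrable_fin_num.
have g2 := cmean_Lfun2 f2.
have fT : tangent_space mu M Pstar f.
  rewrite (_ : f = (fun z => \sum_i (delta_mx ord0 j : 'rV[R]_p) ord0 i * phi z ord0 i)).
    exact: phiT.
  apply/funext => z; rewrite (bigD1 j)//= mxE !eqxx mul1r big1 ?addr0// => i ij.
  by rewrite mxE eqxx (negbTE ij) mul0r.
have u2 := Lfun2_fst kstar g2.
(* The test function is the conditional mean [g] read on the product. Its inner product with [f] is
   [E[g ^ 2]], and [score0] makes it orthogonal to every joint score. *)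
have := tangent_space_orthogonal u2 fT.
rewrite (integral_fst_mul g2 f2) => H.
apply: integral_sqr_eq0; first by have /Lfun2P[] := g2.
apply: H => s ss; have [? [? [? [? ? ? ? [s2 _]]]]] := ss.
rewrite (integral_fst_mul g2 s2) -(score0 _ ss).
by apply: eq_integral => x _; rewrite mulrC.
Qed.

End product_model.

(** * Sine and cosine of i.i.d. sums under local alternatives *)

Section trigonometric_bounds.
Variable R : realType.
Implicit Types x y : R.

Lemma ler_norm_sin x : `|sin x| <= `|x|.
Proof.
wlog x0 : x / 0 <= x => [H|].
  have [/H//|/ltW x0] := leP 0 x.
  by rewrite -normrN -sinN -(normrN x) H// oppr_ge0.
have [|c _] := @MVT_segment R sin cos 0 x x0 (fun z _ => is_derive_sin z).
  exact/continuous_subspaceT/continuous_sin.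
by rewrite sin0 !subr0 => ->; rewrite normrM ler_piMl// cos_max.
Qed.

Lemma cos_half x : 1 - cos x = 2 * sin (x / 2) ^+ 2.
Proof.
have -> : cos x = cos (x / 2 + x / 2) by rewrite -splitr.
by have := cos2Dsin2 (x / 2); rewrite cosD -!expr2; lra.
Qed.

Lemma one_sub_cos_ge0 x : 0 <= 1 - cos x.
Proof. by rewrite subr_ge0 cos_le1. Qed.

Lemma one_sub_cos_le_sqr x : 1 - cos x <= x ^+ 2 / 2.
Proof.
have := ler_norm_sin (x / 2); rewrite -ler_sqr ?nnegrE// => H.
have := real_normK (num_real (sin (x / 2))); have := real_normK (num_real (x / 2)).
by rewrite cos_half => e1 e2; rewrite e1 e2 in H; lra.
Qed.

Lemma one_sub_cos_le_norm x : 1 - cos x <= `|x|.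
Proof.
have H := ler_norm_sin (x / 2); have H1 := sin_max (x / 2).
rewrite normrM (@ger0_norm _ 2^-1) ?invr_ge0// in H.
have := real_normK (num_real (sin (x / 2))).
by rewrite cos_half => <-; have := normr_ge0 (sin (x / 2)); nra.
Qed.

(** The mean value theorem for [sin z - z], whose derivative is bounded by [z ^ 2 / 2]. The constant
    is not sharp; only the cubic order matters. *)
Lemma norm_sin_sub_le x : `|sin x - x| <= `|x| ^+ 3 / 2.
Proof.
wlog x0 : x / 0 <= x => [H|].
  have [/H//|/ltW x0] := leP 0 x.
  have := H (- x); rewrite oppr_ge0 sinN normrN -opprD normrN; exact.
have dsin (z : R) : is_derive z 1 (fun z => sin z - z) (cos z - 1) by exact: is_deriveB.
have csin : {within `[0, x], continuous (fun z : R => sin z - z)}.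
  apply: continuous_subspaceT => z; apply: cvgB; first exact: continuous_sin.
  exact: cvg_id.
have [c] := MVT_segment x0 (fun z _ => dsin z) csin.
rewrite in_itv/= => /andP[c0 cx].
rewrite sin0 !subr0 => ->; rewrite normrM -normrN opprB.
rewrite (ger0_norm (one_sub_cos_ge0 c)) (ger0_norm x0).
have := one_sub_cos_le_sqr c; have : c ^+ 2 <= x ^+ 2 by rewrite ler_sqr.
move=> h1 h2; rewrite (_ : x ^+ 3 / 2 = x ^+ 2 / 2 * x); last by ring.
by rewrite ler_wpM2r//; lra.
Qed.

(** The cubic bound suffices up to 2, the triangle inequality beyond. A square is what can be
    dominated when [psi] is merely in L2. *)
Lemma norm_sin_sub_le_sqr x : `|sin x - x| <= x ^+ 2.
Proof.
have [x2|x2] := leP `|x| 2.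
  apply: le_trans (norm_sin_sub_le x) _; rewrite -[leRHS]real_normK ?num_real//.
  by have := normr_ge0 x; nra.
rewrite (le_trans (ler_normB _ _))// -[leRHS]real_normK ?num_real//.
by have := sin_max x; nra.
Qed.

Lemma ler_norm_sinB x y : `|sin x - sin y| <= `|x - y|.
Proof.
wlog xy : x y / y <= x => [H|].
  have [/H//|/ltW xy] := leP y x; by rewrite distrC (distrC x) H.
have [|c _ ->] := @MVT_segment R sin cos y x xy (fun z _ => is_derive_sin z).
  exact/continuous_subspaceT/continuous_sin.
by rewrite normrM ler_piMl// cos_max.
Qed.

End trigonometric_bounds.

Section bounded_expectation.
Context d (T : measurableType d) (R : realType) (P : probability T R).
Implicit Types f g : T -> R.

Lemma bounded_integrable f (B : R) : measurable_fun setT f ->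
  (forall z, `|f z| <= B) -> P.-integrable setT (EFin \o f).
Proof.
move=> mf fB; apply: (le_integrable measurableT _ _
  (unit_mass_integrable_cst (probability_setT P) B)).
- exact/measurable_EFinP.
- by move=> z _; rewrite lee_fin (le_trans (fB z))// ler_norm.
Qed.

Lemma Rintegral_cst1 (c : R) : \int[P]__ c = c.
Proof.
rewrite Rintegral_cst// -[RHS]mulr1; congr (_ * _).
exact: (congr1 fine (probability_setT P)).
Qed.

Lemma Rintegral_le_cst f (B : R) : P.-integrable setT (EFin \o f) ->
  (forall z, f z <= B) -> \int[P]_z f z <= B.
Proof.
move=> fi fB; rewrite -(Rintegral_cst1 B); apply: le_Rintegral => //.
exact: (unit_mass_integrable_cst (probability_setT P)).
Qed.

Lemma Rintegral_ge_cst f (B : R) : P.-integrable setT (EFin \o f) ->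
  (forall z, B <= f z) -> B <= \int[P]_z f z.
Proof.
move=> fi fB; rewrite -[leLHS](Rintegral_cst1 B); apply: le_Rintegral => //.
exact: (unit_mass_integrable_cst (probability_setT P)).
Qed.

Lemma norm_Rintegral_le f (B : R) : measurable_fun setT f ->
  (forall z, `|f z| <= B) -> `|\int[P]_z f z| <= B.
Proof.
move=> mf fB; have fi := bounded_integrable mf fB.
rewrite ler_norml Rintegral_le_cst ?Rintegral_ge_cst//.
- by move=> z; have := fB z; rewrite ler_norml => /andP[].
- by move=> z; have := fB z; rewrite ler_norml => /andP[].
Qed.

Lemma Rintegral_cvg (f_ : nat -> T -> R) f g :
  (forall n, measurable_fun setT (f_ n)) -> measurable_fun setT f ->
  (forall z, f_ n z @[n --> \oo] --> f z) ->
  P.-integrable setT (EFin \o g) -> (forall n z, `|f_ n z| <= g z) ->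
  \int[P]_z f_ n z @[n --> \oo] --> \int[P]_z f z.
Proof.
move=> mf_ mf f_f gi f_g.
have [|||||fi _] := @dominated_convergence _ _ _ P _ measurableT
    (fun n => EFin \o f_ n) (EFin \o f) (EFin \o g).
- by move=> n; exact/measurable_EFinP.
- exact/measurable_EFinP.
- by apply: aeW => z _; apply: cvg_EFin; [exact: nearW|exact: f_f].
- by [].
- by apply: aeW => z n _; rewrite /= lee_fin.
move=> H; apply: fine_cvg; rewrite fineK//; exact: integrable_fin_num.
Qed.

End bounded_expectation.

Section iid_law_integral.
Context d (T : measurableType d) (R : realType) (P : probability T R).

Lemma Rintegral_iid_lawS n (f : n.+1.-tuple T -> R) (B : R) :
  measurable_fun setT f -> (forall t, `|f t| <= B) ->
  measurable_fun setT (fun x => \int[iid_law P n]_t f (tuple_cons (x, t))) /\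
  \int[iid_law P n.+1]_t f t =
    \int[P]_x \int[iid_law P n]_t f (tuple_cons (x, t)).
Proof.
move=> mf fB.
have mc : measurable_fun setT (@tuple_cons _ T n) by exact: measurable_funP.
have mfc : measurable_fun setT (fun z => f (@tuple_cons _ T n z)).
  exact: measurableT_comp mf mc.
have fci : (P \x iid_law P n)%E.-integrable setT
    (EFin \o (fun z => f (tuple_cons z))).
  apply: (@bounded_integrable _ _ _ (P \x iid_law P n)%E _ B) => //.
have mF := measurable_fubini_F fci.
split.
  by apply: measurableT_comp => //; exact: mF.
rewrite /Rintegral /= integral_pushforward//=; last exact/measurable_EFinP.
rewrite -(integral12_prod_meas1 fci); congr fine; apply: eq_integral => x _.
rewrite /fubini_F fineK//.
apply: integrable_fin_num => //; apply: (@bounded_integrable _ _ _ _ _ B).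
  exact: measurableT_comp mfc _.
by move=> t; exact: fB.
Qed.

End iid_law_integral.

Lemma norm_inv_le (R : realType) (m x : R) : 0 < m -> m <= x -> `|x^-1| <= m^-1.
Proof.
move=> m0 mx; have x0 := lt_le_trans m0 mx.
by rewrite gtr0_norm ?invr_gt0// lef_pV2 ?posrE.
Qed.

(** * Affinity of product laws as a substitute for contiguity *)

Section affinity.
Context d (T : measurableType d) (R : realType).
Implicit Types (P Q : probability T R) (f : T -> R).

(* For [r] at most the affinity of [P] and [Q] this is the Cauchy-Schwarz
   inequality; it survives products without any reference to densities. *)
Definition affinity_ge P Q (r : R) : Prop :=
  forall f (m B : R), measurable_fun setT f -> 0 < m ->
    (forall z, m <= f z <= B) ->
    r ^+ 2 <= (\int[P]_z f z) * (\int[Q]_z (f z)^-1).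

(** The squared Hellinger distance is 2 minus twice the affinity. The Cauchy-Schwarz inequality is
    obtained from Young's inequality with a free weight [l]. *)
Lemma hellinger_affinity_ge (mu : {sigma_finite_measure set T -> \bar R}) P Q (r : R) :
  P `<< mu -> Q `<< mu -> 0 <= r ->
  (\int[mu]_z ((sqrt_density mu Q z - sqrt_density mu P z) ^+ 2)%:E
    <= (2 * (1 - r))%:E)%E ->
  affinity_ge P Q r.
Proof.
move=> Pmu Qmu r0 H f m B mf m0 fmB.
have f0 z : 0 < f z by have /andP[/(lt_le_trans m0)] := fmB z.
have fi : P.-integrable setT (EFin \o f).
  apply: (bounded_integrable _ (B := B)) => // z.
  by have /andP[_] := fmB z; rewrite ger0_norm// ltW.
have mV : measurable_fun setT (fun z => (f z)^-1).
  by apply: measurable_fun_inv => // z; exact: ltW.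
have Vi : Q.-integrable setT (EFin \o (fun z => (f z)^-1)).
  apply: (bounded_integrable _ (B := m^-1)) => // z.
  by have /andP[mfz _] := fmB z; exact: norm_inv_le.
set A := \int[P]_z f z; set C := \int[Q]_z (f z)^-1.
have A0 : 0 < A.
  by apply: (lt_le_trans m0); apply: Rintegral_ge_cst => // z; have /andP[] := fmB z.
have C0 : 0 <= C by apply: Rintegral_ge0 => z _; rewrite invr_ge0 ltW.
have [->|rn0] := eqVneq r 0; first by rewrite expr0n mulr_ge0// ltW.
have {}r0 : 0 < r by rewrite lt_neqAle eq_sym rn0.
suff young (l : R) : 0 < l -> 2 * r <= l * A + l^-1 * C.
  (* This weight makes the first term equal to [r], leaving [r <= A C / r]. *)
  have := young (r / A) ltac:(by rewrite divr_gt0).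
  rewrite invf_div divfK ?gt_eqF// => rA.
  have : r * r <= r * (A / r * C) by apply: ler_wpM2l; [exact: ltW|lra].
  by rewrite mulrA (mulrC r (A / r)) divfK// expr2.
move=> l0.
pose p := sqrt_density mu P; pose q := sqrt_density mu Q.
have mp : measurable_fun setT p by exact: measurable_sqrt_density.
have mq : measurable_fun setT q by exact: measurable_sqrt_density.
have eA : (\int[mu]_z (l * f z * p z ^+ 2)%:E = (l * A)%:E)%E.
  rewrite -ge0_integral_sqrt_density//; last 2 first.
  - by move=> z; rewrite mulr_ge0 ?ltW.
  - exact: measurable_funM.
  under eq_integral do rewrite EFinM.
  by rewrite integralZl// EFinM /A /Rintegral fineK//; exact: integrable_fin_num.
have eC : (\int[mu]_z (l^-1 * (f z)^-1 * q z ^+ 2)%:E = (l^-1 * C)%:E)%E.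
  rewrite -ge0_integral_sqrt_density//; last 2 first.
  - by move=> z; rewrite mulr_ge0 ?invr_ge0 ?ltW.
  - exact: measurable_funM.
  under eq_integral do rewrite EFinM.
  by rewrite integralZl// EFinM /C /Rintegral fineK//; exact: integrable_fin_num.
have one (S : probability T R) : S `<< mu -> (\int[mu]_z (sqrt_density mu S z ^+ 2)%:E = 1)%E.
  move=> Smu; transitivity (\int[mu]_z (1 * sqrt_density mu S z ^+ 2)%:E)%E.
    by apply: eq_integral => z _; rewrite mul1r.
  rewrite -ge0_integral_sqrt_density// integral_cst// mul1e.
  exact: probability_setT.
pose F1 z := (q z - p z) ^+ 2; pose F2 z := l * f z * p z ^+ 2.
pose F3 z := l^-1 * (f z)^-1 * q z ^+ 2.
have mF1 : measurable_fun setT F1 by apply: measurable_funX; exact: measurable_funB.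
have mF2 : measurable_fun setT F2.
  by apply: measurable_funM; [exact: measurable_funM|exact: measurable_funX].
have mF3 : measurable_fun setT F3.
  by apply: measurable_funM; [exact: measurable_funM|exact: measurable_funX].
have F10 z : 0 <= F1 z by exact: sqr_ge0.
have F20 z : 0 <= F2 z by rewrite mulr_ge0 ?sqr_ge0 ?mulr_ge0 ?ltW.
have F30 z : 0 <= F3 z by rewrite mulr_ge0 ?sqr_ge0 ?mulr_ge0 ?invr_ge0 ?ltW.
have : (1 + 1 <= (2 * (1 - r) + (l * A + l^-1 * C))%:E)%E.
  rewrite -{1}(one P Pmu) -(one Q Qmu) EFinD EFinD -eA -eC.
  rewrite -ge0_integralD//; last 4 first.
  - by move=> z _; rewrite lee_fin sqr_ge0.
  - by apply/measurable_EFinP; exact: measurable_funX.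
  - by move=> z _; rewrite lee_fin sqr_ge0.
  - by apply/measurable_EFinP; exact: measurable_funX.
  apply: (@le_trans _ _ (\int[mu]_z (F1 z)%:E +
      (\int[mu]_z (F2 z)%:E + \int[mu]_z (F3 z)%:E))%E); last first.
    by apply: leeD.
  have mE1 : measurable_fun setT (fun z => (F1 z)%:E) by exact/measurable_EFinP.
  have mE2 : measurable_fun setT (fun z => (F2 z)%:E) by exact/measurable_EFinP.
  have mE3 : measurable_fun setT (fun z => (F3 z)%:E) by exact/measurable_EFinP.
  rewrite -ge0_integralD//; last 2 first.
  - by move=> z _; rewrite lee_fin.
  - by move=> z _; rewrite lee_fin.
  rewrite -ge0_integralD//; last 3 first.
  - by move=> z _; rewrite lee_fin.
  - by move=> z _; rewrite -EFinD lee_fin addr_ge0.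
  - exact: emeasurable_funD.
  apply: ge0_le_integral => //.
  - by move=> z _; rewrite -EFinD lee_fin addr_ge0 ?sqr_ge0.
  - by apply: emeasurable_funD; apply/measurable_EFinP; exact: measurable_funX.
  - by apply: emeasurable_funD => //; exact: emeasurable_funD.
  move=> z _; rewrite -!EFinD lee_fin /F1 /F2 /F3 -/p -/q.
  have lf0 : 0 < l * f z by rewrite mulr_gt0.
  rewrite -subr_ge0 -invfM.
  have -> : (q z - p z) ^+ 2 + (l * f z * p z ^+ 2 + (l * f z)^-1 * q z ^+ 2)
     - (p z ^+ 2 + q z ^+ 2) = (l * f z)^-1 * (l * f z * p z - q z) ^+ 2.
    by field; rewrite !gt_eqF.
  by rewrite mulr_ge0 ?sqr_ge0// invr_ge0 ltW.
by rewrite -EFinD lee_fin; lra.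
Qed.

(** The test function [1 + 1_A] has inverse [1 - 1_A / 2], so that
    [r ^ 2 <= (1 + P A) (1 - Q A / 2)]. *)
Lemma affinity_ge_measure P Q (r : R) (A : set T) : affinity_ge P Q r ->
  measurable A -> fine (Q A) <= 2 * (1 - r ^+ 2) + 2 * fine (P A).
Proof.
move=> PQ mA.
have mI : measurable_fun setT (\1_A : T -> R) by exact: measurable_indic.
have I01 z : 0 <= (\1_A z : R) <= 1 by rewrite indicE; case: (_ \in _); rewrite /= !lexx ?ler01.
have Ii (S : probability T R) : S.-integrable setT (EFin \o (\1_A : T -> R)).
  apply: (bounded_integrable _ (B := 1)) => // z.
  by have /andP[I0 I1] := I01 z; rewrite ger0_norm.
have IE (S : probability T R) : \int[S]_z (\1_A z) = fine (S A).
  by rewrite /Rintegral integral_indic// setIT.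
have ci (S : probability T R) (c : R) := unit_mass_integrable_cst (probability_setT S) c.
have := PQ (fun z => 1 + \1_A z) 1 2 (measurable_funD (measurable_cst _) mI) ltr01.
have -> : \int[P]_z (1 + \1_A z) = 1 + fine (P A).
  rewrite (RintegralD measurableT (ci P 1) (Ii P)) IE; congr (_ + _).
  exact: Rintegral_cst1.
have -> : \int[Q]_z (1 + \1_A z)^-1 = 1 - 2^-1 * fine (Q A).
  transitivity (\int[Q]_z (1 - 2^-1 * \1_A z)).
    apply: eq_Rintegral => z _; rewrite indicE; case: (_ \in _) => /=.
      by field.
    by field.
  have IQ : Q.-integrable setT (EFin \o (fun z => 2^-1 * \1_A z)).
    exact: (integrableZl measurableT 2^-1 (Ii Q)).
  rewrite (RintegralB measurableT (ci Q 1) IQ); congr (_ - _).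
    exact: Rintegral_cst1.
  by rewrite (RintegralZl 2^-1 measurableT (Ii Q)) IE.
move=> /(_ (fun z => ltac:(by have := I01 z; lra))).
have P0 : 0 <= fine (P A) by rewrite fine_ge0.
have Q0 : 0 <= fine (Q A) by rewrite fine_ge0.
by have := mulr_ge0 P0 Q0; nra.
Qed.

End affinity.

Section iid_affinity.
Context d (T : measurableType d) (R : realType) (P Q : probability T R).

(** Integrating out the last [n] coordinates of [f] under [P] and of its inverse under [Q] gives [F]
    and [G]. By induction [G >= r ^ (2 n) / F] pointwise, and the one-dimensional inequality applies
    to [F], which inherits the bounds of [f]. *)
Lemma affinity_ge_iid_law (r : R) n : 0 <= r ->
  affinity_ge P Q r -> affinity_ge (iid_law P n) (iid_law Q n) (r ^+ n).
Proof.
move=> r0 PQ; elim: n => [|n IH] f m B mf m0 fmB.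
  pose c := f [tuple].
  have fc t : f t = c by rewrite (tuple0 t).
  have c0 : 0 < c by have /andP[/(lt_le_trans m0)] := fmB [tuple].
  have -> : \int[iid_law P 0]_t f t = c.
    by rewrite -[RHS](Rintegral_cst1 (iid_law P 0)); apply: eq_Rintegral => t _.
  have -> : \int[iid_law Q 0]_t (f t)^-1 = c^-1.
    rewrite -[RHS](Rintegral_cst1 (iid_law Q 0)).
    by apply: eq_Rintegral => t _; rewrite fc.
  by rewrite expr1n divff// gt_eqF.
have f0 t : 0 < f t by have /andP[/(lt_le_trans m0)] := fmB t.
have fB t : `|f t| <= B by have /andP[_] := fmB t; rewrite ger0_norm// ltW.
have mV : measurable_fun setT (fun t => (f t)^-1).
  by apply: measurable_fun_inv => // t; exact: ltW.
have VB t : `|(f t)^-1| <= m^-1.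
  by have /andP[mft _] := fmB t; exact: norm_inv_le.
have [mF ->] := Rintegral_iid_lawS P mf fB.
have [mG ->] := Rintegral_iid_lawS Q mV VB.
set F := fun x => _ in mF *; set G := fun x => _ in mG *.
have msec x : measurable_fun setT (fun t : n.-tuple T => f (tuple_cons (x, t))).
  have mc : measurable_fun setT (@tuple_cons _ T n) by exact: measurable_funP.
  by apply: (measurableT_comp (measurableT_comp mf mc)).
have FmB x : m <= F x <= B.
  have Fi : (iid_law P n).-integrable setT
      (EFin \o (fun t => f (tuple_cons (x, t)))).
    exact: (bounded_integrable _ (B := B)).
  apply/andP; split.
    by apply: Rintegral_ge_cst => // t; have /andP[] := fmB (tuple_cons (x, t)).
  by apply: Rintegral_le_cst => // t; have /andP[] := fmB (tuple_cons (x, t)).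
have F0 x : 0 < F x by have /andP[/(lt_le_trans m0)] := FmB x.
have FG x : (r ^+ n) ^+ 2 <= F x * G x.
  by apply: (IH _ m B) => // t; exact: fmB.
have GB x : `|G x| <= m^-1.
  apply: norm_Rintegral_le => [|t]; last exact: VB.
  by apply: measurable_fun_inv => // t; exact: ltW.
have mFV : measurable_fun setT (fun x => (F x)^-1).
  by apply: measurable_fun_inv => // x; exact: ltW.
have FVi : Q.-integrable setT (EFin \o (fun x => (F x)^-1)).
  apply: (bounded_integrable _ (B := m^-1)) => // x.
  by have /andP[mfx _] := FmB x; exact: norm_inv_le.
have Fi : P.-integrable setT (EFin \o F).
  apply: (bounded_integrable _ (B := B)) => // x.
  by have /andP[_] := FmB x; rewrite ger0_norm// ltW.
have EF0 : 0 <= \int[P]_x F x by apply: Rintegral_ge0 => x _; exact: ltW.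
have step : (r ^+ n) ^+ 2 * \int[Q]_x (F x)^-1 <= \int[Q]_x G x.
  rewrite -RintegralZl//; apply: le_Rintegral => //.
  - exact: (integrableZl measurableT ((r ^+ n) ^+ 2) FVi).
  - exact: (bounded_integrable _ (B := m^-1)).
  - by move=> x _; rewrite ler_pdivrMr// [leRHS]mulrC.
apply: le_trans (ler_wpM2l EF0 step).
rewrite mulrCA [r ^+ n.+1]exprSr exprMn ler_wpM2l ?sqr_ge0//.
exact: (PQ F m B).
Qed.

(** The affinity is at least [1 - H / 2], and Bernoulli's inequality bounds its power [2 n] below by
    [1 - n H]. The assumption [H <= 2] keeps the base nonnegative. *)
Lemma iid_law_measure_le (mu : {sigma_finite_measure set T -> \bar R}) (H : R) n
    (A : set (n.-tuple T)) :
  P `<< mu -> Q `<< mu -> H <= 2 ->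
  (\int[mu]_z ((sqrt_density mu Q z - sqrt_density mu P z) ^+ 2)%:E <= H%:E)%E ->
  measurable A ->
  fine (iid_law Q n A) <= 2 * n%:R * H + 2 * fine (iid_law P n A).
Proof.
move=> Pmu Qmu H2 PQH mA; pose r := 1 - H / 2.
have H0 : 0 <= H.
  by rewrite -lee_fin (le_trans _ PQH)// integral_ge0// => z _; rewrite lee_fin sqr_ge0.
have r0 : 0 <= r by rewrite /r; lra.
have PQr : affinity_ge P Q r.
  apply: (hellinger_affinity_ge Pmu Qmu r0).
  by rewrite (_ : 2 * (1 - r) = H)//; rewrite /r; field.
have := affinity_ge_measure (affinity_ge_iid_law (n := n) r0 PQr) mA.
suff : 1 - n%:R * H <= (r ^+ n) ^+ 2 by lra.
rewrite -exprM muln2 -addnn.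
have bern k : 1 - k%:R * (1 - r) <= r ^+ k.
  elim: k => [|k IHk]; first by rewrite mul0r subr0.
  rewrite exprS -natr1; apply: le_trans (ler_wpM2l r0 IHk).
  by have := mulr_ge0 (ler0n R k) (sqr_ge0 (1 - r)); lra.
apply: le_trans (bern (n + n)%N); rewrite natrD /r.
by rewrite le_eqVlt; apply/orP; left; apply/eqP; field.
Qed.

End iid_affinity.

Section iid_characteristic.
Context d (T : measurableType d) (R : realType) (Q : probability T R).
Variable g : T -> R.
Hypothesis mg : measurable_fun setT g.

Lemma measurable_tuple_sum n :
  measurable_fun setT (fun t : n.-tuple T => \sum_(i < n) g (tnth t i)).
Proof.
apply: measurable_sum => i; exact: measurableT_comp mg (measurable_tnth i).
Qed.

Let msin : measurable_fun setT (@sin R).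
Proof. exact: continuous_measurable_fun (@continuous_sin R). Qed.

Let mcos : measurable_fun setT (@cos R).
Proof. exact: continuous_measurable_fun (@continuous_cos R). Qed.

Let c := \int[Q]_z cos (g z).
Let s := \int[Q]_z sin (g z).

(* [e * (cos b + i sin b)] approximates the characteristic function of [g] under
   [Q] up to [eps], hence its [n]-th power approximates that of the sum. *)
Lemma iid_law_sin_sum (e b eps : R) n (th : R) : 0 <= e <= 1 ->
  `|c - e * cos b| + `|s - e * sin b| <= eps ->
  `|\int[iid_law Q n]_t sin (th + \sum_(i < n) g (tnth t i))
     - e ^+ n * sin (th + n%:R * b)| <= n%:R * eps.
Proof.
(* The phase is generalised because peeling off the first observation adds [g x] to it. *)
move=> /andP[e0 e1] ceps; elim: n th => [|n IH] th.
  rewrite expr0 mul1r !mul0r addr0.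
  have -> : \int[iid_law Q 0]_t sin (th + \sum_(i < 0) g (tnth t i)) = sin th.
    rewrite -[RHS](Rintegral_cst1 (iid_law Q 0)); apply: eq_Rintegral => t _.
    by rewrite big_ord0 addr0.
  by rewrite subrr normr0.
have mf : measurable_fun setT (fun t : n.+1.-tuple T =>
    sin (th + \sum_(i < n.+1) g (tnth t i))).
  apply: measurableT_comp msin _; apply: measurable_funD => //.
  exact: measurable_tuple_sum.
have [mF ->] := Rintegral_iid_lawS Q mf (fun t => sin_max _).
set F := fun x => _ in mF *.
have FE x : F x = \int[iid_law Q n]_t sin ((th + g x) + \sum_(i < n) g (tnth t i)).
  apply: eq_Rintegral => t _; rewrite big_ord_recl addrA tnth0; congr (sin (_ + _)).
  by apply: eq_bigr => i _; rewrite tnthS.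
pose ph := th + n%:R * b.
pose G x := e ^+ n * sin (ph + g x).
have mG : measurable_fun setT G.
  apply: measurable_funM => //; apply: measurableT_comp msin _.
  exact: measurable_funD.
have en1 : 0 <= e ^+ n <= 1 by rewrite exprn_ge0//= exprn_ile1.
have GB x : `|G x| <= 1.
  have /andP[en0 en1'] := en1.
  rewrite normrM (ger0_norm en0) -[leRHS]mulr1.
  by apply: ler_pM => //; exact: sin_max.
have FB x : `|F x| <= 1.
  rewrite FE; apply: norm_Rintegral_le => [|t]; last exact: sin_max.
  apply: measurableT_comp msin _; apply: measurable_funD => //.
  exact: measurable_tuple_sum.
have Fi := bounded_integrable Q mF FB; have Gi := bounded_integrable Q mG GB.
have sB (z : T) : `|sin (g z)| <= 1 by exact: sin_max.
have cB (z : T) : `|cos (g z)| <= 1 by exact: cos_max.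
have msg : measurable_fun setT (fun z => sin (g z)) by exact: measurableT_comp msin mg.
have mcg : measurable_fun setT (fun z => cos (g z)) by exact: measurableT_comp mcos mg.
have si := bounded_integrable Q msg sB; have ci := bounded_integrable Q mcg cB.
have GE : \int[Q]_x G x = e ^+ n * (sin ph * c + cos ph * s).
  rewrite /G; transitivity (\int[Q]_x (e ^+ n * sin ph * cos (g x)
      + e ^+ n * cos ph * sin (g x))).
    by apply: eq_Rintegral => x _; rewrite sinD; ring.
  have i1 : Q.-integrable setT (EFin \o (fun x => e ^+ n * sin ph * cos (g x))).
    exact: (integrableZl measurableT (e ^+ n * sin ph) ci).
  have i2 : Q.-integrable setT (EFin \o (fun x => e ^+ n * cos ph * sin (g x))).
    exact: (integrableZl measurableT (e ^+ n * cos ph) si).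
  rewrite (RintegralD measurableT i1 i2) (RintegralZl _ measurableT ci).
  by rewrite (RintegralZl _ measurableT si) /c /s; ring.
have FG : `|\int[Q]_x F x - \int[Q]_x G x| <= n%:R * eps.
  rewrite -RintegralB//; apply: norm_Rintegral_le.
    exact: measurable_funB.
  move=> x; rewrite FE /G /ph addrAC; exact: IH.
(* The first difference is the induction hypothesis under the integral. The second is the error of a
   single factor and costs at most one [eps], as [e ^ n <= 1]. *)
have -> : \int[Q]_x F x - e ^+ n.+1 * sin (th + n.+1%:R * b) =
    (\int[Q]_x F x - \int[Q]_x G x) +
    e ^+ n * (sin ph * (c - e * cos b) + cos ph * (s - e * sin b)).
  rewrite GE (_ : th + n.+1%:R * b = ph + b); last by rewrite /ph -natr1; ring.
  by rewrite sinD exprSr; ring.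
rewrite (le_trans (ler_normD _ _))// -natr1 mulrDl mul1r lerD//.
apply: le_trans ceps; have /andP[en0 en1'] := en1.
rewrite normrM (ger0_norm en0) (le_trans (ler_piMl _ en1'))//.
rewrite (le_trans (ler_normD _ _))// !normrM lerD//.
- by rewrite ler_piMl// sin_max.
- by rewrite ler_piMl// cos_max.
Qed.

End iid_characteristic.

(** * Expectations along paths differentiable in quadratic mean *)

Section dqm_expectation.
Context d (T : measurableType d) (R : realType).
Variable mu : {sigma_finite_measure set T -> \bar R}.
Implicit Types P Q : probability T R.

Lemma integrable_sqrt_density P (f : T -> R) : P `<< mu ->
  P.-integrable setT (EFin \o f) ->
  mu.-integrable setT (EFin \o (fun z => f z * sqrt_density mu P z ^+ 2)).
Proof.
move=> Pmu fi; have mf : measurable_fun setT f.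
  by apply/measurable_EFinP; exact: measurable_int fi.
have mp : measurable_fun setT (sqrt_density mu P) by exact: measurable_sqrt_density.
apply/integrableP; split.
  by apply/measurable_EFinP/measurable_funM => //; exact: measurable_funX.
have /integrableP[_] := fi; apply: le_lt_trans.
have mnf : measurable_fun setT (fun z => `|f z|) by exact: measurableT_comp.
rewrite [leRHS](ge0_integral_sqrt_density Pmu (fun z => normr_ge0 (f z)) mnf).
rewrite le_eqVlt; apply/orP; left; apply/eqP; apply: eq_integral => z _ /=.
by rewrite normrM (ger0_norm (sqr_ge0 _)).
Qed.

Lemma Rintegral_sqrt_density P (f : T -> R) : P `<< mu ->
  P.-integrable setT (EFin \o f) ->
  \int[P]_z f z = \int[mu]_z (f z * sqrt_density mu P z ^+ 2).
Proof.
move=> Pmu fi; have mf : measurable_fun setT f.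
  by apply/measurable_EFinP; exact: measurable_int fi.
pose fp z := Num.max (f z) 0; pose fn z := Num.max (- f z) 0.
have mfp : measurable_fun setT fp by apply: measurable_maxr.
have mfn : measurable_fun setT fn.
  by apply: measurable_maxr => //; exact: measurable_funN.
have fE z : f z = fp z - fn z.
  by rewrite /fp /fn !maxEle; case: ifPn => h1; case: ifPn => h2;
    rewrite -?ltNge in h1 h2; lra.
have fp0 z : 0 <= fp z by rewrite /fp le_max lexx orbT.
have fn0 z : 0 <= fn z by rewrite /fn le_max lexx orbT.
have ip : P.-integrable setT (EFin \o fp).
  apply: (le_integrable measurableT _ _ fi); first exact/measurable_EFinP.
  move=> z _; rewrite lee_fin ger0_norm// /fp ge_max normr_ge0 andbT; exact: ler_norm.
have iN : P.-integrable setT (EFin \o fn).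
  apply: (le_integrable measurableT _ _ fi); first exact/measurable_EFinP.
  move=> z _; rewrite lee_fin ger0_norm// /fn ge_max normr_ge0 andbT.
  by rewrite -normrN ler_norm.
have ipw := integrable_sqrt_density Pmu ip.
have inw := integrable_sqrt_density Pmu iN.
under eq_Rintegral do rewrite fE.
under [RHS]eq_Rintegral do rewrite fE mulrBl.
rewrite !RintegralB//; congr (_ - _); rewrite /Rintegral; congr fine;
  exact: ge0_integral_sqrt_density.
Qed.

(** Writing [q = p + c s p + r], one has [q ^ 2 - p ^ 2 - 2 c s p ^ 2 = 2 r p + (c s p + r) ^ 2].
    Young's inequality with weight [lam] splits [2 |F r| p], the square is doubled, and [|F| <= 2]
    accounts for the 4 in [lam + 4]. *)
Lemma dqm_expectation P Q (s F : T -> R) (c eta lam : R) :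
  P `<< mu -> Q `<< mu -> s \in Lfun P 2%:E -> measurable_fun setT F ->
  (forall z, `|F z| <= 2) -> 0 < lam ->
  (\int[mu]_z ((sqrt_density mu Q z - sqrt_density mu P z
     - c * s z * sqrt_density mu P z) ^+ 2)%:E <= eta%:E)%E ->
  `|\int[Q]_z F z - \int[P]_z F z - 2 * c * \int[P]_z (s z * F z)| <=
    (lam + 4) * eta + (lam^-1 * \int[P]_z (F z ^+ 2)
      + 2 * c ^+ 2 * \int[P]_z (`|F z| * s z ^+ 2)).
Proof.
move=> Pmu Qmu s2 mF F2 lam0 Heta; have /Lfun2P[ms _] := s2.
pose p := sqrt_density mu P; pose q := sqrt_density mu Q.
have mp : measurable_fun setT p by exact: measurable_sqrt_density.
have mq : measurable_fun setT q by exact: measurable_sqrt_density.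
have FiP := bounded_integrable P mF F2.
have FiQ := bounded_integrable Q mF F2.
have F2i : P.-integrable setT (EFin \o (fun z => F z ^+ 2)).
  apply: (bounded_integrable _ (B := 4)); first exact: measurable_funX.
  move=> z; have := F2 z; have := normr_ge0 (F z); rewrite normrX; nra.
have s2i := Lfun2_integrable_sqr s2.
have sFi : P.-integrable setT (EFin \o (fun z => s z * F z)).
  apply: (le_integrable measurableT _ _ (integrableZl measurableT 2
    (integrable_abse (Lfun2_integrable s2)))).
    by apply/measurable_EFinP/measurable_funM.
  move=> z _; rewrite /= lee_fin !normrM normr_id mulrC.
  by apply: ler_pM => //; rewrite (le_trans (F2 z))// ler_norm.
have Fs2i : P.-integrable setT (EFin \o (fun z => `|F z| * s z ^+ 2)).
  apply: (le_integrable measurableT _ _ (integrableZl measurableT 2 s2i)).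
    apply/measurable_EFinP/measurable_funM; last exact: measurable_funX.
    exact: measurableT_comp.
  move=> z _; rewrite /= lee_fin !normrM normr_id.
  by apply: ler_pM => //; rewrite (le_trans (F2 z))// ler_norm.
have i1 := integrable_sqrt_density Qmu FiQ.
have i2 := integrable_sqrt_density Pmu FiP.
have i3 := integrable_sqrt_density Pmu sFi.
have i3' : mu.-integrable setT (EFin \o (fun z => 2 * c * (s z * F z * p z ^+ 2))).
  exact: (integrableZl measurableT (2 * c) i3).
have i12 : mu.-integrable setT (EFin \o (fun z => F z * q z ^+ 2 - F z * p z ^+ 2)).
  exact: (integrableB measurableT i1 i2).
rewrite (Rintegral_sqrt_density Qmu FiQ) (Rintegral_sqrt_density Pmu FiP).
rewrite (Rintegral_sqrt_density Pmu sFi) -(RintegralZl _ measurableT i3).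
rewrite -(RintegralB measurableT i1 i2) -(RintegralB measurableT i12 i3').
have iX : mu.-integrable setT (EFin \o (fun z => F z * q z ^+ 2 - F z * p z ^+ 2
    - 2 * c * (s z * F z * p z ^+ 2))).
  exact: (integrableB measurableT i12 i3').
rewrite -lee_fin (EFin_normr_Rintegral measurableT iX).
apply: (le_trans (le_abse_integral mu measurableT (measurable_int _ iX))).
pose r z := q z - p z - c * s z * p z.
have mr : measurable_fun setT r.
  apply: measurable_funB; first exact: measurable_funB.
  by apply: measurable_funM => //; exact: measurable_funM.
pose G1 z := (lam + 4) * r z ^+ 2.
pose G2 z := lam^-1 * (F z ^+ 2 * p z ^+ 2).
pose G3 z := 2 * c ^+ 2 * (`|F z| * s z ^+ 2 * p z ^+ 2).
have lam40 : 0 <= lam + 4 by rewrite addr_ge0// ltW.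
have mG1 : measurable_fun setT (fun z => (G1 z)%:E).
  by apply/measurable_EFinP/measurable_funM => //; exact: measurable_funX.
have mF2 : measurable_fun setT (fun z => (F z ^+ 2 * p z ^+ 2)%:E).
  by apply/measurable_EFinP; apply: measurable_funM; exact: measurable_funX.
have mFs : measurable_fun setT (fun z => (`|F z| * s z ^+ 2 * p z ^+ 2)%:E).
  apply/measurable_EFinP; apply: measurable_funM; last exact: measurable_funX.
  by apply: measurable_funM; [exact: measurableT_comp|exact: measurable_funX].
have mG2 : measurable_fun setT (fun z => (G2 z)%:E).
  by apply/measurable_EFinP; apply: measurable_funM => //; exact/measurable_EFinP.
have mG3 : measurable_fun setT (fun z => (G3 z)%:E).
  by apply/measurable_EFinP; apply: measurable_funM => //; exact/measurable_EFinP.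
have G10 z : 0 <= G1 z by rewrite mulr_ge0 ?sqr_ge0.
have G20 z : 0 <= G2 z.
  apply: mulr_ge0; first by rewrite invr_ge0 ltW.
  by rewrite mulr_ge0 ?sqr_ge0.
have G30 z : 0 <= G3 z.
  apply: mulr_ge0; first by rewrite mulr_ge0 ?sqr_ge0.
  by apply: mulr_ge0; rewrite ?sqr_ge0// mulr_ge0 ?sqr_ge0.
apply: (@le_trans _ _ (\int[mu]_z ((G1 z)%:E + ((G2 z)%:E + (G3 z)%:E)))%E).
  apply: ge0_le_integral => //.
  - by apply: measurableT_comp => //; exact: measurable_int iX.
  - by apply: emeasurable_funD => //; exact: emeasurable_funD.
  move=> z _; rewrite -!EFinD lee_fin.
  have -> : F z * q z ^+ 2 - F z * p z ^+ 2 - 2 * c * (s z * F z * p z ^+ 2) =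
      F z * (2 * r z * p z + (c * s z * p z + r z) ^+ 2) by rewrite /r; ring.
  rewrite normrM; have p0 : 0 <= p z by exact: sqrtr_ge0.
  set Y := 2 * r z * p z + (c * s z * p z + r z) ^+ 2.
  have YE : `|Y| <= 2 * `|r z| * p z + (2 * (c * s z * p z) ^+ 2 + 2 * `|r z| ^+ 2).
    rewrite (le_trans (ler_normD _ _))//; apply: lerD.
      by rewrite !normrM (ger0_norm p0) ger0_norm.
    rewrite (ger0_norm (sqr_ge0 _)) real_normK ?num_real//.
    by have := sqr_ge0 (c * s z * p z - r z); nra.
  apply: le_trans (ler_wpM2l (normr_ge0 (F z)) YE) _.
  have R2 : `|r z| ^+ 2 = r z ^+ 2 by rewrite real_normK ?num_real.
  have F2E : `|F z| ^+ 2 = F z ^+ 2 by rewrite real_normK ?num_real.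
  rewrite /G1 /G2 /G3 -R2 -F2E.
  have Fz := F2 z; have := normr_ge0 (F z); have := normr_ge0 (r z).
  move: (`|F z|) (`|r z|) Fz => f rr f2 rr0 f0.
  have young : 2 * f * rr * p z <= lam * rr ^+ 2 + lam^-1 * (f ^+ 2 * p z ^+ 2).
    rewrite -subr_ge0.
    have -> : lam * rr ^+ 2 + lam^-1 * (f ^+ 2 * p z ^+ 2) - 2 * f * rr * p z =
      lam^-1 * (lam * rr - f * p z) ^+ 2 by field; rewrite gt_eqF.
    by rewrite mulr_ge0 ?sqr_ge0// invr_ge0 ltW.
  have : f * rr ^+ 2 <= 2 * rr ^+ 2 by rewrite ler_wpM2r ?sqr_ge0.
  by nra.
rewrite ge0_integralD//; last 3 first.
- by move=> z _; rewrite lee_fin.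
- by move=> z _; rewrite -EFinD lee_fin addr_ge0.
- exact: emeasurable_funD.
rewrite ge0_integralD//; last 2 first.
- by move=> z _; rewrite lee_fin.
- by move=> z _; rewrite lee_fin.
rewrite EFinD; apply: leeD.
  under eq_integral do rewrite /G1 EFinM.
  rewrite ge0_integralZl//; last 2 first.
  - by apply/measurable_EFinP; exact: measurable_funX.
  - by move=> z _; rewrite lee_fin sqr_ge0.
  by rewrite EFinM; apply: lee_wpmul2l => //; rewrite lee_fin.
rewrite EFinD; apply: leeD; rewrite le_eqVlt; apply/orP; left; apply/eqP.
  under eq_integral do rewrite /G2 EFinM.
  rewrite ge0_integralZl//; last 2 first.
  - by move=> z _; rewrite lee_fin mulr_ge0 ?sqr_ge0.
  - by rewrite lee_fin invr_ge0 ltW.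
  rewrite -ge0_integral_sqrt_density//; last 2 first.
  - by move=> z; exact: sqr_ge0.
  - exact: measurable_funX.
  by rewrite EFinM /Rintegral fineK//; exact: integrable_fin_num.
under eq_integral do rewrite /G3 EFinM.
rewrite ge0_integralZl//; last 2 first.
- by move=> z _; rewrite lee_fin mulr_ge0 ?sqr_ge0// mulr_ge0 ?sqr_ge0.
- by rewrite lee_fin mulr_ge0 ?sqr_ge0.
rewrite -ge0_integral_sqrt_density//; last 2 first.
- by move=> z; rewrite mulr_ge0 ?sqr_ge0.
- by apply: measurable_funM; [exact: measurableT_comp|exact: measurable_funX].
by rewrite [RHS]EFinM /Rintegral fineK//; exact: integrable_fin_num.
Qed.

End dqm_expectation.

Section local_scale.
Variable R : realType.

(* The junk value of [0^-1] makes [root_scale 0 = 0]. *)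
Definition root_scale (n : nat) : R := (Num.sqrt n%:R)^-1.

Lemma root_scale_ge0 n : 0 <= root_scale n.
Proof. by rewrite invr_ge0 sqrtr_ge0. Qed.

Lemma root_scale_sqr n : root_scale n ^+ 2 = n%:R^-1.
Proof. by rewrite exprVn sqr_sqrtr. Qed.

Lemma natr_root_scale_sqr_le1 n : n%:R * root_scale n ^+ 2 <= 1.
Proof.
rewrite root_scale_sqr; have [->|n0] := eqVneq n 0%N; first by rewrite mul0r.
by rewrite divff// pnatr_eq0.
Qed.

Lemma natr_root_scale n : n%:R * root_scale n = Num.sqrt n%:R.
Proof.
have [->|n0] := eqVneq n 0%N; first by rewrite mul0r sqrtr0.
have s0 : Num.sqrt n%:R != 0 :> R by rewrite gt_eqF// sqrtr_gt0 ltr0n lt0n.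
by rewrite -{1}(@sqr_sqrtr _ n%:R)// /root_scale expr2 mulfK.
Qed.

Lemma sqrt_root_scale n : (0 < n)%N -> Num.sqrt n%:R * root_scale n = 1 :> R.
Proof. by move=> n0; rewrite divff// gt_eqF// sqrtr_gt0 ltr0n. Qed.

Lemma sqrt_root_scale_sqr n : Num.sqrt n%:R * root_scale n ^+ 2 = root_scale n.
Proof.
have [->|n0] := posnP n; first by rewrite /root_scale sqrtr0 invr0 mul0r.
by rewrite expr2 mulrA sqrt_root_scale// mul1r.
Qed.

Lemma root_scale_cvg0 : root_scale n @[n --> \oo] --> 0.
Proof.
have h : (fun n => n%:R^-1 : R) @ \oo --> 0.
  by rewrite -cvg_shiftS; exact: cvg_harmonic.
rewrite -[X in _ --> X](@sqrtr0 R).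
have -> : root_scale = (fun n => Num.sqrt (n%:R^-1)).
  by apply/funext => n; rewrite sqrtrV.
by apply: continuous_cvg h; exact: sqrt_continuous.
Qed.

Lemma root_scaleM_cvg0 (y : R) : root_scale n * y @[n --> \oo] --> 0.
Proof. by rewrite -(mul0r y); apply: cvgMl; exact: root_scale_cvg0. Qed.

Lemma cvg0_le (u v : nat -> R) : (\forall n \near \oo, `|u n| <= v n) ->
  v n @[n --> \oo] --> 0 -> u n @[n --> \oo] --> 0.
Proof.
move=> uv v0; apply/cvgrPdist_le => e e0.
have /cvgrPdist_le/(_ e e0) := v0; apply: filterS2 uv => n uvn.
by rewrite !sub0r !normrN => ve; rewrite (le_trans uvn)// (le_trans (ler_norm _)).
Qed.

Lemma sqrt_sin_cvg (y : R) : Num.sqrt n%:R * sin (root_scale n * y) @[n --> \oo] --> y.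
Proof.
apply/subr_cvg0; apply: (cvg0_le _ (root_scaleM_cvg0 (y ^+ 2))).
exists 1%N => // n /= n0.
have -> : Num.sqrt n%:R * sin (root_scale n * y) - y =
    Num.sqrt n%:R * (sin (root_scale n * y) - root_scale n * y).
  by rewrite mulrBr mulrA sqrt_root_scale// mul1r.
rewrite normrM ger0_norm ?sqrtr_ge0// -[in leRHS](sqrt_root_scale_sqr n) -mulrA -exprMn.
by rewrite ler_wpM2l ?sqrtr_ge0// norm_sin_sub_le_sqr.
Qed.

Lemma sqrt_cos_cvg (y : R) :
  Num.sqrt n%:R * (cos (root_scale n * y) - 1) @[n --> \oo] --> 0.
Proof.
apply: (cvg0_le _ (root_scaleM_cvg0 (y ^+ 2))).
apply: nearW => n; rewrite normrM ger0_norm ?sqrtr_ge0//.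
rewrite -[in leRHS](sqrt_root_scale_sqr n) -mulrA -exprMn ler_wpM2l ?sqrtr_ge0//.
rewrite -normrN opprB ger0_norm ?one_sub_cos_ge0//.
apply: le_trans (one_sub_cos_le_sqr _) _.
by have := sqr_ge0 (root_scale n * y); lra.
Qed.

Lemma natr_sin_sub_cvg (y : R) :
  n%:R * (sin (root_scale n * y) - root_scale n * y) @[n --> \oo] --> 0.
Proof.
apply: (cvg0_le _ (root_scaleM_cvg0 (`|y| ^+ 3))).
apply: nearW => n; rewrite normrM ger0_norm//.
apply: le_trans (ler_wpM2l (ler0n _ _) (norm_sin_sub_le _)) _.
rewrite normrM (ger0_norm (root_scale_ge0 n)) exprMn.
have a0 := root_scale_ge0 n; have y0 : 0 <= `|y| ^+ 3 by rewrite exprn_ge0.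
have := mulr_ge0 a0 y0; have := natr_root_scale_sqr_le1 n.
move: (root_scale n) (`|y| ^+ 3) a0 y0 => a w a0 w0 na aw.
have : (n%:R * a ^+ 2) * (a * w) <= 1 * (a * w) by rewrite ler_wpM2r.
by rewrite exprS; have := aw; nra.
Qed.

(** By the half-angle formula the sequence is minus twice the square of that of [sqrt_sin_cvg] at
    [y / 2]. *)
Lemma natr_cos_cvg (y : R) :
  n%:R * (cos (root_scale n * y) - 1) @[n --> \oo] --> - (y ^+ 2 / 2).
Proof.
have h := @sqrt_sin_cvg (y / 2).
have -> : (fun n => n%:R * (cos (root_scale n * y) - 1)) =
    (fun n => - (2 * (Num.sqrt n%:R * sin (root_scale n * (y / 2)))
                   * (Num.sqrt n%:R * sin (root_scale n * (y / 2))))).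
  apply/funext => n; rewrite -[cos _ - 1]opprB cos_half mulrN mulrA; congr (- _).
  rewrite -[root_scale n * y / 2]mulrA -[X in X * (2 * _)](@sqr_sqrtr _ n%:R)//; ring.
have -> : y ^+ 2 / 2 = 2 * (y / 2) * (y / 2) by field.
by apply: cvgN; apply: cvgM => //; apply: cvgMr.
Qed.

End local_scale.

Section local_expectation.
Context d (T : measurableType d) (R : realType).
Variables (mu : {sigma_finite_measure set T -> \bar R}).
Variables (P : probability T R) (Q_ : nat -> probability T R).
Variables (psi s : T -> R) (h : R).
Hypothesis Pmu : P `<< mu.
Hypothesis Qmu : \forall n \near \oo, Q_ n `<< mu.
Hypothesis psi2 : psi \in Lfun P 2%:E.
Hypothesis psi0 : \int[P]_z psi z = 0.
Hypothesis s2 : s \in Lfun P 2%:E.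
Hypothesis Qdqm : forall e : R, 0 < e -> \forall n \near \oo,
  (\int[mu]_z ((sqrt_density mu (Q_ n) z - sqrt_density mu P z
     - h * root_scale R n / 2 * s z * sqrt_density mu P z) ^+ 2)%:E
   <= (e * (h * root_scale R n) ^+ 2)%:E)%E.

Let a := root_scale R.
Let mpsi : measurable_fun setT psi. Proof. by have /Lfun2P[] := psi2. Qed.
Let ms : measurable_fun setT s. Proof. by have /Lfun2P[] := s2. Qed.
Let psi2i := Lfun2_integrable_sqr psi2.
Let s2i := Lfun2_integrable_sqr s2.

(** Here [kap] plays the derivative of [F] at 0: it is 1 for the sine and 0 for [cos - 1]. In
    [dqm_expectation] the coefficient [2 c] is [h a_n], and [n a_n = sqrt n], which is why the
    linear term converges to [h kap E[s psi]]. *)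
Lemma local_expectation_cvg (F : R -> R) (kap A : R) :
  measurable_fun setT F -> (forall x, `|F x| <= `|x|) -> (forall x, `|F x| <= 2) ->
  (forall y, Num.sqrt n%:R * F (a n * y) @[n --> \oo] --> kap * y) ->
  n%:R * \int[P]_z F (a n * psi z) @[n --> \oo] --> A ->
  n%:R * \int[Q_ n]_z F (a n * psi z) @[n --> \oo] -->
    A + h * (kap * \int[P]_z (s z * psi z)).
Proof.
move=> mF Fx F2 Fk FA.
have mFa n : measurable_fun setT (fun z => F (a n * psi z)).
  by apply: measurableT_comp mF _; exact: measurable_funM.
pose U n := \int[P]_z (s z * F (a n * psi z)).
pose V n := \int[P]_z (`|F (a n * psi z)| * s z ^+ 2).
have spsi := Lfun2_integrable_mul s2 psi2.
have msF n : measurable_fun setT (fun z => s z * F (a n * psi z)).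
  exact: measurable_funM.
have sFi n : P.-integrable setT (EFin \o (fun z => s z * F (a n * psi z))).
  apply: (le_integrable measurableT _ _ (integrableZl measurableT 2
    (integrable_abse (Lfun2_integrable s2)))); first exact/measurable_EFinP.
  move=> z _; rewrite /= lee_fin !normrM normr_id mulrC.
  by apply: ler_pM => //; rewrite (le_trans (F2 _))// ler_norm.
have U_cvg : Num.sqrt n%:R * U n @[n --> \oo] --> kap * \int[P]_z (s z * psi z).
  rewrite -(RintegralZl _ measurableT spsi).
  have -> : (fun n => Num.sqrt n%:R * U n) =
      (fun n => \int[P]_z (Num.sqrt n%:R * (s z * F (a n * psi z)))).
    by apply/funext => n; rewrite RintegralZl.
  apply: (Rintegral_cvg (g := fun z => `|s z * psi z|)).
  - by move=> n; exact: measurable_funM.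
  - by apply: measurable_funM => //; exact: measurable_funM.
  - move=> z; under eq_fun do rewrite mulrCA.
    by rewrite mulrCA; apply: cvgMr; exact: Fk.
  - exact: integrable_abse spsi.
  - move=> n z; rewrite mulrCA normrM [leRHS]normrM ler_wpM2l// normrM.
    rewrite ger0_norm ?sqrtr_ge0//.
    apply: le_trans (ler_wpM2l (sqrtr_ge0 _) (Fx _)) _.
    rewrite normrM (ger0_norm (root_scale_ge0 _ _)) mulrA.
    have [->|n0] := posnP n; first by rewrite sqrtr0 !mul0r.
    by rewrite sqrt_root_scale// mul1r.
have V_cvg : V n @[n --> \oo] --> 0.
  rewrite -[X in _ --> X](Rintegral_cst1 P 0).
  apply: (Rintegral_cvg (g := fun z => 2 * s z ^+ 2)).
  - move=> n; apply: measurable_funM; last exact: measurable_funX.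
    exact: measurableT_comp.
  - exact: measurable_cst.
  - move=> z; rewrite -[X in _ --> X](mul0r (s z ^+ 2)); apply: cvgMl.
    apply: (cvg0_le (v := fun n => a n * `|psi z|)); last exact: root_scaleM_cvg0.
    apply: nearW => n; rewrite normr_id (le_trans (Fx _))// normrM.
    by rewrite (ger0_norm (root_scale_ge0 _ _)).
  - exact: (integrableZl measurableT 2 s2i).
  - move=> n z; rewrite normrM normr_id (ger0_norm (sqr_ge0 _)).
    by rewrite ler_wpM2r ?sqr_ge0.
set sig := \int[P]_z (psi z ^+ 2).
have sig0 : 0 <= sig by apply: Rintegral_ge0 => z _; exact: sqr_ge0.
have F2_le n : n%:R * \int[P]_z (F (a n * psi z) ^+ 2) <= sig.
  have F2i : P.-integrable setT (EFin \o (fun z => F (a n * psi z) ^+ 2)).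
    apply: (bounded_integrable _ (B := 4)); first exact: measurable_funX.
    by move=> z; have := F2 (a n * psi z); have := normr_ge0 (F (a n * psi z));
      rewrite normrX; nra.
  have : \int[P]_z (F (a n * psi z) ^+ 2) <= a n ^+ 2 * sig.
    rewrite -(RintegralZl _ measurableT psi2i); apply: le_Rintegral => //.
      exact: (integrableZl measurableT (a n ^+ 2) psi2i).
    move=> z _; rewrite -exprMn -real_normK ?num_real// -[leRHS]real_normK ?num_real//.
    by rewrite ler_sqr ?nnegrE.
  move=> /(ler_wpM2l (ler0n R n)) H; apply: (le_trans H).
  by rewrite mulrA ler_piMl// natr_root_scale_sqr_le1.
pose err n := n%:R * (\int[Q_ n]_z F (a n * psi z) - \int[P]_z F (a n * psi z)
  - 2 * (h * a n / 2) * U n).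
have err_cvg : err n @[n --> \oo] --> 0.
  apply/cvgrPdist_le => e e0.
  (* Each of the three error terms gets [e / 3]: [lam] is large enough for the one with [F ^ 2],
     then [eta] small enough for the quadratic-mean remainder multiplied by [lam + 4], while the
     third vanishes with [V]. The added ones guard against [sig = 0] and [h = 0]. *)
  pose lam := 3 * (sig + 1) / e.
  have sig1 : 0 < sig + 1 by rewrite ltr_wpDl.
  have lam0 : 0 < lam by rewrite divr_gt0// mulr_gt0.
  have lam4 : 0 < lam + 4 by rewrite addr_gt0.
  have h1 : 0 < h ^+ 2 + 1 by rewrite ltr_wpDl ?sqr_ge0.
  pose eta := e / (3 * (lam + 4) * (h ^+ 2 + 1)).
  have eta0 : 0 < eta by rewrite divr_gt0// !mulr_gt0.
  have V_small : \forall n \near \oo, V n <= e / (3 * (h ^+ 2 + 1)).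
    have e3 : 0 < e / (3 * (h ^+ 2 + 1)) by rewrite divr_gt0// mulr_gt0.
    have /cvgrPdist_le/(_ _ e3) := V_cvg; apply: filterS => n.
    by rewrite sub0r normrN; apply: le_trans; exact: ler_norm.
  near=> n; rewrite sub0r normrN /err normrM ger0_norm//.
  have Qn : Q_ n `<< mu by near: n.
  have Hn : (\int[mu]_z ((sqrt_density mu (Q_ n) z - sqrt_density mu P z
     - h * a n / 2 * s z * sqrt_density mu P z) ^+ 2)%:E
     <= (eta * (h * a n) ^+ 2)%:E)%E by near: n; exact: Qdqm.
  have Vn : V n <= e / (3 * (h ^+ 2 + 1)) by near: n.
  have V0 : 0 <= V n.
    by apply: Rintegral_ge0 => z _; rewrite mulr_ge0 ?sqr_ge0.
  have D := dqm_expectation Pmu Qn s2 (mFa n) (fun z => F2 _) lam0 Hn.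
  apply: le_trans (ler_wpM2l (ler0n R n) D) _.
  have na := natr_root_scale_sqr_le1 R n; have na0 : 0 <= n%:R * a n ^+ 2.
    by rewrite mulr_ge0 ?sqr_ge0.
  have B1 : n%:R * ((lam + 4) * (eta * (h * a n) ^+ 2)) <= e / 3.
    have -> : n%:R * ((lam + 4) * (eta * (h * a n) ^+ 2)) =
      (n%:R * a n ^+ 2) * (e / 3 * (h ^+ 2 / (h ^+ 2 + 1))).
      by rewrite /eta; field; rewrite !gt_eqF.
    have hh : 0 <= h ^+ 2 / (h ^+ 2 + 1) <= 1.
      rewrite divr_ge0 ?sqr_ge0 ?(ltW h1)//= ler_pdivrMr// mul1r lerDl//.
    have e30 : 0 <= e / 3 by rewrite divr_ge0// ltW.
    have /andP[hh0 hh1] := hh.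
    apply: le_trans (ler_piMl _ na) _; first by rewrite mulr_ge0.
    by rewrite ler_piMr.
  have B2 : n%:R * (lam^-1 * \int[P]_z (F (a n * psi z) ^+ 2)) <= e / 3.
    rewrite mulrCA; apply: le_trans (ler_wpM2l _ (F2_le n)) _.
      by rewrite invr_ge0 ltW.
    rewrite /lam invf_div mulrAC ler_pdivrMr ?mulr_gt0//.
    by have := mulr_ge0 (ltW e0) sig0; nra.
  have B3 : n%:R * (2 * (h * a n / 2) ^+ 2 * V n) <= e / 3.
    have -> : n%:R * (2 * (h * a n / 2) ^+ 2 * V n) =
      (n%:R * a n ^+ 2) * (h ^+ 2 / 2 * V n) by field.
    have hV : 0 <= h ^+ 2 / 2 * V n by rewrite mulr_ge0// divr_ge0// sqr_ge0.
    apply: le_trans (ler_piMl hV na) _.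
    apply: le_trans (ler_wpM2l _ Vn) _; first by rewrite divr_ge0// sqr_ge0.
    rewrite mulrA ler_pdivrMr ?mulr_gt0//.
    by have := mulr_ge0 (ltW e0) (sqr_ge0 h); nra.
  rewrite (_ : e = e / 3 + (e / 3 + e / 3)); last by field.
  by rewrite mulrDr; apply: lerD => //; rewrite mulrDr; exact: lerD.
have -> : (fun n => n%:R * \int[Q_ n]_z F (a n * psi z)) =
    (fun n => err n + (n%:R * \int[P]_z F (a n * psi z) + h * (Num.sqrt n%:R * U n))).
  apply/funext => n; by rewrite /err -(natr_root_scale R n) -/(a n); field.
rewrite -[X in _ --> X]add0r; apply: cvgD => //; apply: cvgD => //.
by apply: cvgMr.
Unshelve. all: by end_near. Qed.

Lemma local_sin_cvg : n%:R * \int[Q_ n]_z sin (a n * psi z) @[n --> \oo] -->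
  h * \int[P]_z (s z * psi z).
Proof.
have msin : measurable_fun setT (@sin R).
  exact: continuous_measurable_fun (@continuous_sin R).
rewrite -[X in _ --> h * X]mul1r -[X in _ --> X]add0r.
apply: local_expectation_cvg => //.
- exact: ler_norm_sin.
- by move=> x; rewrite (le_trans (sin_max x))// ler1n.
- by move=> y; rewrite mul1r; exact: sqrt_sin_cvg.
have mz n : measurable_fun setT (fun z => sin (a n * psi z)).
  by apply: measurableT_comp msin _; exact: measurable_funM.
have psi_i := Lfun2_integrable psi2.
have si n : P.-integrable setT (EFin \o (fun z => sin (a n * psi z))).
  by apply: (bounded_integrable _ (mz n)) => z; exact: sin_max.
have api n : P.-integrable setT (EFin \o (fun z => a n * psi z)).
  exact: (integrableZl measurableT (a n) psi_i).
have di n : P.-integrable setT (EFin \o (fun z => sin (a n * psi z) - a n * psi z)).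
  exact: (integrableB measurableT (si n) (api n)).
(* As [psi] has mean 0, its linear term can be subtracted for free; the difference is dominated by
   [psi ^ 2] even after multiplication by [n]. *)
have -> : (fun n => n%:R * \int[P]_z sin (a n * psi z)) =
    (fun n => \int[P]_z (n%:R * (sin (a n * psi z) - a n * psi z))).
  apply/funext => n; rewrite (RintegralZl _ measurableT (di n)).
  rewrite (RintegralB measurableT (si n) (api n)) (RintegralZl _ measurableT psi_i).
  by rewrite psi0 mulr0 subr0.
rewrite -[X in _ --> X](Rintegral_cst1 P 0).
apply: (Rintegral_cvg (g := fun z => psi z ^+ 2)) => //.
- move=> n; apply: measurable_funM => //; apply: measurable_funB => //.
  exact: measurable_funM.
- by move=> z; exact: natr_sin_sub_cvg.
move=> n z; rewrite normrM ger0_norm//.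
apply: le_trans (ler_wpM2l (ler0n _ _) (norm_sin_sub_le_sqr _)) _.
by rewrite exprMn mulrA ler_piMl ?sqr_ge0// natr_root_scale_sqr_le1.
Qed.

(** The limit is the one under [P], since [cos - 1] has slope 0 at the origin: to this order the
    perturbation changes the phase of the characteristic function but not its modulus. *)
Lemma local_cos_cvg : n%:R * (\int[Q_ n]_z cos (a n * psi z) - 1) @[n --> \oo] -->
  - ((\int[P]_z (psi z ^+ 2)) / 2).
Proof.
have mcos : measurable_fun setT (@cos R).
  exact: continuous_measurable_fun (@continuous_cos R).
pose F x : R := cos x - 1.
have mF : measurable_fun setT F by exact: measurable_funB.
have FE x : `|F x| = 1 - cos x.
  by rewrite /F -normrN opprB ger0_norm// one_sub_cos_ge0.
have mz n : measurable_fun setT (fun z => cos (a n * psi z)).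
  by apply: measurableT_comp mcos _; exact: measurable_funM.
have -> : (fun n => n%:R * (\int[Q_ n]_z cos (a n * psi z) - 1)) =
    (fun n => n%:R * \int[Q_ n]_z F (a n * psi z)).
  apply/funext => n; congr (_ * _); rewrite /F RintegralB//.
  - by congr (_ - _); rewrite Rintegral_cst1.
  - by apply: (bounded_integrable _ (mz n)) => z; exact: cos_max.
  - exact: (unit_mass_integrable_cst (probability_setT _)).
have -> : - ((\int[P]_z (psi z ^+ 2)) / 2) = - ((\int[P]_z (psi z ^+ 2)) / 2)
    + h * (0 * \int[P]_z (s z * psi z)) by rewrite mul0r mulr0 addr0.
apply: local_expectation_cvg => //.
- by move=> x; rewrite FE one_sub_cos_le_norm.
- by move=> x; rewrite FE; have := cos_max x; rewrite ler_norml => /andP[]; lra.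
- by move=> y; rewrite mul0r; exact: sqrt_cos_cvg.
have Fi n : P.-integrable setT (EFin \o (fun z => F (a n * psi z))).
  apply: (bounded_integrable _ (B := 2)).
    by apply: measurableT_comp mF _; exact: measurable_funM.
  by move=> z; rewrite FE; have := cos_max (a n * psi z); rewrite ler_norml => /andP[]; lra.
have -> : (fun n => n%:R * \int[P]_z F (a n * psi z)) =
    (fun n => \int[P]_z (n%:R * F (a n * psi z))).
  by apply/funext => n; rewrite (RintegralZl _ measurableT (Fi n)).
have -> : - ((\int[P]_z (psi z ^+ 2)) / 2) = \int[P]_z (- 2^-1 * psi z ^+ 2).
  by rewrite (RintegralZl _ measurableT psi2i) mulNr mulrC.
apply: (Rintegral_cvg (g := fun z => psi z ^+ 2)) => //.
- move=> n; apply: measurable_funM => //; apply: measurableT_comp mF _.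
  exact: measurable_funM.
- by apply: measurable_funM => //; exact: measurable_funX.
- by move=> z; rewrite mulNr mulrC; exact: natr_cos_cvg.
move=> n z; rewrite normrM FE ger0_norm//.
apply: le_trans (ler_wpM2l (ler0n _ _) (one_sub_cos_le_sqr _)) _.
rewrite exprMn; have := natr_root_scale_sqr_le1 R n; have := sqr_ge0 (psi z).
have : 0 <= n%:R * a n ^+ 2 by rewrite mulr_ge0 ?sqr_ge0.
by rewrite -/(a n); nra.
Qed.

End local_expectation.

Lemma same_law_iid_law d (T : measurableType d) (R : realType)
    (P Q : probability T R) n :
  same_law P Q -> same_law (iid_law P n) (iid_law Q n).
Proof.
move=> PQ; elim: n => [//|n IH] A mA /=.
have mc : measurable_fun setT (@tuple_cons _ T n) by exact: measurable_funP.
have mA' : measurable (@tuple_cons _ T n @^-1` A).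
  by rewrite -[Z in measurable Z]setTI; exact: mc.
have U := @product_measure_unique _ _ _ _ _ P (iid_law P n) (Q \x iid_law Q n)%E.
apply: U => // B C mB mC.
apply: etrans (product_measure1E _ _ mB mC) _.
by congr (_ * _)%E; apply/esym; [exact: PQ|exact: IH].
Qed.

(** With [x = k / n] the claim is [0 <= expR (- x) - 1 + x <= x ^ 2]. It follows from
    [1 + y <= expR y] at [y = x] and [y = - x]. *)
Lemma natr_expR_cvg_bound (R : realType) (k : R) n : (0 < n)%N -> 0 <= k ->
  `|n%:R * (expR (- (k / n%:R)) - 1) + k| <= k ^+ 2 / n%:R.
Proof.
move=> n0 k0; have n0' : 0 < n%:R :> R by rewrite ltr0n.
set x := k / n%:R; have x0 : 0 <= x by rewrite divr_ge0.
have nx : n%:R * x = k by rewrite /x mulrC divfK// gt_eqF.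
have e1 := expR_ge1Dx (- x); have e2 := expR_ge1Dx x.
have ee : expR x * expR (- x) = 1 by rewrite -expRD subrr expR0.
have ep := expR_gt0 (- x).
have x2 : k ^+ 2 / n%:R = n%:R * x ^+ 2 by rewrite /x; field; rewrite gt_eqF.
have -> : n%:R * (expR (- x) - 1) + k = n%:R * (expR (- x) - 1 + x).
  by rewrite [in RHS]mulrDr nx.
rewrite x2 normrM (ger0_norm (ltW n0')) ler_wpM2l ?(ltW n0')// ger0_norm; last by lra.
have ex : (1 + x) * expR (- x) <= 1 by rewrite -[leRHS]ee ler_wpM2r// ltW.
by have := ler_wpM2l x0 e1; lra.
Qed.

Section local_iid_expectation.
Context d (T : measurableType d) (R : realType).
Variables (mu : {sigma_finite_measure set T -> \bar R}).
Variables (P : probability T R) (Q_ : nat -> probability T R).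
Variables (psi s : T -> R) (h : R).
Hypothesis Pmu : P `<< mu.
Hypothesis Qmu : \forall n \near \oo, Q_ n `<< mu.
Hypothesis psi2 : psi \in Lfun P 2%:E.
Hypothesis psi0 : \int[P]_z psi z = 0.
Hypothesis s2 : s \in Lfun P 2%:E.
Hypothesis Qdqm : forall e : R, 0 < e -> \forall n \near \oo,
  (\int[mu]_z ((sqrt_density mu (Q_ n) z - sqrt_density mu P z
     - h * root_scale R n / 2 * s z * sqrt_density mu P z) ^+ 2)%:E
   <= (e * (h * root_scale R n) ^+ 2)%:E)%E.

Let a := root_scale R.
Let mpsi : measurable_fun setT psi. Proof. by have /Lfun2P[] := psi2. Qed.
Let ms : measurable_fun setT s. Proof. by have /Lfun2P[] := s2. Qed.
Let b := h * \int[P]_z (s z * psi z).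
Let k := \int[P]_z (psi z ^+ 2) / 2.
Let S n (t : n.-tuple T) := \sum_(i < n) a n * psi (tnth t i).

Let k0 : 0 <= k.
Proof. by rewrite divr_ge0//; apply: Rintegral_ge0 => z _; exact: sqr_ge0. Qed.

Lemma local_iid_sin_cvg : \int[iid_law (Q_ n) n]_t sin (S t) @[n --> \oo] -->
  expR (- k) * sin b.
Proof.
pose c n := \int[Q_ n]_z cos (a n * psi z).
pose sn n := \int[Q_ n]_z sin (a n * psi z).
have c_cvg : n%:R * (c n - 1) + k @[n --> \oo] --> 0.
  rewrite -[X in _ --> X](addNr k); apply: cvgD; last exact: cvg_cst.
  exact: (local_cos_cvg Pmu Qmu psi2 s2 Qdqm).
have s_cvg : n%:R * sn n - b @[n --> \oo] --> 0.
  apply/subr_cvg0; exact: (local_sin_cvg Pmu Qmu psi2 psi0 s2 Qdqm).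
(* The coefficients of the errors of order [1 / n]: from [expR (- k / n)], from [cos (b / n)], from
   [sin (b / n)], and from the product of [1 - e] with the sine. *)
pose K := k ^+ 2 + b ^+ 2 + b ^+ 2 + k * `|b|.
apply/subr_cvg0.
apply: (cvg0_le (v := fun n =>
  `|n%:R * (c n - 1) + k| + `|n%:R * sn n - b| + a n * a n * K)); last first.
  rewrite -[X in _ --> X]addr0 -[X in _ --> X + _]addr0; apply: cvgD.
    by apply: cvgD; rewrite -(normr0 R); exact: cvg_norm.
  rewrite -(mul0r K); apply: cvgMl; rewrite -(mul0r 0).
  by apply: cvgM; exact: root_scale_cvg0.
exists 1%N => // n /= n0.
have n0' : 0 < n%:R :> R by rewrite ltr0n.
have aa : a n * a n = n%:R^-1 by rewrite -expr2 root_scale_sqr.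
(* These make the comparison value exact: [e ^ n = expR (- k)] and [n bn = b], so all the error lies
   in a single factor. *)
pose e := expR (- (k / n%:R)); pose bn := b / n%:R.
have e0 : 0 < e by exact: expR_gt0.
have kn0 : 0 <= k / n%:R by rewrite divr_ge0.
have e1 : e <= 1 by rewrite -expR0 ler_expR oppr_le0.
have e01 : 0 <= e <= 1 by rewrite ltW.
have en : e ^+ n = expR (- k).
  by rewrite /e -expRM_natl; congr expR; field; rewrite gt_eqF.
have nbn : n%:R * bn = b by rewrite /bn mulrC divfK// gt_eqF.
have mapsi : measurable_fun setT (fun z => a n * psi z) by exact: measurable_funM.
have := @iid_law_sin_sum _ T R (Q_ n) _ mapsi e bn
  (`|c n - e * cos bn| + `|sn n - e * sin bn|) n 0 e01 (lexx _).
rewrite en add0r nbn.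
have -> : \int[iid_law (Q_ n) n]_t sin (0 + \sum_(i < n) a n * psi (tnth t i)) =
    \int[iid_law (Q_ n) n]_t sin (S t).
  by apply: eq_Rintegral => t _; rewrite add0r.
move=> H; apply: (le_trans H); rewrite mulrDr.
have nn (x : R) : n%:R * `|x| = `|n%:R * x| by rewrite normrM (ger0_norm (ltW n0')).
rewrite !nn.
have eb := natr_expR_cvg_bound n0 k0; rewrite -/e in eb.
have cb : `|n%:R * (1 - cos bn)| <= b ^+ 2 / n%:R.
  rewrite ger0_norm; last by rewrite mulr_ge0 ?one_sub_cos_ge0.
  have := one_sub_cos_le_sqr bn => /(ler_wpM2l (ltW n0')) /le_trans; apply.
  have -> : n%:R * (bn ^+ 2 / 2) = b ^+ 2 / n%:R / 2 by rewrite /bn; field; rewrite gt_eqF.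
  have : 0 <= b ^+ 2 / n%:R by rewrite divr_ge0 ?sqr_ge0.
  by lra.
have sb : `|n%:R * (sin bn - bn)| <= b ^+ 2 / n%:R.
  rewrite -nn; have := norm_sin_sub_le_sqr bn => /(ler_wpM2l (ltW n0')) /le_trans; apply.
  by rewrite le_eqVlt; apply/orP; left; apply/eqP; rewrite /bn; field; rewrite gt_eqF.
have nsb : `|n%:R * sin bn| <= `|b|.
  by rewrite -nn -nbn -nn ler_wpM2l ?(ltW n0')// ler_norm_sin.
have e1k : `|1 - e| <= k / n%:R.
  rewrite ger0_norm ?subr_ge0//; have := expR_ge1Dx (- (k / n%:R)); rewrite -/e; lra.
have -> : n%:R * (c n - e * cos bn) = (n%:R * (c n - 1) + k)
    - (n%:R * (e - 1) + k) + e * (n%:R * (1 - cos bn)) by ring.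
have -> : n%:R * (sn n - e * sin bn) = (n%:R * sn n - b)
    - n%:R * (sin bn - bn) + (1 - e) * (n%:R * sin bn).
  by rewrite -nbn; ring.
have t1 : `|e * (n%:R * (1 - cos bn))| <= b ^+ 2 / n%:R.
  by rewrite normrM (ger0_norm (ltW e0)) (le_trans (ler_piMl _ e1)).
have t2 : `|(1 - e) * (n%:R * sin bn)| <= k / n%:R * `|b|.
  by rewrite normrM; apply: ler_pM.
have n1 := ler_normD (n%:R * (c n - 1) + k - (n%:R * (e - 1) + k))
  (e * (n%:R * (1 - cos bn))).
have n2 := ler_normB (n%:R * (c n - 1) + k) (n%:R * (e - 1) + k).
have n3 := ler_normD (n%:R * sn n - b - n%:R * (sin bn - bn))
  ((1 - e) * (n%:R * sin bn)).
have n4 := ler_normB (n%:R * sn n - b) (n%:R * (sin bn - bn)).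
have KE : a n * a n * K = k ^+ 2 / n%:R + b ^+ 2 / n%:R + b ^+ 2 / n%:R + k / n%:R * `|b|.
  by rewrite aa /K; ring.
rewrite KE; lra.
Qed.

Variable W : forall n, n.-tuple T -> R.
Hypothesis mW : forall n, measurable_fun setT (@W n).
Hypothesis W_S : forall e : R, 0 < e ->
  fine (iid_law P n [set t | e < `|W t - S t|]) @[n --> \oo] --> 0.
Variable l : R.
Hypothesis W_cvg : \int[iid_law (Q_ n) n]_t sin (W t) @[n --> \oo] --> l.

(** Off the event [|W - S| > e] the two sines differ by at most [e], and on it by at most 2. Twice
    the probability of the event under [Q_ n] contributes [4 n H], and [n H <= h ^ 2 (2 + I / 2)]
    gives the constant. *)
Lemma local_sin_bias : `|l - expR (- k) * sin b| <=
  (8 + 2 * \int[P]_z (s z ^+ 2)) * h ^+ 2.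
Proof.
set I := \int[P]_z (s z ^+ 2).
have s2i := Lfun2_integrable_sqr s2.
have I0 : 0 <= I by apply: Rintegral_ge0 => z _; exact: sqr_ge0.
have msin : measurable_fun setT (@sin R).
  exact: continuous_measurable_fun (@continuous_sin R).
(* Seven shares: one for each of the two limits, one for the closeness of [W] and [S], and four for
   [4 P^n(A)]. *)
apply/ler_addgt0Pr => e' e'0; pose e := e' / 7; have e0 : 0 < e by rewrite divr_gt0.
(* Bounds the squared Hellinger distance: twice the remainder, at most [(h a_n) ^ 2] by [Qdqm] with
   constant 1, plus twice the linear term [(h a_n / 2) ^ 2 I]. *)
pose H n := (h * a n) ^+ 2 * (2 + I / 2).
have H_cvg : H n @[n --> \oo] --> 0.
  rewrite -(mul0r (2 + I / 2)); apply: cvgMl.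
  have ha : h * a n @[n --> \oo] --> 0.
    by rewrite -(mulr0 h); apply: cvgMr; exact: root_scale_cvg0.
  by under eq_fun do rewrite expr2; rewrite -(mul0r 0); apply: cvgM.
have H2 : \forall n \near \oo, H n <= 2.
  have /cvgrPdist_le/(_ 2 ltac:(lra)) := H_cvg; apply: filterS => n.
  by rewrite sub0r normrN; apply: le_trans; exact: ler_norm.
have PA : \forall n \near \oo, fine (iid_law P n [set t | e < `|W t - S t|]) <= e.
  have /cvgrPdist_le/(_ e e0) := W_S e0; apply: filterS => n.
  by rewrite sub0r normrN; apply: le_trans; exact: ler_norm.
have Wl : \forall n \near \oo, `|l - \int[iid_law (Q_ n) n]_t sin (W t)| <= e.
  by have /cvgrPdist_le/(_ e e0) := W_cvg.
have Sl : \forall n \near \oo,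
    `|expR (- k) * sin b - \int[iid_law (Q_ n) n]_t sin (S t)| <= e.
  by have /cvgrPdist_le/(_ e e0) := local_iid_sin_cvg.
near \oo => n.
have Qn : Q_ n `<< mu by near: n.
have dn : (\int[mu]_z ((sqrt_density mu (Q_ n) z - sqrt_density mu P z
     - h * a n / 2 * s z * sqrt_density mu P z) ^+ 2)%:E
   <= (1 * (h * a n) ^+ 2)%:E)%E by near: n; exact: Qdqm.
have Hn : H n <= 2 by near: n.
have PAn : fine (iid_law P n [set t | e < `|W t - S t|]) <= e by near: n.
have Wn : `|l - \int[iid_law (Q_ n) n]_t sin (W t)| <= e by near: n.
have Sn : `|expR (- k) * sin b - \int[iid_law (Q_ n) n]_t sin (S t)| <= e by near: n.
have mS : measurable_fun setT (@S n).
  by apply: (@measurable_tuple_sum _ T R (fun z => a n * psi z)); exact: measurable_funM.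
set A := [set t | e < `|W t - S t|] in PAn.
have mA : measurable A.
  have mWS : measurable_fun setT (fun t : n.-tuple T => e < `|W t - S t|).
    apply: measurable_fun_ltr => //; apply: measurableT_comp => //.
    exact: (measurable_funB (@mW n) mS).
  by rewrite -[A]setTI; apply: (mWS measurableT [set true]).
have hel : (\int[mu]_z ((sqrt_density mu (Q_ n) z - sqrt_density mu P z) ^+ 2)%:E
    <= (H n)%:E)%E.
  have mp : measurable_fun setT (sqrt_density mu P) by exact: measurable_sqrt_density.
  have mq : measurable_fun setT (sqrt_density mu (Q_ n)).
    exact: measurable_sqrt_density.
  have msp : measurable_fun setT (fun z => h * a n / 2 * s z * sqrt_density mu P z).
    by apply: measurable_funM => //; exact: measurable_funM.
  have mr := measurable_funB (measurable_funB mq mp) msp.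
  have := integral_sqrD_le mu mr msp.
  under eq_integral do rewrite subrK.
  move=> /le_trans; apply.
  have -> : (\int[mu]_z ((h * a n / 2 * s z * sqrt_density mu P z) ^+ 2)%:E =
      ((h * a n / 2) ^+ 2 * I)%:E)%E.
    rewrite (eq_integral (fun z => (((h * a n / 2) ^+ 2 * s z ^+ 2)
      * sqrt_density mu P z ^+ 2)%:E)); last by move=> z _; rewrite !exprMn.
    rewrite -ge0_integral_sqrt_density//; last 2 first.
    - by move=> z; rewrite mulr_ge0 ?sqr_ge0.
    - by apply: measurable_funM => //; exact: measurable_funX.
    under eq_integral do rewrite EFinM.
    by rewrite integralZl// [RHS]EFinM /I /Rintegral fineK//; exact: integrable_fin_num.
  have -> : (H n)%:E = (2%:E * (1 * (h * a n) ^+ 2)%:E +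
      2%:E * ((h * a n / 2) ^+ 2 * I)%:E)%E.
    by rewrite -!EFinM -EFinD; congr EFin; rewrite /H; field.
  by apply: leeD => //; apply: lee_wpmul2l.
have QA := iid_law_measure_le Pmu Qn Hn hel mA.
have nH : n%:R * H n <= h ^+ 2 * (2 + I / 2).
  have -> : n%:R * H n = (n%:R * a n ^+ 2) * (h ^+ 2 * (2 + I / 2)).
    by rewrite /H; ring.
  rewrite ler_piMl ?natr_root_scale_sqr_le1// mulr_ge0 ?sqr_ge0//.
  by rewrite addr_ge0// divr_ge0.
have mI : measurable_fun setT (\1_A : n.-tuple T -> R) by exact: measurable_indic.
have Ii : (iid_law (Q_ n) n).-integrable setT (EFin \o (\1_A : n.-tuple T -> R)).
  apply: (bounded_integrable _ (B := 1)) => // t.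
  by rewrite indicE; case: (_ \in _); rewrite ?normr1 ?normr0.
have ci := unit_mass_integrable_cst (probability_setT (iid_law (Q_ n) n)) e.
have msW : measurable_fun setT (fun t : n.-tuple T => sin (W t)).
  exact: measurableT_comp msin (@mW n).
have msS : measurable_fun setT (fun t : n.-tuple T => sin (S t)).
  exact: measurableT_comp msin mS.
have siW : (iid_law (Q_ n) n).-integrable setT (EFin \o (fun t => sin (W t))).
  by apply: (bounded_integrable _ msW) => t; exact: sin_max.
have siS : (iid_law (Q_ n) n).-integrable setT (EFin \o (fun t => sin (S t))).
  by apply: (bounded_integrable _ msS) => t; exact: sin_max.
have siWS : (iid_law (Q_ n) n).-integrable setT (EFin \o (fun t => sin (W t) - sin (S t))).
  exact: (integrableB measurableT siW siS).
have I2i : (iid_law (Q_ n) n).-integrable setT (EFin \o (fun t => 2 * \1_A t)).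
  exact: (integrableZl measurableT 2 Ii).
have WS : `|\int[iid_law (Q_ n) n]_t sin (W t) - \int[iid_law (Q_ n) n]_t sin (S t)|
    <= e + 2 * fine (iid_law (Q_ n) n A).
  rewrite -(RintegralB measurableT siW siS).
  apply: le_trans (le_normr_Rintegral measurableT siWS) _.
  have -> : e + 2 * fine (iid_law (Q_ n) n A) =
      \int[iid_law (Q_ n) n]_t (e + 2 * \1_A t).
    rewrite (RintegralD measurableT ci I2i); congr (_ + _).
      by apply/esym; exact: Rintegral_cst1.
    rewrite (RintegralZl 2 measurableT Ii); congr (_ * _).
    by rewrite /Rintegral integral_indic// setIT.
  apply: le_Rintegral => //.
  - exact: integrable_abse siWS.
  - exact: (integrableD measurableT ci I2i).
  move=> t _; rewrite indicE; have [tA|tA] := boolP (t \in A); rewrite /=.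
    rewrite mulr1 (le_trans (ler_normB _ _))//.
    by have := sin_max (W t); have := sin_max (S t); lra.
  rewrite mulr0 addr0 (le_trans (ler_norm_sinB _ _))// leNgt.
  by apply/negP => tA'; move: tA; rewrite notin_setE; apply.
have -> : l - expR (- k) * sin b =
    (l - \int[iid_law (Q_ n) n]_t sin (W t)) +
    (\int[iid_law (Q_ n) n]_t sin (W t) - \int[iid_law (Q_ n) n]_t sin (S t)) -
    (expR (- k) * sin b - \int[iid_law (Q_ n) n]_t sin (S t)) by ring.
apply: le_trans (ler_normB _ _) _.
have tri := ler_normD (l - \int[iid_law (Q_ n) n]_t sin (W t))
  (\int[iid_law (Q_ n) n]_t sin (W t) - \int[iid_law (Q_ n) n]_t sin (S t)).
have e'E : e' = 7 * e by rewrite /e; field.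
by rewrite -mulrA in QA; lra.
Unshelve. all: by end_near. Qed.

End local_iid_expectation.

(** Since [l] is common to all [h], subtracting the bounds at [h] and [- h] leaves
    [K |sin (h tau)| = O(h ^ 2)], impossible for small [h] unless the slope [tau] is 0. *)
Lemma sin_slope_eq0 (R : realType) (l K C tau : R) : 0 < K ->
  (forall h, h != 0 -> `|l - K * sin (h * tau)| <= C * h ^+ 2) -> tau = 0.
Proof.
move=> K0 H; apply/eqP; apply/negPn/negP => tau0.
have t0 : 0 < `|tau| by rewrite normr_gt0.
pose D := `|C| + 1; have D0 : 0 < D by rewrite ltr_wpDl.
(* The first bound gives [h |tau| <= 1], hence [|sin (h tau)| >= h |tau| / 2]; the second makes
   [D h ^ 2] at most half of the resulting lower bound. *)
pose h := Num.min (`|tau|^-1) (K * `|tau| / (4 * D)).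
have h0 : 0 < h by rewrite lt_min invr_gt0 t0 divr_gt0 ?mulr_gt0.
have h1 : h * `|tau| <= 1 by rewrite -ler_pdivlMr// mul1r ge_min lexx.
have h2 : 4 * (D * h) <= K * `|tau|.
  have : h <= K * `|tau| / (4 * D) by rewrite ge_min lexx orbT.
  by rewrite ler_pdivlMr ?mulr_gt0//; lra.
have h_neq0 : h != 0 by rewrite gt_eqF.
have H1 := H h h_neq0; have H2 := H (- h) ltac:(by rewrite oppr_eq0).
rewrite mulNr sinN sqrrN in H2.
have CD : C * h ^+ 2 <= D * h ^+ 2.
  by rewrite ler_wpM2r ?sqr_ge0// /D; have := ler_norm C; lra.
have S1 : K * `|sin (h * tau)| <= D * h ^+ 2.
  have : `|2 * (K * sin (h * tau))| <= 2 * (D * h ^+ 2).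
    have -> : 2 * (K * sin (h * tau)) =
      (l - K * - sin (h * tau)) - (l - K * sin (h * tau)) by ring.
    by apply: le_trans (ler_normB _ _) _; lra.
  by rewrite !normrM (gtr0_norm K0) ger0_norm//; lra.
have S2 : h * `|tau| / 2 <= `|sin (h * tau)|.
  have := norm_sin_sub_le (h * tau); rewrite normrM (gtr0_norm h0).
  set x := h * `|tau| in h1 *; have x0 : 0 < x by rewrite mulr_gt0.
  have := ler_normB (sin (h * tau)) (sin (h * tau) - h * tau).
  rewrite opprB addrC subrK normrM (gtr0_norm h0) -/x => tri x3.
  have : x ^+ 3 <= x by rewrite exprS ler_piMr ?(ltW x0)// exprn_ile1 ?(ltW x0).
  by lra.
have := ler_wpM2l (ltW K0) S2.
have : D * h ^+ 2 = D * h * h by rewrite expr2 mulrA.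
have := ler_wpM2r (ltW h0) h2.
have := mulr_gt0 (mulr_gt0 K0 t0) h0.
by nra.
Qed.

(** * Influence functions of regular estimators *)

(** The norm is the maximum over the coordinates, attained once it is nonzero; [0 <= e] excludes the
    empty row, whose norm is 0. *)
Lemma norm_rV_gtP (R : realType) p (v : 'rV[R]_p) (e : R) : 0 <= e ->
  e < `|v| <-> exists j, e < `|v ord0 j|.
Proof.
move=> e0; split=> [ev|[j ejv]].
  have v0 : mx_norm v != 0 by rewrite gt_eqF// (le_lt_trans e0 ev).
  have [[i j] /= vE] := mx_norm_neq0 v0; exists j.
  by move: ev; rewrite -[`|v|]/(mx_norm v) vE (ord1 i).
apply: lt_le_trans ejv _; rewrite -[`|v|]/(mx_norm v) mx_normrE.
exact: (le_bigmax _ (fun ij : 'I_1 * 'I_p => `|v ij.1 ij.2|) (ord0, j)).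
Qed.

Section regular_estimator.
Context (R : realType) d d' (X : measurableType d) (Y : measurableType d').
Variables (mu : {sigma_finite_measure set (X * Y)%type -> \bar R})
  (nu : {sigma_finite_measure set X -> \bar R}).
Variables (MX : set (probability X R)) (MK : set (R.-pker X ~> Y)).
Variables (PXstar : probability X R) (kstar : R.-pker X ~> Y).
Let M := joint_model MX MK.
Let Pstar := joint_law PXstar kstar.
Hypothesis Mmu : forall P, M P -> P `<< mu.
Hypothesis MXnu : forall PX, MX PX -> PX `<< nu.
Hypothesis MXstar : MX PXstar.
Hypothesis MKstar : MK kstar.
Variables (p : nat) (theta : probability (X * Y)%type R -> 'rV[R]_p).
Hypothesis ws : well_specified theta kstar MX PXstar.
Variables (psi : X * Y -> 'rV[R]_p)
  (That : forall n, n.-tuple (X * Y)%type -> 'rV[R]_p).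
Hypothesis That_est : is_estimator That.
Hypothesis That_al : is_asymp_linear Pstar (theta Pstar) That psi.
Hypothesis That_reg : is_regular mu M Pstar theta That.

Lemma regular_influence_orthogonal (j : 'I_p) (s : X -> R) :
  is_score nu MX PXstar s ->
  (\int[PXstar]_x (s x * cmean kstar (fun z => psi z ord0 j) x)%:E = 0)%E.
Proof.
move=> [D [tstar [PX_ sub]]]; have [Dt DM PXE _ [sX2 _]] := sub.
have [psiL al] := That_al; have [f2 f0] := psiL j.
set f := fun z => psi z ord0 j in f2 f0 *.
have subJ := regular_submodel_joint_law Mmu MXnu MKstar sub.
have [L reg] := That_reg subJ.
have [_ _ PE sdqm [s2 _]] := subJ.
(* [J tstar] and [Pstar] agree on measurable sets only, so moments and probabilities are moved from
   one to the other by [PE]. *)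
pose J t := joint_law (PX_ t) kstar.
have s2J : (fun z => s z.1) \in Lfun (J tstar) 2%:E.
  by have /Lfun2P[? ?] := s2; apply/Lfun2P; split; rewrite ?(same_law_integral _ PE).
have f2J : f \in Lfun (J tstar) 2%:E.
  by have /Lfun2P[? ?] := f2; apply/Lfun2P; split; rewrite ?(same_law_integral _ PE).
have f0J : \int[J tstar]_z f z = 0.
  by move: f0; rewrite unlock /Rintegral (same_law_integral _ PE) => ->.
have mf : measurable_fun setT f by have /Lfun2P[] := f2.
have Jmu t : D t -> J t `<< mu.
  by move=> /DM PXt; apply: Mmu; exists (PX_ t), kstar.
have Dtstar := nbhs_singleton Dt.
have path_cvg h : tstar + h * root_scale R n @[n --> \oo] --> tstar.
  rewrite -[X in _ --> X]addr0; apply: cvgD; first exact: cvg_cst.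
  by rewrite -(mulr0 h); apply: cvgMr; exact: root_scale_cvg0.
have path_D h : \forall n \near \oo, D (tstar + h * root_scale R n).
  exact: path_cvg Dt.
set tau := \int[J tstar]_z (s z.1 * f z).
pose k := \int[J tstar]_z (f z ^+ 2) / 2.
pose W n (t : n.-tuple (X * Y)%type) : R :=
  Num.sqrt n%:R * (That t ord0 j - theta Pstar ord0 j).
have mW n : measurable_fun setT (@W n).
  apply: measurable_funM => //; apply: measurable_funB => //; exact: That_est.
pose S n (t : n.-tuple (X * Y)%type) := \sum_(i < n) root_scale R n * f (tnth t i).
have mS n : measurable_fun setT (@S n).
  apply: (@measurable_tuple_sum _ _ R (fun z => root_scale R n * f z)).
  exact: measurable_funM.
pose V n (t : n.-tuple (X * Y)%type) := Num.sqrt n%:R *: (That t - theta Pstar)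
  - (Num.sqrt n%:R)^-1 *: \sum_(i < n) psi (tnth t i).
have VE n t i : @V n t ord0 i = Num.sqrt n%:R * (That t ord0 i - theta Pstar ord0 i)
    - root_scale R n * \sum_(i0 < n) psi (tnth t i0) ord0 i.
  by rewrite /V !mxE summxE.
have mpsi i : measurable_fun setT (fun z => psi z ord0 i).
  by have [/Lfun2P[]] := psiL i.
have mV n i : measurable_fun setT (fun t => @V n t ord0 i).
  under eq_fun do rewrite VE; apply: measurable_funB.
    by apply: measurable_funM => //; apply: measurable_funB => //; exact: That_est.
  apply: measurable_funM => //.
  exact: (@measurable_tuple_sum _ _ R (fun z => psi z ord0 i)).
have mVgt n e i : measurable [set t | e < `|@V n t ord0 i|].
  have mVi : measurable_fun setT (fun t : n.-tuple (X * Y)%type => e < `|V n t ord0 i|).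
    by apply: measurable_fun_ltr => //; exact: measurableT_comp (mV n i).
  by rewrite -[X in measurable X]setTI; apply: (mVi measurableT [set true]).
have W_S e : 0 < e ->
    fine (iid_law (J tstar) n [set t | e < `|W n t - S n t|]) @[n --> \oo] --> 0.
  move=> e0; have /fine_cvgP[_ al0] := al e e0.
  apply: (cvg0_le _ al0); apply: nearW => n.
  have -> : [set t | e < `|W n t - S n t|] = [set t | e < `|@V n t ord0 j|].
    by apply/seteqP; split => t /=; rewrite VE /W /S -mulr_sumr.
  (* Monotonicity of the measure requires this event to be measurable, which is seen by writing it
     as a finite union over the coordinates. *)
  have mB : measurable [set t | e < `|@V n t|].
    have -> : [set t | e < `|@V n t|] =
        \bigcup_(i in [set: 'I_p]) [set t | e < `|@V n t ord0 i|].
      apply/seteqP; split => t /=.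
        by move/(norm_rV_gtP _ (ltW e0)) => [i ei]; exists i.
      by move=> [i _ ei]; apply/(norm_rV_gtP _ (ltW e0)); exists i.
    by apply: fin_bigcup_measurable => // i _; exact: mVgt.
  have mA := mVgt n e j.
  rewrite ger0_norm ?fine_ge0// (same_law_iid_law PE mA).
  have AB : [set t | e < `|@V n t ord0 j|] `<=` [set t | e < `|@V n t|].
    by move=> t /= et; apply/(norm_rV_gtP _ (ltW e0)); exists j.
  apply: fine_le; [exact: fin_num_measure|exact: fin_num_measure|].
  by apply: le_measure; rewrite ?inE.
pose Lint := (\int[L]_x (sin (x ord0 j))%:E)%E.
have cont : continuous (fun w : 'rV[R]_p => sin (w ord0 j)).
  move=> w; apply: (@continuous_comp _ _ _ (fun w : 'rV[R]_p => w ord0 j) (@sin R)).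
    exact: coord_continuous.
  exact: continuous_sin.
have sinB : exists B : R, forall w : 'rV[R]_p, `|sin (w ord0 j)| <= B.
  by exists 1 => w; exact: sin_max.
have L_cvg h := reg h _ cont sinB.
have msin : measurable_fun setT (@sin R).
  exact: continuous_measurable_fun (@continuous_sin R).
have W_cvgE h : (\int[iid_law (J (tstar + h * root_scale R n)%R) n]_t
    (sin (W n t))%:E)%E @[n --> \oo] --> Lint.
  (* By well-specification the centring [theta (J t)] equals [theta Pstar] as soon as [t] lies in
     [D], so the statistic [W] no longer involves [h]. *)
  apply: cvg_trans (L_cvg h); apply: near_eq_cvg.
  apply: filterS (path_D h) => n Dn; apply: eq_integral => t _.
  by rewrite !mxE /W (ws (DM _ Dn)).
have sWi h n : (iid_law (J (tstar + h * root_scale R n)) n).-integrable setT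
    (EFin \o (fun t => sin (W n t))).
  apply: (bounded_integrable _ (B := 1)); first exact: measurableT_comp msin (mW n).
  by move=> t; exact: sin_max.
have sWE h n : (\int[iid_law (J (tstar + h * root_scale R n)%R) n]_t
    (sin (W n t))%:E)%E =
    (\int[iid_law (J (tstar + h * root_scale R n)%R) n]_t sin (W n t))%:E.
  by rewrite /Rintegral fineK//; exact: integrable_fin_num (sWi h n).
have sW1 h n : `|\int[iid_law (J (tstar + h * root_scale R n)) n]_t sin (W n t)| <= 1.
  apply: norm_Rintegral_le => [|t]; last exact: sin_max.
  exact: measurableT_comp msin (mW n).
have Lint_fin : Lint \is a fin_num.
  have lo : ((-1)%:E <= Lint)%E.
    apply: (cvge_ge _ (W_cvgE 1)); apply: nearW => n.
    by rewrite sWE lee_fin; have := sW1 1 n; rewrite ler_norml => /andP[].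
  have hi : (Lint <= 1%:E)%E.
    apply: (cvge_le _ (W_cvgE 1)); apply: nearW => n.
    by rewrite sWE lee_fin; have := sW1 1 n; rewrite ler_norml => /andP[].
  by rewrite fin_numElt (lt_le_trans _ lo) ?ltNyr// (le_lt_trans hi) ?ltry.
have W_cvg h : \int[iid_law (J (tstar + h * root_scale R n)) n]_t sin (W n t)
    @[n --> \oo] --> fine Lint.
  by apply: fine_cvg; rewrite fineK//; exact: W_cvgE.
(* The quadratic-mean limit ranges over a punctured neighbourhood of [tstar], hence [h != 0], and
   [n > 0] because [root_scale] is 0 at 0. *)
have Qdqm h : h != 0 -> forall e : R, 0 < e -> \forall n \near \oo,
    (\int[mu]_z ((sqrt_density mu (J (tstar + h * root_scale R n)) z
       - sqrt_density mu (J tstar) z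
       - h * root_scale R n / 2 * s z.1 * sqrt_density mu (J tstar) z) ^+ 2)%:E
     <= (e * (h * root_scale R n) ^+ 2)%:E)%E.
  move=> h0 e e0; move/dqmP : sdqm => /(_ e e0) near_t.
  have := path_cvg h _ near_t; rewrite /=.
  apply: filterS2 (nbhs_infty_gt 0%N) => n n0 /=.
  have -> : tstar + h * root_scale R n - tstar = h * root_scale R n.
    by rewrite addrAC subrr add0r.
  by apply; rewrite -subr_eq0 addrAC subrr add0r mulf_neq0// invr_neq0// gt_eqF// sqrtr_gt0 ltr0n.
have tau0 : tau = 0.
  apply: (sin_slope_eq0 (l := fine Lint) (K := expR (- k))
    (C := 8 + 2 * \int[J tstar]_z (s z.1 ^+ 2))); first exact: expR_gt0.
  move=> h h0.
  have Qmu : \forall n \near \oo, J (tstar + h * root_scale R n) `<< mu.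
    by apply: filterS (path_D h) => n; exact: Jmu.
  apply: (local_sin_bias (Jmu _ Dtstar) Qmu f2J f0J s2J (Qdqm h h0) mW W_S (W_cvg h)).
rewrite -(integral_fst_mul sX2 f2) -(same_law_integral _ PE).
rewrite -[LHS]fineK; last first.
  by apply: integrable_fin_num => //; exact: Lfun2_integrable_mul s2J f2J.
by rewrite -[fine _]/tau tau0.
Qed.

(** The conditional mean is itself centred and square integrable, hence in the closed span of the
    marginal scores; being orthogonal to all of them, it is orthogonal to itself. *)
Lemma cmean_influence_eq0 (j : 'I_p) : tangent_space nu MX PXstar = L20 PXstar ->
  {ae PXstar, forall x, cmean kstar (fun z => psi z ord0 j) x = 0}.
Proof.
move=> tangentE; have [psiL _] := That_al; have [f2 f0] := psiL j.
have g2 := cmean_Lfun2 f2.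
have gL : L20 PXstar (cmean kstar (fun z => psi z ord0 j)).
  split => //; move: f0; rewrite !unlock => <-.
  by have [_ <-] := integral_cmean (Lfun2_integrable f2).
rewrite -tangentE in gL.
apply: integral_sqr_eq0; first by have /Lfun2P[] := g2.
apply: (tangent_space_orthogonal g2 gL) => s ss.
rewrite -[RHS](regular_influence_orthogonal j ss).
by apply: eq_integral => x _; rewrite mulrC.
Qed.

End regular_estimator.

Lemma cond_exp_vec_eq0 (R : realType) d d' (X : measurableType d)
    (Y : measurableType d') (PX : probability X R) (k : R.-pker X ~> Y) p
    (f : X * Y -> 'rV[R]_p) (g : X -> 'rV[R]_p) :
  L20_vec (joint_law PX k) f ->
  (forall j, {ae PX, forall x, cmean k (fun z => f z ord0 j) x = 0}) ->
  is_cond_exp_vec (joint_law PX k) f g -> {ae PX, forall x, g x = 0}.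
Proof.
move=> fL f0 fg.
have : {ae PX, forall x, forall j, g x ord0 j = 0}.
  apply: filter_forall => j; have [f2 _] := fL j.
  exact: cond_exp_eq0 (Lfun2_integrable f2) (f0 j) (fg j).
by apply: filterS => x gx0; apply/rowP => j; rewrite gx0 mxE.
Qed.

Theorem theorem3p2 (R : realType) (dX dY : measure_display)
    (X : measurableType dX) (Y : measurableType dY)
    (mu : {sigma_finite_measure set (X * Y)%type -> \bar R})
    (nu : {sigma_finite_measure set X -> \bar R})
    (MX : set (probability X R)) (MK : set (R.-pker X ~> Y))
    (PXstar : probability X R) (kstar : R.-pker X ~> Y)
    (p : nat) (Theta : set 'rV[R]_p)
    (theta : probability (X * Y)%type R -> 'rV[R]_p)
    (Omega : metricType R) (eta : probability (X * Y)%type R -> Omega)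
    (phi : Omega -> X * Y -> 'rV[R]_p) :
  let M := joint_model MX MK in
  let Pstar := joint_law PXstar kstar in
  let etastar := eta Pstar in
  (forall P, M P -> P `<< mu) ->
  (forall PX, MX PX -> PX `<< nu) ->
  MX PXstar -> MK kstar ->
  (forall P, M P -> Theta (theta P)) ->
  is_eif mu M Pstar theta (phi etastar) ->
  well_specified theta kstar MX PXstar ->
  (forall g : X -> 'rV[R]_p, is_cond_exp_vec Pstar (phi etastar) g ->
     {ae PXstar, forall x, g x = 0}) /\
  (tangent_space nu MX PXstar = L20 PXstar ->
   forall (psi : Omega -> X * Y -> 'rV[R]_p)
          (That : forall n, n.-tuple (X * Y)%type -> 'rV[R]_p),
     is_estimator That ->
     is_asymp_linear Pstar (theta Pstar) That (psi etastar) ->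
     is_regular mu M Pstar theta That ->
     forall g : X -> 'rV[R]_p, is_cond_exp_vec Pstar (psi etastar) g ->
       {ae PXstar, forall x, g x = 0}).
Proof.
move=> M Pstar etastar Mmu MXnu MXstar MKstar _ eif ws; split.
  move=> g gE; have [[phiL _] _] := eif.
  apply: cond_exp_vec_eq0 phiL _ gE => j.
  exact: (cmean_eif_eq0 Mmu MXnu MXstar MKstar j eif ws).
move=> tangentE psi That That_est That_al That_reg g gE.
have [psiL _] := That_al; apply: cond_exp_vec_eq0 psiL _ gE => j.
exact: (cmean_influence_eq0 Mmu MXnu MKstar ws That_est That_al That_reg j tangentE).
Qed.
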